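(* Fix $p>4$. There exists $\varepsilon>0$ such that, if $J_c-\varepsilon<J<J_c$, the following holds. Let $\underline s$ be an infinite volume ground state that is invariant under translation by a vector $\mathbf n=(n_1,n_2)\in\mathbb Z^2$. Then there exist integers $k_1<k_2$ such that, with $\mathbf n_\perp=(-n_2,n_1)$ and $\mathcal I_{k_1,k_2}(\mathbf n)=\{x\in\mathbb Z^2:\ x\cdot\mathbf n_\perp\in[k_1,k_2]\}$, the configuration $\underline s$ coincides, on each of the two infinite connected components of $\mathbb Z^2\setminus\mathcal I_{k_1,k_2}(\mathbf n)$, with an optimal periodic striped configuration (possibly a different one on each component).
   Context: Work on $\mathbb Z^2$ with $p>4$ and a coupling $J>0$. For $\underline\sigma\in\{\pm1\}^{\mathbb Z^2}$ the formal Hamiltonian is $H(\underline\sigma)=-J\sum_{\langle x,y\rangle}(\sigma_x\sigma_y-1)+\sum_{\{x,y\}}\frac{\sigma_x\sigma_y-1}{|x-y|^p}$, where the first sum is over nearest-neighbour pairs and the second over unordered pairs of distinct sites. For a finite $X\subset\mathbb Z^2$, $\underline\sigma_X\in\{\pm1\}^X$ and $\underline s\in\{\pm1\}^{\mathbb Z^2}$, set $H_X(\underline\sigma_X|\underline s)=-J\sum_{\langle x,y\rangle,\,x,y\in X}(\sigma_x\sigma_y-1)+\sum_{\{x,y\}\subset X}\frac{\sigma_x\sigma_y-1}{|x-y|^p}-J\sum_{x\in X,y\in X^c,|x-y|=1}(\sigma_xs_y-1)+\sum_{x\in X,y\in X^c}\frac{\sigma_xs_y-1}{|x-y|^p}$.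 A configuration $\underline s$ is an infinite volume ground state if $H_X(\underline\sigma_X|\underline s)-H_X(\underline s_X|\underline s)\ge0$ for every finite $X$ and every $\underline\sigma_X\in\{\pm1\}^X$ ($\underline s_X$ is the restriction of $\underline s$ to $X$). Let $J_c=\sum_{y_1>0,\,y_2\in\mathbb Z}\frac{y_1}{(y_1^2+y_2^2)^{p/2}}$. For $h\in\mathbb N$ let $\underline\sigma^{(h)}$ be given by $\sigma^{(h)}_x=\mathrm{sign}(\sin(\pi(x_1+1/2)/h))$, and let $e_{\rm s}(h)=\frac1{2h}\sum_{x_1=0}^{2h-1}\Big[-\frac J2\sum_{y:|y-x|=1}(\sigma_x\sigma_y-1)+\frac12\sum_{y\ne x}\frac{\sigma_x\sigma_y-1}{|x-y|^p}\Big]$ with $x=(x_1,0)$, $\underline\sigma=\underline\sigma^{(h)}$ (its energy per site). The optimal periodic striped configurations are the configurations $\underline\sigma^{(h^* )}$, for $h^*$ a minimizer of $e_{\rm s}$ over $\mathbb N$, together with their images under lattice translations and rotation by $\pi/2$. *)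

(* Defs.v *)
From Stdlib Require Import Reals Lra ZArith List.
From Coquelicot Require Import Coquelicot.
Open Scope R_scope.

Definition site := (Z * Z)%type.
Definition config := site -> bool.
Definition spin (s : config) (x : site) : R := if s x then 1 else -1.

Definition site_eqb (x y : site) : bool :=
  Z.eqb (fst x) (fst y) && Z.eqb (snd x) (snd y).
Definition memb (x : site) (X : list site) : bool := existsb (site_eqb x) X.

Definition dist2 (x y : site) : Z :=
  ((fst x - fst y) ^ 2 + (snd x - snd y) ^ 2)%Z.
Definition distp (p : R) (x y : site) : R := Rpower (IZR (dist2 x y)) (p / 2).

Definition neighbours (x : site) : list site :=
  ((fst x + 1)%Z, snd x) :: ((fst x - 1)%Z, snd x) ::
  (fst x, (snd x + 1)%Z) :: (fst x, (snd x - 1)%Z) :: nil.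

Definition lsum {A : Type} (f : A -> R) (l : list A) : R :=
  fold_right Rplus 0 (map f l).

(** Sums over Z^2: limit of the partial sums over the boxes [-N,N]^2.
    (All the sums used below are absolutely convergent for p > 2, so this
    is the value of the unconditional sum.) *)
Definition zrange (N : nat) : list Z :=
  map (fun k => (Z.of_nat k - Z.of_nat N)%Z) (seq 0 (2 * N + 1)).
Definition box (N : nat) : list site := list_prod (zrange N) (zrange N).
Definition zsum2 (g : site -> R) : R :=
  real (Lim_seq (fun N => lsum g (box N))).

Fixpoint upairs {A : Type} (l : list A) : list (A * A) :=
  match l with
  | nil => nil
  | a :: l' => map (fun b => (a, b)) l' ++ upairs l'
  end.

(** H_X(sigma_X | s): sigma is only used on X, s only on X^c. *)
Definition HX (J p : R) (X : list site) (sigma s : config) : R :=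
  - J * lsum (fun xy => if Z.eqb (dist2 (fst xy) (snd xy)) 1
                        then spin sigma (fst xy) * spin sigma (snd xy) - 1 else 0)
             (upairs X)
  + lsum (fun xy => (spin sigma (fst xy) * spin sigma (snd xy) - 1)
                    / distp p (fst xy) (snd xy)) (upairs X)
  - J * lsum (fun x => lsum (fun y => if memb y X then 0
                                     else spin sigma x * spin s y - 1)
                            (neighbours x)) X
  + lsum (fun x => zsum2 (fun y => if memb y X then 0
                                  else (spin sigma x * spin s y - 1) / distp p x y)) X.

Definition ground_state (J p : R) (s : config) : Prop :=
  forall (X : list site), NoDup X ->
  forall sigma : config, HX J p X sigma s - HX J p X s s >= 0.

Definition Jc (p : R) : R :=
  zsum2 (fun y => if Z.ltb 0 (fst y)
                  then IZR (fst y) / Rpower (IZR ((fst y) ^ 2 + (snd y) ^ 2)%Z) (p / 2)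
                  else 0).

(** Striped configuration sigma^(h)_x = sign(sin(pi (x1 + 1/2) / h)).
    (The sine never vanishes for h >= 1, so sign takes values +-1.) *)
Definition stripe (h : nat) : config :=
  fun x => if Rlt_dec 0 (sin (PI * (IZR (fst x) + / 2) / INR h)) then true else false.

Definition e_s (J p : R) (h : nat) : R :=
  / (2 * INR h) *
  lsum (fun k : nat =>
          let x : site := (Z.of_nat k, 0%Z) in
          - (J / 2) * lsum (fun y => spin (stripe h) x * spin (stripe h) y - 1)
                           (neighbours x)
          + / 2 * zsum2 (fun y => if site_eqb y x then 0
                                 else (spin (stripe h) x * spin (stripe h) y - 1)
                                      / distp p x y))
       (seq 0 (2 * h)).

Definition es_minimizer (J p : R) (hs : nat) : Prop :=
  (1 <= hs)%nat /\ forall h : nat, (1 <= h)%nat -> e_s J p hs <= e_s J p h.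

Definition rot (x : site) : site := ((- snd x)%Z, fst x).

(** Optimal periodic striped configurations: sigma^(hs) for a minimiser hs,
    and its images under the group generated by lattice translations and
    the rotation by pi/2 (i.e. x |-> rot^k x + t). *)
Definition optimal_striped (J p : R) (t : config) : Prop :=
  exists hs : nat, es_minimizer J p hs /\
  exists (k : nat) (a : site),
    forall x : site,
      t x = stripe hs (((fst (Nat.iter k rot x) + fst a)%Z,
                        (snd (Nat.iter k rot x) + snd a)%Z)).

Definition translation_invariant (s : config) (n : site) : Prop :=
  forall x : site, s ((fst x + fst n)%Z, (snd x + snd n)%Z) = s x.

Definition dot_perp (x n : site) : Z := (- fst x * snd n + snd x * fst n)%Z.

(* Main.v *)
(** Writing the indicator of opposite spins at x, y through the third corner
    (y1, x2) of their rectangle splits the energy of a square into one-dimensional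
    energies of its rows and columns, plus a nonnegative term charging at least
    2^(-p/2) to every corner, that is, every site differing both from a horizontal
    and from a vertical neighbour.

    The interaction of the walls of a row is a mixture of exponentials q^r, because
    |1 - e^(-d(z+in))|^(-p) d^p tends to (z^2+n^2)^(-p/2) as d -> 0 and is a positive
    combination of damped waves, while the sums over n are Fejer sums.  For q^r the
    energy of a chain of gaps is bounded below by the sum of the energies of the
    periodic chains, with a quadratic remainder that penalises unequal adjacent gaps.

    A row run meeting a column run of length at most D forces a corner nearby, so
    discarding all such runs costs O(tau D) per corner, tau = J_c - J.  With D of the order
    tau / |e*|, where e* is the minimal stripe energy per site, tau D -> 0 since p > 4:
    this is beaten by the corner energy, and afterwards every site
    has energy at least e*, strictly more unless it lies in a run of optimal width.

    Comparing a ground state with optimal stripes in squares of side L bounds by O(L)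
    the number of defects: corners, sites outside optimal runs, adjacent optimal
    runs of different widths.  For a state invariant under n only finitely many n-orbits of
    defects are possible, and in a half-plane without defects the state is striped. *)

Require Import Defs.
From Stdlib Require Import Reals Lra Lia Psatz ZArith List Bool Sorted.
From Stdlib Require Import Classical ClassicalEpsilon FunctionalExtensionality.
From Coquelicot Require Import Coquelicot.
Import ListNotations.
Open Scope R_scope.

(** * Finite sums *)

(** The mixture of exponentials is never built as a measure. It is encoded by duality: a finite
    linear inequality valid for every sequence q^k with 0 <= q <= 1 must hold for the kernel. Such
    inequalities survive sums, shifts and pointwise limits, so each estimate is algebra for a single
    q, then transferred. This dictates that the penalty for unequal gaps be polynomial in q and that
    periodic energies be truncated before the transfer.

    p > 4 enters through the second moment of the kernel summed along lines. A stripe of width d has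
    energy at most -tau plus 1/d times the tail of this moment beyond d. Hence a width proportional
    to 1/tau makes |e*| exceed a prescribed multiple of tau^2 for small tau, and with D near 3 tau /
    |e*| the product tau D is a prescribed fraction of the corner energy. The constants 48, 96 and
    384 only realise this.

    The lower bound and the comparison with stripes must agree up to O(L). Rows are therefore taken
    with free ends, which costs one wall per row, and the trial stripes fill squares that hold a
    whole number of periods. *)

Definition ind (b : bool) : R := if b then 1 else 0.
Definition Sg (n : nat) (f : nat -> R) : R := lsum f (seq 0 n).

Lemma ind_nonneg b : 0 <= ind b.
Proof. destruct b; simpl; lra. Qed.

Lemma ind_le1 b : ind b <= 1.
Proof. destruct b; simpl; lra. Qed.

Section ListSums.
Context {A : Type}.
Implicit Types (f g : A -> R) (l : list A).

Lemma lsum_cons f a l : lsum f (a :: l) = f a + lsum f l.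
Proof. reflexivity. Qed.

Lemma lsum_app f l l' : lsum f (l ++ l') = lsum f l + lsum f l'.
Proof.
  induction l as [|a l IH]; simpl.
  - unfold lsum; simpl; lra.
  - rewrite !lsum_cons, IH; lra.
Qed.

Lemma lsum_ext_in f g l : (forall x, In x l -> f x = g x) -> lsum f l = lsum g l.
Proof.
  induction l as [|a l IH]; intros H; [reflexivity|].
  rewrite !lsum_cons, H, IH; auto with datatypes.
Qed.

Lemma lsum_ext f g l : (forall x, f x = g x) -> lsum f l = lsum g l.
Proof. intros; apply lsum_ext_in; auto. Qed.

Lemma lsum_le_in f g l : (forall x, In x l -> f x <= g x) -> lsum f l <= lsum g l.
Proof.
  induction l as [|a l IH]; intros H; [unfold lsum; simpl; lra|].
  rewrite !lsum_cons.
  assert (f a <= g a) by auto with datatypes.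
  assert (lsum f l <= lsum g l) by auto with datatypes.
  lra.
Qed.

Lemma lsum_zero l : lsum (fun _ : A => 0) l = 0.
Proof. induction l; [reflexivity|]. rewrite lsum_cons, IHl; lra. Qed.

Lemma lsum_zero_in f l : (forall x, In x l -> f x = 0) -> lsum f l = 0.
Proof. intros H. rewrite (lsum_ext_in f (fun _ => 0)); auto using lsum_zero. Qed.

Lemma lsum_nonneg f l : (forall x, In x l -> 0 <= f x) -> 0 <= lsum f l.
Proof. intros H. rewrite <- (lsum_zero l). apply lsum_le_in; auto. Qed.

Lemma lsum_nonpos f l : (forall x, In x l -> f x <= 0) -> lsum f l <= 0.
Proof. intros H. rewrite <- (lsum_zero l). apply lsum_le_in; auto. Qed.

Lemma lsum_plus f g l : lsum (fun x => f x + g x) l = lsum f l + lsum g l.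
Proof. induction l; [unfold lsum; simpl; lra|]. rewrite !lsum_cons, IHl; lra. Qed.

Lemma lsum_minus f g l : lsum (fun x => f x - g x) l = lsum f l - lsum g l.
Proof. induction l; [unfold lsum; simpl; lra|]. rewrite !lsum_cons, IHl; lra. Qed.

Lemma lsum_scal c f l : lsum (fun x => c * f x) l = c * lsum f l.
Proof. induction l; [unfold lsum; simpl; lra|]. rewrite !lsum_cons, IHl; lra. Qed.

Lemma lsum_scal_r c f l : lsum (fun x => f x * c) l = lsum f l * c.
Proof. induction l; [unfold lsum; simpl; lra|]. rewrite !lsum_cons, IHl; lra. Qed.

Lemma lsum_const c l : lsum (fun _ : A => c) l = INR (length l) * c.
Proof.
  induction l; [unfold lsum; simpl; lra|].
  rewrite lsum_cons, IHl. change (length (a :: l)) with (S (length l)). rewrite S_INR; lra.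
Qed.

Lemma lsum_filter (P : A -> bool) f l :
  lsum f (filter P l) = lsum (fun x => if P x then f x else 0) l.
Proof.
  induction l as [|a l IH]; [reflexivity|].
  simpl filter. rewrite lsum_cons. destruct (P a); rewrite ?lsum_cons, IH; lra.
Qed.

Lemma lsum_in_le f l a : (forall x, In x l -> 0 <= f x) -> In a l -> f a <= lsum f l.
Proof.
  induction l as [|b l IH]; intros H Hin; [destruct Hin|].
  rewrite lsum_cons. destruct Hin as [->|Hin].
  - assert (0 <= lsum f l) by (apply lsum_nonneg; auto with datatypes). lra.
  - assert (0 <= f b) by auto with datatypes.
    assert (f a <= lsum f l) by auto with datatypes. lra.
Qed.

Lemma lsum_incl f l l' : NoDup l -> incl l l' ->
  (forall x, In x l' -> 0 <= f x) -> lsum f l <= lsum f l'.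
Proof.
  intros Hnd. revert l'. induction Hnd as [|a l Ha Hnd IH]; intros l' Hi Hp.
  - unfold lsum at 1; simpl. now apply lsum_nonneg.
  - destruct (in_split a l') as [l1 [l2 ->]]; [apply Hi; now left|].
    rewrite lsum_app, !lsum_cons.
    assert (lsum f l <= lsum f (l1 ++ l2)).
    { apply IH.
      - intros x Hx. assert (In x (l1 ++ a :: l2)) as Hx' by (apply Hi; now right).
        apply in_app_or in Hx'. apply in_or_app. destruct Hx' as [?|[->|?]]; auto. contradiction.
      - intros x Hx. apply Hp. apply in_app_or in Hx. apply in_or_app; destruct Hx; auto with datatypes. }
    rewrite lsum_app in H. lra.
Qed.

End ListSums.

Lemma lsum_map {A B} (h : B -> A) (f : A -> R) (lb : list B) : lsum f (map h lb) = lsum (fun x => f (h x)) lb.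
Proof. unfold lsum. now rewrite map_map. Qed.

Lemma lsum_swap {A B} (h : A -> B -> R) (l : list A) (lb : list B) :
  lsum (fun x => lsum (fun y => h x y) lb) l = lsum (fun y => lsum (fun x => h x y) l) lb.
Proof.
  induction l as [|a l IH].
  - unfold lsum at 1; simpl. now rewrite lsum_zero_in.
  - rewrite lsum_cons, IH, <- lsum_plus. reflexivity.
Qed.

Lemma lsum_list_prod {A B} (h : A * B -> R) (l : list A) (lb : list B) :
  lsum h (list_prod l lb) = lsum (fun x => lsum (fun y => h (x, y)) lb) l.
Proof.
  induction l as [|a l IH]; [reflexivity|].
  simpl list_prod. rewrite lsum_app, IH, lsum_map. reflexivity.
Qed.


Lemma is_lim_seq_lsum {A} (F : nat -> A -> R) (G : A -> R) (l : list A) :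
  (forall x, In x l -> is_lim_seq (fun n => F n x) (G x)) ->
  is_lim_seq (fun n => lsum (F n) l) (lsum G l).
Proof.
  induction l as [|a l IH]; intros H.
  - apply is_lim_seq_const.
  - apply (is_lim_seq_ext (fun n => F n a + lsum (F n) l)); [reflexivity|].
    apply (is_lim_seq_plus' _ _ (G a) (lsum G l)); auto with datatypes.
Qed.

Lemma Sg_S n f : Sg (S n) f = Sg n f + f n.
Proof. unfold Sg. rewrite seq_S, lsum_app. unfold lsum at 2; simpl. lra. Qed.

Lemma Sg_0 f : Sg 0 f = 0.
Proof. reflexivity. Qed.

Lemma Sg_ext n f g : (forall i, (i < n)%nat -> f i = g i) -> Sg n f = Sg n g.
Proof. intros H. apply lsum_ext_in. intros x Hx. apply in_seq in Hx. apply H; lia. Qed.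

Lemma Sg_le n f g : (forall i, (i < n)%nat -> f i <= g i) -> Sg n f <= Sg n g.
Proof. intros H. apply lsum_le_in. intros x Hx. apply in_seq in Hx. apply H; lia. Qed.

Lemma Sg_nonneg n f : (forall i, (i < n)%nat -> 0 <= f i) -> 0 <= Sg n f.
Proof. intros H. apply lsum_nonneg. intros x Hx. apply in_seq in Hx. apply H; lia. Qed.

Lemma Sg_plus n f g : Sg n (fun i => f i + g i) = Sg n f + Sg n g.
Proof. apply lsum_plus. Qed.

Lemma Sg_minus n f g : Sg n (fun i => f i - g i) = Sg n f - Sg n g.
Proof. apply lsum_minus. Qed.

Lemma Sg_scal n c f : Sg n (fun i => c * f i) = c * Sg n f.
Proof. apply lsum_scal. Qed.

Lemma Sg_scal_r n c f : Sg n (fun i => f i * c) = Sg n f * c.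
Proof. apply lsum_scal_r. Qed.

Lemma Sg_const n c : Sg n (fun _ => c) = INR n * c.
Proof. unfold Sg. now rewrite lsum_const, length_seq. Qed.

Lemma Sg_zero n f : (forall i, (i < n)%nat -> f i = 0) -> Sg n f = 0.
Proof. intros H. rewrite (Sg_ext _ _ (fun _ => 0)) by auto. rewrite Sg_const; lra. Qed.

Lemma Sg_swap n m (h : nat -> nat -> R) :
  Sg n (fun i => Sg m (fun j => h i j)) = Sg m (fun j => Sg n (fun i => h i j)).
Proof. apply lsum_swap. Qed.

Lemma Sg_add n m f : Sg (n + m) f = Sg n f + Sg m (fun k => f (n + k)%nat).
Proof.
  induction m as [|m IH].
  - rewrite Nat.add_0_r, Sg_0; lra.
  - rewrite Nat.add_succ_r, !Sg_S, IH; lra.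
Qed.

Lemma Sg_head n f : Sg (S n) f = f 0%nat + Sg n (fun k => f (S k)).
Proof. change (S n) with (1 + n)%nat. rewrite Sg_add, Sg_S, Sg_0. simpl. lra. Qed.

Lemma Sg_rev n f : Sg n f = Sg n (fun k => f (n - 1 - k)%nat).
Proof.
  induction n as [|n IH]; [reflexivity|].
  rewrite Sg_S, IH, Sg_head.
  replace (S n - 1 - 0)%nat with n by lia.
  rewrite Rplus_comm. f_equal. apply Sg_ext; intros i Hi. f_equal. lia.
Qed.

Lemma Sg_mono n m f : (n <= m)%nat -> (forall i, (i < m)%nat -> 0 <= f i) -> Sg n f <= Sg m f.
Proof.
  intros H Hp. replace m with (n + (m - n))%nat by lia. rewrite Sg_add.
  assert (0 <= Sg (m - n) (fun k => f (n + k)%nat)) by (apply Sg_nonneg; intros; apply Hp; lia). lra.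
Qed.

Lemma Sg_in_le n f a : (forall i, (i < n)%nat -> 0 <= f i) -> (a < n)%nat -> f a <= Sg n f.
Proof.
  intros H Ha. apply lsum_in_le; [|apply in_seq; lia].
  intros x Hx; apply in_seq in Hx; apply H; lia.
Qed.

Lemma Sg_interval n a b :
  Sg n (fun i => ind ((a <=? i) && (i <? b))) = INR (Nat.min b n - a).
Proof.
  induction n as [|n IH].
  - rewrite Sg_0. now rewrite Nat.min_0_r.
  - rewrite Sg_S, IH. destruct (Nat.leb_spec a n); destruct (Nat.ltb_spec n b); simpl.
    + replace (Nat.min b (S n) - a)%nat with (S (Nat.min b n - a))%nat by lia. rewrite S_INR; lra.
    + replace (Nat.min b (S n) - a)%nat with (Nat.min b n - a)%nat by lia; lra.
    + replace (Nat.min b (S n) - a)%nat with (Nat.min b n - a)%nat by lia; lra.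
    + replace (Nat.min b (S n) - a)%nat with (Nat.min b n - a)%nat by lia; lra.
Qed.

Lemma Sg_delta n a c : Sg n (fun i => if Nat.eqb i a then c else 0) = if (a <? n)%nat then c else 0.
Proof.
  induction n as [|n IH]; [reflexivity|].
  rewrite Sg_S, IH. destruct (Nat.eqb_spec n a); destruct (Nat.ltb_spec a n); destruct (Nat.ltb_spec a (S n)); try lia; lra.
Qed.

(** * Series and limits of sequences *)

Definition nsum (f : nat -> R) : R := real (Lim_seq (fun n => Sg n f)).

Lemma nsum_lim f M : (forall n, 0 <= f n) -> (forall n, Sg n f <= M) ->
  is_lim_seq (fun n => Sg n f) (nsum f).
Proof.
  intros H0 HM. apply Lim_seq_correct'. apply (ex_finite_lim_seq_incr _ M); auto.
  intros n; rewrite Sg_S. specialize (H0 n); lra.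
Qed.

Lemma Sg_le_lim f (L : R) : (forall n, 0 <= f n) -> is_lim_seq (fun n => Sg n f) L -> forall n, Sg n f <= L.
Proof.
  intros H0 HL. apply is_lim_seq_incr_compare; auto.
  intros n; rewrite Sg_S. specialize (H0 n); lra.
Qed.

Lemma lim_le_const (u : nat -> R) (l M : R) : is_lim_seq u l -> (forall n, u n <= M) -> l <= M.
Proof. intros H HM. exact (is_lim_seq_le u (fun _ => M) l M HM H (is_lim_seq_const M)). Qed.

Lemma lim_ge_const (u : nat -> R) (l M : R) : is_lim_seq u l -> (forall n, M <= u n) -> M <= l.
Proof. intros H HM. exact (is_lim_seq_le (fun _ => M) u M l HM (is_lim_seq_const M) H). Qed.

Lemma lim_ge_const_loc (u : nat -> R) (l M : R) N :
  is_lim_seq u l -> (forall n, (N <= n)%nat -> M <= u n) -> M <= l.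
Proof.
  intros H HM. refine (is_lim_seq_le_loc (fun _ => M) u M l _ (is_lim_seq_const M) H).
  exists N; auto.
Qed.

Lemma lim_eps (u : nat -> R) (l : R) : is_lim_seq u l <->
  (forall eps : R, 0 < eps -> exists N, forall n, (N <= n)%nat -> Rabs (u n - l) < eps).
Proof.
  split.
  - intros H eps He. apply is_lim_seq_spec in H. destruct (H (mkposreal eps He)) as [N HN].
    exists N; exact HN.
  - intros H. apply is_lim_seq_spec. intros [eps He]. destruct (H eps He) as [N HN]. exists N; exact HN.
Qed.

(** Dominated convergence with a moving cutoff: finitely many terms converge to those of [A], and
    the rest is at most a tail of the convergent series of [A]. It identifies limits over growing
    boxes with iterated sums. *)
Lemma diag_limit (a : nat -> nat -> R) (A : nat -> R) (m : nat -> nat) (L : R) :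
  (forall N z, 0 <= a N z <= A z) ->
  (forall z, is_lim_seq (fun N => a N z) (A z)) ->
  is_lim_seq (fun n => Sg n A) L ->
  (forall M, exists N0, forall N, (N0 <= N)%nat -> (M <= m N)%nat) ->
  is_lim_seq (fun N => Sg (m N) (a N)) L.
Proof.
  intros Hb Hc HL Hm. apply lim_eps. intros eps He.
  assert (HA : forall z, 0 <= A z) by (intros z; destruct (Hb 0%nat z); lra).
  assert (Hup := Sg_le_lim A L HA HL).
  destruct (proj1 (lim_eps _ _) HL (eps / 2) ltac:(lra)) as [M HM].
  specialize (HM M (le_n _)).
  assert (Hfin : is_lim_seq (fun N => Sg M (a N)) (Sg M A)) by (apply is_lim_seq_lsum; auto).
  destruct (proj1 (lim_eps _ _) Hfin (eps / 2) ltac:(lra)) as [N1 HN1].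
  destruct (Hm M) as [N0 HN0].
  exists (Nat.max N0 N1). intros n Hn.
  specialize (HN1 n ltac:(lia)). specialize (HN0 n ltac:(lia)).
  assert (Sg M (a n) <= Sg (m n) (a n)) by (apply Sg_mono; auto; intros; apply Hb).
  assert (Sg (m n) (a n) <= Sg (m n) A) by (apply Sg_le; intros; apply Hb).
  specialize (Hup (m n)).
  apply Rabs_def1; apply Rabs_def2 in HM; apply Rabs_def2 in HN1; lra.
Qed.

Lemma Rdiv_ge a b c : 0 < c -> a * c <= b -> a <= b / c.
Proof.
  intros Hc H. apply Rmult_le_reg_r with c; auto.
  replace (b / c * c) with b by (field; lra). exact H.
Qed.

Lemma Rdiv_le a b c : 0 < c -> a <= b * c -> a / c <= b.
Proof.
  intros Hc H. apply Rmult_le_reg_r with c; auto.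
  replace (a / c * c) with a by (field; lra). exact H.
Qed.

(** * Moment sequences and the chessboard estimate *)

Definition lincomb (P : list (R * nat)) (f : nat -> R) : R :=
  lsum (fun ck => fst ck * f (snd ck)) P.

(** Dual form of the statement that [V k] is the integral of q^k against a positive measure on
    [0,1]. In this form the class is visibly closed under pointwise limits, and an inequality
    between finite combinations need only be checked on the sequences q^k. *)
Definition moment_cone (V : nat -> R) : Prop :=
  forall P, (forall q, 0 <= q <= 1 -> 0 <= lincomb P (pow q)) -> 0 <= lincomb P V.

Definition finite_functional (L : (nat -> R) -> R) : Prop :=
  exists P, forall f, L f = lincomb P f.

Lemma finite_functional_eval k : finite_functional (fun f => f k).
Proof. exists [(1, k)]. intros f. unfold lincomb, lsum; simpl; lra. Qed.

Lemma finite_functional_zero : finite_functional (fun _ => 0).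
Proof. exists []. intros f. reflexivity. Qed.

Lemma finite_functional_plus L M :
  finite_functional L -> finite_functional M -> finite_functional (fun f => L f + M f).
Proof.
  intros [P HP] [Q HQ]. exists (P ++ Q). intros f.
  rewrite HP, HQ. unfold lincomb. now rewrite lsum_app.
Qed.

Lemma finite_functional_scal c L :
  finite_functional L -> finite_functional (fun f => c * L f).
Proof.
  intros [P HP]. exists (map (fun ck => (c * fst ck, snd ck)) P). intros f.
  rewrite HP. unfold lincomb. rewrite lsum_map, <- lsum_scal. apply lsum_ext; intros; simpl; ring.
Qed.

Lemma finite_functional_minus L M :
  finite_functional L -> finite_functional M -> finite_functional (fun f => L f - M f).
Proof.
  intros HL HM. destruct (finite_functional_plus _ _ HL (finite_functional_scal (-1) _ HM)) as [P HP].
  exists P. intros f. rewrite <- HP. lra.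
Qed.

Lemma finite_functional_Sg n (L : nat -> (nat -> R) -> R) :
  (forall i, finite_functional (L i)) -> finite_functional (fun f => Sg n (fun i => L i f)).
Proof.
  intros H. induction n as [|n IH].
  - exact finite_functional_zero.
  - destruct (finite_functional_plus _ _ IH (H n)) as [P HP]. exists P.
    intros f. rewrite Sg_S. apply HP.
Qed.

Lemma moment_cone_functional V L :
  moment_cone V -> finite_functional L ->
  (forall q, 0 <= q <= 1 -> 0 <= L (pow q)) -> 0 <= L V.
Proof. intros HV [P HP] H. rewrite HP. apply HV. intros q Hq. rewrite <- HP. auto. Qed.

Lemma moment_cone_lim (F : nat -> nat -> R) (V : nat -> R) :
  (forall n, moment_cone (F n)) -> (forall k, is_lim_seq (fun n => F n k) (V k)) -> moment_cone V.
Proof.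
  intros HF Hl P HP. apply (lim_ge_const (fun n => lincomb P (F n))).
  - apply (is_lim_seq_lsum (fun n ck => fst ck * F n (snd ck)) (fun ck => fst ck * V (snd ck))).
    intros [c k] _. simpl. apply (is_lim_seq_mult' (fun _ => c)); [apply is_lim_seq_const|apply Hl].
  - intros n. apply HF; auto.
Qed.

Lemma moment_cone_ext V W : (forall k, V k = W k) -> moment_cone V -> moment_cone W.
Proof.
  intros H HV P HP. unfold lincomb. rewrite (lsum_ext _ (fun ck => fst ck * V (snd ck))).
  - apply HV; auto.
  - intros; now rewrite H.
Qed.

Lemma moment_cone_zero : moment_cone (fun _ => 0).
Proof. intros P _. unfold lincomb. rewrite lsum_zero_in; [lra|]. intros; ring. Qed.

Lemma moment_cone_plus V W : moment_cone V -> moment_cone W -> moment_cone (fun k => V k + W k).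
Proof.
  intros HV HW P HP. unfold lincomb.
  rewrite (lsum_ext _ (fun ck => fst ck * V (snd ck) + fst ck * W (snd ck))) by (intros; ring).
  rewrite lsum_plus. specialize (HV P HP); specialize (HW P HP). unfold lincomb in *; lra.
Qed.

Lemma moment_cone_scal c V : 0 <= c -> moment_cone V -> moment_cone (fun k => c * V k).
Proof.
  intros Hc HV P HP. unfold lincomb.
  rewrite (lsum_ext _ (fun ck => c * (fst ck * V (snd ck)))) by (intros; ring).
  rewrite lsum_scal. specialize (HV P HP). unfold lincomb in *; nra.
Qed.

Lemma moment_cone_shift m V : moment_cone V -> moment_cone (fun k => V (k + m)%nat).
Proof.
  intros HV P HP.
  assert (Heq : forall f, lincomb P (fun k => f (k + m)%nat) = lincomb (map (fun ck => (fst ck, (snd ck + m)%nat)) P) f).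
  { intros f. unfold lincomb. now rewrite lsum_map. }
  rewrite Heq. apply HV. intros q Hq. rewrite <- Heq.
  unfold lincomb. rewrite (lsum_ext _ (fun ck => (fst ck * q ^ snd ck) * q ^ m)).
  - rewrite lsum_scal_r. apply Rmult_le_pos; [now apply HP|apply pow_le; lra].
  - intros; rewrite pow_add; ring.
Qed.

Lemma moment_cone_Sg n (V : nat -> nat -> R) :
  (forall i, moment_cone (V i)) -> moment_cone (fun k => Sg n (fun i => V i k)).
Proof.
  intros H. induction n as [|n IH].
  - exact moment_cone_zero.
  - apply (moment_cone_ext (fun k => Sg n (fun i => V i k) + V n k)).
    + intros; now rewrite Sg_S.
    + apply moment_cone_plus; auto.
Qed.

Lemma moment_cone_geometric c q : 0 <= c -> 0 <= q <= 1 -> moment_cone (fun k => c * q ^ k).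
Proof. intros Hc Hq. apply moment_cone_scal; auto. intros P HP. now apply HP. Qed.

(** For a moment sequence this is the integral of q^k (1-q)^j against the representing measure. *)
Fixpoint bdiff (V : nat -> R) (j k : nat) : R :=
  match j with
  | O => V k
  | S j' => bdiff V j' k - bdiff V j' (S k)
  end.

Lemma bdiff_pow q j k : bdiff (pow q) j k = q ^ k * (1 - q) ^ j.
Proof. revert k; induction j as [|j IH]; intros k; simpl; [ring|]. rewrite !IH. simpl. ring. Qed.

Lemma finite_functional_bdiff j k : finite_functional (fun V => bdiff V j k).
Proof.
  revert k; induction j as [|j IH]; intros k; simpl.
  - apply finite_functional_eval.
  - apply finite_functional_minus; auto.
Qed.

(* Log-convexity in j: the moments of q^k (1-q)^j satisfy the Cauchy-Schwarz inequality. *)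
Lemma bdiff_pos V : moment_cone V -> (forall k, 0 < V k) -> (forall k, V (S k) < V k) ->
  forall j k, 0 < bdiff V j k.
Proof.
  intros HV H0 H1.
  assert (HCS : forall j k t, 0 <= t ^ 2 * bdiff V j k - 2 * t * bdiff V (S j) k + bdiff V (S (S j)) k).
  { intros j k t.
    apply (moment_cone_functional V (fun V => t ^ 2 * bdiff V j k - 2 * t * bdiff V (S j) k + bdiff V (S (S j)) k)); auto.
    - apply finite_functional_plus; [apply finite_functional_minus; apply finite_functional_scal|];
        apply finite_functional_bdiff.
    - intros q Hq. rewrite !bdiff_pow.
      replace (_ + _) with (q ^ k * (1 - q) ^ j * (t - (1 - q)) ^ 2) by (simpl; ring).
      apply Rmult_le_pos; [apply Rmult_le_pos; apply pow_le; lra|apply pow2_ge_0]. }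
  assert (Hj : forall j, (forall k, 0 < bdiff V j k) /\ (forall k, 0 < bdiff V (S j) k)).
  { induction j as [|j [IH1 IH2]].
    - split; auto. intros k; simpl. specialize (H1 k). lra.
    - split; auto. intros k.
      specialize (IH1 k); specialize (IH2 k).
      assert (H := HCS j k (bdiff V (S j) k / bdiff V j k)).
      set (a := bdiff V j k) in *. set (b := bdiff V (S j) k) in *. set (c := bdiff V (S (S j)) k) in *.
      replace ((b / a) ^ 2 * a - 2 * (b / a) * b + c) with (c - b * b / a) in H by (field; lra).
      assert (0 < b * b / a) by (apply Rdiv_lt_0_compat; nra). lra. }
  intros j k; apply Hj.
Qed.

(** * Walls of a chain and their alternating interaction *)

Definition decreasing (l : list nat) : Prop := StronglySorted (fun a b => (b < a)%nat) l.

(** Walls are listed from right to left. Each wall flips the spin, so two walls interact with a sign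
    that alternates with the number of walls between them, adjacent ones counting positively;
    [altpairs] collects these signed interactions over all pairs. *)
Fixpoint altfrom (f : nat -> R) (s : nat) (l : list nat) : R :=
  match l with
  | [] => 0
  | t :: l' => f (s - t)%nat - altfrom f s l'
  end.

Fixpoint altpairs (f : nat -> R) (l : list nat) : R :=
  match l with
  | [] => 0
  | s :: l' => altfrom f s l' + altpairs f l'
  end.

(** [X] takes the ends of a gap in increasing order although the list decreases; [gap2sum] likewise
    sees three consecutive walls, that is, two adjacent gaps. *)
Fixpoint gapsum (X : nat -> nat -> R) (l : list nat) : R :=
  match l with
  | [] => 0
  | s :: l' => match l' with t :: _ => X t s | [] => 0 end + gapsum X l'
  end.

Fixpoint gap2sum (X : nat -> nat -> nat -> R) (l : list nat) : R :=
  match l with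
  | [] => 0
  | s :: l' => match l' with t :: r :: _ => X r t s | _ => 0 end + gap2sum X l'
  end.

Lemma altfrom_pow_shift q s t l : (t <= s)%nat -> (forall u, In u l -> (u <= t)%nat) ->
  altfrom (pow q) s l = q ^ (s - t) * altfrom (pow q) t l.
Proof.
  intros Hst. induction l as [|u l IH]; intros H; simpl; [ring|].
  rewrite IH by auto with datatypes.
  assert (u <= t)%nat by auto with datatypes.
  replace (s - u)%nat with ((s - t) + (t - u))%nat by lia. rewrite pow_add. ring.
Qed.

Lemma pow_le_base q n : 0 <= q <= 1 -> (1 <= n)%nat -> 0 <= q ^ n <= q.
Proof.
  intros Hq Hn. destruct n as [|n]; [lia|]. simpl.
  assert (0 <= q ^ n) by (apply pow_le; lra).
  assert (q ^ n <= 1) by (rewrite <- (pow1 n); apply pow_incr; lra). nra.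
Qed.

(** The exponential is multiplicative, so the field u at [s] of all lower walls is determined by the
    field v at the next wall [t]: u = x (1 - v) with x = q^(s-t). This one-step recursion makes the
    chain tractable. *)
Lemma altfrom_pow_cons q s t l : decreasing (s :: t :: l) ->
  altfrom (pow q) s (t :: l) = q ^ (s - t) * (1 - altfrom (pow q) t l).
Proof.
  intros H. inversion H as [|? ? H1 H2]; subst. inversion H1 as [|? ? H3 H4]; subst.
  inversion H2; subst. simpl. rewrite (altfrom_pow_shift q s t) by (try lia; intros u Hu;
    rewrite Forall_forall in H4; specialize (H4 u Hu); lia).
  ring.
Qed.

Lemma decreasing_tail s l : decreasing (s :: l) -> decreasing l.
Proof. intros H; now inversion H. Qed.

Lemma decreasing_head s t l : decreasing (s :: t :: l) -> (t < s)%nat.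
Proof. intros H; inversion H as [|? ? H1 H2]; subst. now inversion H2. Qed.

Lemma altfrom_pow_bounds q s l : 0 <= q <= 1 -> decreasing (s :: l) ->
  0 <= altfrom (pow q) s l <= q.
Proof.
  intros Hq. revert s; induction l as [|t l IH]; intros s Hd; [simpl; lra|].
  rewrite altfrom_pow_cons by auto.
  specialize (IH t (decreasing_tail _ _ Hd)).
  assert (Hx := pow_le_base q (s - t) Hq ltac:(assert (t < s)%nat by (eapply decreasing_head; eauto); lia)).
  nra.
Qed.

(* With u = x(1-v), the defect u - x/(1+x) - (u^2-v^2)/2 equals (u-v)^2 (1-x) / (2(1+x)):
   the squares telescope along the chain of breaks. *)
Lemma chessboard_step x v q : 0 <= x <= q -> q <= 1 -> 0 <= v ->
  x / (1 + x) + ((x * (1 - v)) ^ 2 - v ^ 2) / 2 + (1 - q) / 4 * (x * (1 - v) - v) ^ 2 <= x * (1 - v).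
Proof.
  intros Hx Hq Hv.
  assert (E : x * (1 - v) - x / (1 + x) - ((x * (1 - v)) ^ 2 - v ^ 2) / 2
              = (x * (1 - v) - v) ^ 2 * ((1 - x) / (2 * (1 + x)))) by (field; lra).
  assert ((1 - q) / 4 <= (1 - x) / (2 * (1 + x))).
  { apply Rdiv_ge; [lra|]. nra. }
  assert (0 <= (x * (1 - v) - v) ^ 2) by apply pow2_ge_0.
  nra.
Qed.

(** x/(1+x) is the fixed point of the recursion u = x (1 - u), the value in a chain with all gaps
    equal. [chessboard_step] is applied at each wall and its squares telescope. The induction
    carries half of the defect (u-v)^2 of the top wall; together with half of the next defect it
    controls the difference of two adjacent gaps. *)
Lemma chessboard_pow q l : 0 <= q <= 1 -> decreasing l ->
  gapsum (fun t s => q ^ (s - t) / (1 + q ^ (s - t))) l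
  + gap2sum (fun r t s => (1 - q) ^ 3 / 16 * (q ^ (s - t) - q ^ (t - r)) ^ 2) l
  <= altpairs (pow q) l.
Proof.
  intros Hq.
  assert (Main : forall l s t, decreasing (s :: t :: l) ->
    gapsum (fun t s => q ^ (s - t) / (1 + q ^ (s - t))) (s :: t :: l)
    + gap2sum (fun r t s => (1 - q) ^ 3 / 16 * (q ^ (s - t) - q ^ (t - r)) ^ 2) (s :: t :: l)
    + altfrom (pow q) s (t :: l) ^ 2 / 2
    + (1 - q) / 8 * (altfrom (pow q) s (t :: l) - altfrom (pow q) t l) ^ 2
    <= altpairs (pow q) (s :: t :: l)).
  { induction l0 as [|r l0 IH]; intros s t Hd.
    - assert (Hx := pow_le_base q (s - t) Hq ltac:(assert (t < s)%nat by (eapply decreasing_head; eauto); lia)).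
      assert (H := chessboard_step (q ^ (s - t)) 0 q ltac:(lra) ltac:(lra) ltac:(lra)).
      simpl. simpl in H.
      set (x := q ^ (s - t)) in *. assert (0 <= (1-q) * (x * x)) by (apply Rmult_le_pos; nra).
      lra.
    - specialize (IH t r (decreasing_tail _ _ Hd)).
      assert (Hx := pow_le_base q (s - t) Hq ltac:(assert (t < s)%nat by (eapply decreasing_head; eauto); lia)).
      assert (Hx2 := pow_le_base q (t - r) Hq ltac:(assert (r < t)%nat by (eapply decreasing_head; eapply decreasing_tail; eauto); lia)).
      assert (Hv := altfrom_pow_bounds q t (r :: l0) Hq (decreasing_tail _ _ Hd)).
      assert (Hw := altfrom_pow_bounds q r l0 Hq (decreasing_tail _ _ (decreasing_tail _ _ Hd))).
      assert (Hs := altfrom_pow_cons q s t (r :: l0) Hd).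
      assert (Ht := altfrom_pow_cons q t r l0 (decreasing_tail _ _ Hd)).
      change (gapsum ?X (s :: t :: r :: l0)) with (X t s + gapsum X (t :: r :: l0)).
      change (gap2sum ?X (s :: t :: r :: l0)) with (X r t s + gap2sum X (t :: r :: l0)).
      change (altpairs (pow q) (s :: t :: r :: l0)) with (altfrom (pow q) s (t :: r :: l0) + altpairs (pow q) (t :: r :: l0)).
      cbv beta.
      set (u := altfrom (pow q) s (t :: r :: l0)) in *.
      set (v := altfrom (pow q) t (r :: l0)) in *.
      set (w := altfrom (pow q) r l0) in *.
      set (x := q ^ (s - t)) in *. set (y := q ^ (t - r)) in *.
      assert (H := chessboard_step x v q ltac:(lra) ltac:(lra) ltac:(lra)).
      rewrite <- Hs in H.
      (* Difference of the recursions u = x (1-v) and v = y (1-w): if the gap factors x and y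
         differ, then u differs from v or v from w. *)
      assert (E : (x - y) * (1 - v) = (u - v) + y * (v - w)) by (rewrite Hs, Ht; ring).
      assert (Hy : (y * (v - w)) ^ 2 <= (v - w) ^ 2).
      { rewrite Rpow_mult_distr. assert (0 <= (v - w) ^ 2) by apply pow2_ge_0.
        assert (y ^ 2 <= 1) by nra. nra. }
      assert (K : ((x - y) * (1 - v)) ^ 2 <= 2 * ((u - v) ^ 2 + (v - w) ^ 2)).
      { rewrite E. assert (0 <= (u - v - y * (v - w)) ^ 2) by apply pow2_ge_0. nra. }
      assert (K2 : (1 - q) ^ 2 * (x - y) ^ 2 <= 2 * ((u - v) ^ 2 + (v - w) ^ 2)).
      { apply Rle_trans with (2 := K). rewrite Rpow_mult_distr.
        assert (0 <= (x - y) ^ 2) by apply pow2_ge_0.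
        assert ((1 - q) ^ 2 <= (1 - v) ^ 2) by (apply pow_incr; lra).
        rewrite Rmult_comm. apply Rmult_le_compat_l; auto. }
      assert (K3 : (1 - q) ^ 3 / 16 * (x - y) ^ 2 <= (1 - q) / 8 * ((u - v) ^ 2 + (v - w) ^ 2)).
      { replace ((1 - q) ^ 3 / 16 * (x - y) ^ 2) with ((1 - q) / 16 * ((1 - q) ^ 2 * (x - y) ^ 2)) by field.
        replace ((1 - q) / 8 * ((u - v) ^ 2 + (v - w) ^ 2)) with ((1 - q) / 16 * (2 * ((u - v) ^ 2 + (v - w) ^ 2))) by field.
        apply Rmult_le_compat_l; lra. }
      assert (0 <= (u - v) ^ 2) by apply pow2_ge_0.
      lra. }
  intros Hd. destruct l as [|s [|t l]]; [simpl; lra|simpl; lra|].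
  specialize (Main l s t Hd).
  assert (0 <= altfrom (pow q) s (t :: l) ^ 2) by apply pow2_ge_0.
  assert (0 <= (altfrom (pow q) s (t :: l) - altfrom (pow q) t l) ^ 2) by apply pow2_ge_0.
  nra.
Qed.

(** A partial sum of V(d) - V(2d) + V(3d) - ..., the energy per gap of the infinite chain with all
    gaps [d]; for powers of q the full series is x/(1+x) with x = q^d. Cut at 2m terms it is a
    finite functional of [V]. *)
Definition psi_trunc (m : nat) (V : nat -> R) (d : nat) : R :=
  Sg m (fun k => V ((2 * k + 1) * d)%nat - V ((2 * k + 2) * d)%nat).

(** For unequal gaps and powers of q this is q^(2 min) (1-q)^5 / 16, a polynomial lower bound for
    the remainder (1-q)^3 (q^d - q^d')^2 / 16, since 1 - q^r >= 1 - q for r >= 1. *)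
Definition gap_penalty (V : nat -> R) (d d' : nat) : R :=
  if Nat.eqb d d' then 0 else bdiff V 5 (2 * Nat.min d d') / 16.

Lemma psi_trunc_pow m q d : 0 <= q <= 1 -> psi_trunc m (pow q) d <= q ^ d / (1 + q ^ d).
Proof.
  intros Hq. unfold psi_trunc. set (x := q ^ d).
  assert (Hx : 0 <= x) by (apply pow_le; lra).
  rewrite (Sg_ext _ _ (fun k => x ^ (2 * k + 1) - x ^ (2 * k + 2))).
  2:{ intros k _. unfold x. now rewrite <- !pow_mult, !(Nat.mul_comm d). }
  assert (E : (1 + x) * Sg m (fun k => x ^ (2 * k + 1) - x ^ (2 * k + 2)) = x - x ^ (2 * m + 1)).
  { induction m as [|m IH].
    - rewrite Sg_0. simpl. ring.
    - rewrite Sg_S, Rmult_plus_distr_l, IH.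
      replace (2 * S m + 1)%nat with ((2 * m + 1) + 2)%nat by lia.
      replace (2 * m + 2)%nat with ((2 * m + 1) + 1)%nat by lia.
      rewrite !pow_add. ring. }
  apply Rdiv_ge; [lra|]. rewrite Rmult_comm, E.
  assert (0 <= x ^ (2 * m + 1)) by (apply pow_le; lra). lra.
Qed.

Lemma gap_penalty_pow q d d' : 0 <= q <= 1 ->
  gap_penalty (pow q) d d' <= (1 - q) ^ 3 / 16 * (q ^ d - q ^ d') ^ 2.
Proof.
  intros Hq.
  assert (Hlt : forall a b, (a < b)%nat -> q ^ (2 * a) * (1 - q) ^ 5 / 16 <= (1 - q) ^ 3 / 16 * (q ^ a - q ^ b) ^ 2).
  { intros a b Hab. replace b with (a + (b - a))%nat by lia.
    assert (Hx := pow_le_base q (b - a) Hq ltac:(lia)).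
    rewrite pow_add. replace (2 * a)%nat with (a + a)%nat by lia. rewrite pow_add.
    set (y := q ^ (b - a)) in *. set (x := q ^ a).
    replace ((1 - q) ^ 3 / 16 * (x - x * y) ^ 2) with (x * x * (1 - q) ^ 3 / 16 * (1 - y) ^ 2) by (simpl; field).
    replace (x * x * (1 - q) ^ 5 / 16) with (x * x * (1 - q) ^ 3 / 16 * (1 - q) ^ 2) by (simpl; field).
    apply Rmult_le_compat_l.
    - assert (0 <= x * x) by nra. assert (0 <= (1 - q) ^ 3) by (apply pow_le; lra).
      assert (0 <= x * x * (1 - q) ^ 3) by nra. lra.
    - apply pow_incr; lra. }
  assert (0 <= (1 - q) ^ 3 / 16 * (q ^ d - q ^ d') ^ 2).
  { apply Rmult_le_pos; [|apply pow2_ge_0]. assert (0 <= (1 - q) ^ 3) by (apply pow_le; lra). lra. }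
  unfold gap_penalty. destruct (Nat.eqb_spec d d'); [lra|].
  rewrite bdiff_pow. destruct (Nat.lt_ge_cases d d') as [Hl|Hl].
  - rewrite Nat.min_l by lia. apply Hlt; lia.
  - rewrite Nat.min_r by lia. replace ((q ^ d - q ^ d') ^ 2) with ((q ^ d' - q ^ d) ^ 2) by ring. apply Hlt; lia.
Qed.

Lemma gapsum_le X Y l : decreasing l -> (forall t s, (t < s)%nat -> X t s <= Y t s) -> gapsum X l <= gapsum Y l.
Proof.
  intros Hd H. induction l as [|s l IH]; simpl; [lra|].
  specialize (IH (decreasing_tail _ _ Hd)).
  destruct l as [|t l]; [lra|]. specialize (H t s (decreasing_head _ _ _ Hd)). lra.
Qed.

Lemma gap2sum_le X Y l : (forall r t s, X r t s <= Y r t s) -> gap2sum X l <= gap2sum Y l.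
Proof.
  intros H. induction l as [|s l IH]; simpl; [lra|].
  destruct l as [|t [|r l]]; try lra. specialize (H r t s). lra.
Qed.

Lemma finite_functional_altfrom s l : finite_functional (fun V => altfrom V s l).
Proof.
  induction l as [|t l IH]; simpl.
  - apply finite_functional_zero.
  - apply finite_functional_minus; auto using finite_functional_eval.
Qed.

Lemma finite_functional_altpairs l : finite_functional (fun V => altpairs V l).
Proof.
  induction l as [|t l IH]; simpl.
  - apply finite_functional_zero.
  - apply finite_functional_plus; auto using finite_functional_altfrom.
Qed.

Lemma finite_functional_gapsum X l : (forall t s, finite_functional (fun V => X V t s)) ->
  finite_functional (fun V => gapsum (X V) l).
Proof.
  intros H. induction l as [|s l IH]; simpl; [apply finite_functional_zero|].
  apply finite_functional_plus; auto. destruct l; auto using finite_functional_zero.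
Qed.

Lemma finite_functional_gap2sum X l : (forall r t s, finite_functional (fun V => X V r t s)) ->
  finite_functional (fun V => gap2sum (X V) l).
Proof.
  intros H. induction l as [|s l IH]; simpl; [apply finite_functional_zero|].
  apply finite_functional_plus; auto. destruct l as [|t [|r l]]; auto using finite_functional_zero.
Qed.

(** Both sides are finite functionals of [V], so the inequality for pure powers extends to the whole
    cone. *)
Lemma chessboard V m l : moment_cone V -> decreasing l ->
  gapsum (fun t s => psi_trunc m V (s - t)) l
  + gap2sum (fun r t s => gap_penalty V (s - t) (t - r)) l <= altpairs V l.
Proof.
  intros HV Hd.
  assert (H : 0 <= altpairs V l - (gapsum (fun t s => psi_trunc m V (s - t)) l
      + gap2sum (fun r t s => gap_penalty V (s - t) (t - r)) l)); [|lra].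
  apply (moment_cone_functional V (fun V => altpairs V l - (gapsum (fun t s => psi_trunc m V (s - t)) l
      + gap2sum (fun r t s => gap_penalty V (s - t) (t - r)) l))); auto.
  - apply finite_functional_minus; [apply finite_functional_altpairs|apply finite_functional_plus].
    + apply (finite_functional_gapsum (fun V t s => psi_trunc m V (s - t))).
      intros t s. apply (finite_functional_Sg m (fun k V => V ((2 * k + 1) * (s - t))%nat - V ((2 * k + 2) * (s - t))%nat)).
      intros k. apply finite_functional_minus; apply finite_functional_eval.
    + apply (finite_functional_gap2sum (fun V r t s => gap_penalty V (s - t) (t - r))).
      intros r t s. unfold gap_penalty. destruct (Nat.eqb _ _); [apply finite_functional_zero|].
      destruct (finite_functional_scal (/ 16) _ (finite_functional_bdiff 5 (2 * Nat.min (s - t) (t - r)))) as [P HP].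
      exists P. intros f. rewrite <- HP. unfold Rdiv. ring.
  - intros q Hq. assert (H := chessboard_pow q l Hq Hd).
    assert (H1 : gapsum (fun t s => psi_trunc m (pow q) (s - t)) l <= gapsum (fun t s => q ^ (s - t) / (1 + q ^ (s - t))) l).
    { apply gapsum_le; auto. intros; now apply psi_trunc_pow. }
    assert (H2 : gap2sum (fun r t s => gap_penalty (pow q) (s - t) (t - r)) l
       <= gap2sum (fun r t s => (1 - q) ^ 3 / 16 * (q ^ (s - t) - q ^ (t - r)) ^ 2) l).
    { apply gap2sum_le. intros; now apply gap_penalty_pow. }
    lra.
Qed.

(** * The lattice kernel *)

(** At the origin the convention [ln 0 = 0] gives the value 1; there the kernel is always multiplied
    by the [dif] of a spin with itself. *)
Definition KK (p : R) (a b : Z) : R := / Rpower (IZR (a ^ 2 + b ^ 2)) (p / 2).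

Lemma KK_pos p a b : 0 < KK p a b.
Proof. apply Rinv_0_lt_compat, exp_pos. Qed.

Lemma KK_opp_l p a b : KK p (- a) b = KK p a b.
Proof. unfold KK. do 3 f_equal. ring. Qed.

Lemma KK_opp_r p a b : KK p a (- b) = KK p a b.
Proof. unfold KK. do 3 f_equal. ring. Qed.

Lemma KK_sym p a b : KK p a b = KK p b a.
Proof. unfold KK. do 3 f_equal. ring. Qed.

Lemma KK_abs p a b : KK p a b = KK p (Z.abs a) b.
Proof. destruct (Z.abs_eq_or_opp a) as [->| ->]; auto using KK_opp_l. Qed.

Lemma zrange_NoDup N : NoDup (zrange N).
Proof.
  apply NoDup_map_NoDup_ForallPairs; [|apply seq_NoDup].
  intros a b _ _ H. lia.
Qed.

Lemma in_zrange N z : In z (zrange N) <-> (- Z.of_nat N <= z <= Z.of_nat N)%Z.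
Proof.
  unfold zrange. rewrite in_map_iff. split.
  - intros [k [<- Hk]]. apply in_seq in Hk. lia.
  - intros H. exists (Z.to_nat (z + Z.of_nat N)). split; [lia|apply in_seq; lia].
Qed.

Lemma lsum_zrange f N :
  lsum f (zrange N) = f 0%Z + Sg N (fun k => f (Z.of_nat (S k)) + f (- Z.of_nat (S k))%Z).
Proof.
  unfold zrange. rewrite lsum_map. fold (Sg (2 * N + 1) (fun k => f (Z.of_nat k - Z.of_nat N)%Z)).
  replace (2 * N + 1)%nat with (N + (1 + N))%nat by lia.
  rewrite !Sg_add, Sg_S, Sg_0, Sg_plus, (Sg_rev N).
  replace (Z.of_nat (N + 0) - Z.of_nat N)%Z with 0%Z by lia.
  rewrite (Sg_ext N (fun k => f (Z.of_nat (N - 1 - k) - Z.of_nat N)%Z) (fun k => f (- Z.of_nat (S k))%Z))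
    by (intros; f_equal; lia).
  rewrite (Sg_ext N (fun k => f (Z.of_nat (N + (1 + k)) - Z.of_nat N)%Z) (fun k => f (Z.of_nat (S k))%Z))
    by (intros; f_equal; lia).
  ring.
Qed.

Lemma lsum_zrange_mono f N M : (N <= M)%nat -> (forall z, 0 <= f z) ->
  lsum f (zrange N) <= lsum f (zrange M).
Proof.
  intros H H0. apply lsum_incl; auto using zrange_NoDup.
  intros z Hz. apply in_zrange in Hz. apply in_zrange. lia.
Qed.

Lemma incl_zrange (l : list Z) : exists N, incl l (zrange N).
Proof.
  induction l as [|z l [N HN]].
  - exists O. intros x [].
  - exists (N + Z.to_nat (Z.abs z))%nat. intros x [->|Hx]; apply in_zrange; [lia|].
    apply HN in Hx. apply in_zrange in Hx. lia.
Qed.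

Definition zeta_term (e : R) (n : nat) : R := Rpower (INR (S n)) (- (1 + e)).

Lemma INR_S_pos n : 0 < INR (S n).
Proof. apply lt_0_INR; lia. Qed.

(* (m-1)^{-e} >= m^{-e} (1 + e/m), so the terms telescope. *)
Lemma zeta_bound e N : 0 < e -> Sg N (zeta_term e) <= 1 + / e.
Proof.
  intros He.
  assert (H : Sg (S N) (zeta_term e) <= 1 + / e * (1 - Rpower (INR (S N)) (- e))).
  { induction N as [|N IH].
    - rewrite Sg_S, Sg_0. unfold zeta_term. simpl INR. unfold Rpower. rewrite ln_1, !Rmult_0_r, exp_0. lra.
    - rewrite Sg_S. apply Rle_trans with (1 + / e * (1 - Rpower (INR (S N)) (- e)) + zeta_term e (S N)); [lra|].
      assert (K : e * zeta_term e (S N) <= Rpower (INR (S N)) (- e) - Rpower (INR (S (S N))) (- e)).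
      { unfold zeta_term. set (m := INR (S (S N))).
        assert (Hm : m = INR (S N) + 1) by (unfold m; now rewrite (S_INR (S N))).
        assert (H0 := INR_S_pos N).
        assert (Hm1 : 1 < m) by lra.
        replace (- (1 + e)) with (- e + - (1)) by ring.
        rewrite Rpower_plus, (Rpower_Ropp m 1), Rpower_1 by lra.
        assert (E : Rpower (INR (S N)) (- e) = Rpower m (- e) * exp (- e * ln (INR (S N) / m))).
        { unfold Rpower. rewrite <- exp_plus. f_equal. unfold Rdiv. rewrite ln_mult, ln_Rinv; try lra.
          - apply Rinv_0_lt_compat; lra. }
        rewrite E.
        assert (L : / m <= - ln (INR (S N) / m)).
        { assert (Hr : 0 < INR (S N) / m) by (apply Rdiv_lt_0_compat; lra).
          assert (H := exp_ineq1_le (ln (INR (S N) / m))). rewrite exp_ln in H by auto.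
          replace (INR (S N) / m) with (1 - / m) in H at 2 by (rewrite Hm; field; lra).
          lra. }
        assert (X := exp_ineq1_le (- e * ln (INR (S N) / m))).
        assert (P : 0 < Rpower m (- e)) by apply exp_pos.
        assert (e * / m <= - e * ln (INR (S N) / m)) by nra.
        assert (Rpower m (- e) * (1 + e * / m) <= Rpower m (- e) * exp (- e * ln (INR (S N) / m))) by (apply Rmult_le_compat_l; lra).
        lra. }
      assert (zeta_term e (S N) <= / e * (Rpower (INR (S N)) (- e) - Rpower (INR (S (S N))) (- e))).
      { apply Rmult_le_reg_l with e; auto. rewrite <- Rmult_assoc, Rinv_r, Rmult_1_l by lra. exact K. }
      lra. }
  apply Rle_trans with (Sg (S N) (zeta_term e)).
  - rewrite Sg_S. assert (0 < zeta_term e N) by apply exp_pos. lra.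
  - assert (0 < Rpower (INR (S N)) (- e)) by apply exp_pos.
    assert (0 < / e) by (apply Rinv_0_lt_compat; auto). nra.
Qed.

Section Kernel.
Context (p : R) (hp : 4 < p).

Let e := (p - 4) / 2.

(** The exponent is shared as p = (3 + e) + (1 + e), each part being bounded through one coordinate:
    the second makes the sum over a line converge, the first leaves a decay for which the second
    moment is finite. *)
Lemma KK_bound n k : KK p (Z.of_nat (S n)) 0 <= Rpower (INR (S n)) (- (3 + e)) /\
  KK p (Z.of_nat (S n)) (Z.of_nat (S k)) <= Rpower (INR (S n)) (- (3 + e)) * zeta_term e k.
Proof.
  assert (He : 0 < e) by (unfold e; lra).
  assert (Hn := INR_S_pos n). assert (Hk := INR_S_pos k).
  assert (Sq : forall m c, 0 < INR (S m) -> Rpower (INR (S m) ^ 2) (c / 2) = Rpower (INR (S m)) c).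
  { intros m c Hm. rewrite <- Rpower_pow by auto. rewrite Rpower_mult. f_equal. simpl. field. }
  assert (H1 : 1 <= INR (S n)) by (rewrite S_INR; assert (0 <= INR n) by apply pos_INR; lra).
  split.
  - unfold KK. rewrite Z.add_0_r.
    replace (IZR (Z.of_nat (S n) ^ 2)) with (INR (S n) ^ 2) by (rewrite INR_IZR_INZ, pow_IZR; reflexivity).
    rewrite Sq by auto. rewrite <- Rpower_Ropp.
    apply Rle_Rpower; auto. unfold e; lra.
  - unfold KK, zeta_term.
    replace (IZR (Z.of_nat (S n) ^ 2 + Z.of_nat (S k) ^ 2)) with (INR (S n) ^ 2 + INR (S k) ^ 2).
    2:{ rewrite plus_IZR. f_equal; rewrite INR_IZR_INZ, pow_IZR; reflexivity. }
    assert (P1 : 0 < INR (S n) ^ 2) by (apply pow_lt; auto).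
    assert (P2 : 0 < INR (S k) ^ 2) by (apply pow_lt; auto).
    replace (p / 2) with ((3 + e) / 2 + (1 + e) / 2) by (unfold e; field).
    rewrite Rpower_plus, Rinv_mult, !Rpower_Ropp.
    rewrite <- (Sq n (3 + e)), <- (Sq k (1 + e)) by auto.
    apply Rmult_le_compat; try (left; apply Rinv_0_lt_compat, exp_pos);
    (apply Rinv_le_contravar; [apply exp_pos|]; apply Rle_Rpower_l; [lra|split; lra]).
Qed.

Definition K1 (z : Z) : R := real (Lim_seq (fun N => lsum (KK p z) (zrange N))).
Definition k1 (n : nat) : R := K1 (Z.of_nat n).

Let C1 := 1 + 2 * (1 + / e).

Lemma KK_line_bound n N : lsum (KK p (Z.of_nat (S n))) (zrange N) <= C1 * Rpower (INR (S n)) (- (3 + e)).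
Proof.
  assert (He : 0 < e) by (unfold e; lra).
  rewrite lsum_zrange.
  assert (H0 := proj1 (KK_bound n 0)).
  set (r := Rpower (INR (S n)) (- (3 + e))) in *.
  assert (Hr : 0 < r) by apply exp_pos.
  assert (Sg N (fun k => KK p (Z.of_nat (S n)) (Z.of_nat (S k)) + KK p (Z.of_nat (S n)) (- Z.of_nat (S k)))
    <= Sg N (fun k => (2 * r) * zeta_term e k)).
  { apply Sg_le. intros k _. rewrite KK_opp_r. assert (H := proj2 (KK_bound n k)). fold r in H. lra. }
  rewrite Sg_scal in H.
  assert (Hz := zeta_bound e N He). unfold C1. nra.
Qed.

Lemma K1_even z : K1 (- z) = K1 z.
Proof.
  unfold K1. f_equal. apply Lim_seq_ext. intros N. apply lsum_ext. intros; apply KK_opp_l.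
Qed.

Lemma K1_abs z : K1 z = k1 (Z.abs_nat z).
Proof.
  unfold k1. rewrite Zabs2Nat.id_abs. destruct (Z.abs_eq_or_opp z) as [->| ->]; auto using K1_even.
Qed.

Lemma K1_lim z : z <> 0%Z -> is_lim_seq (fun N => lsum (KK p z) (zrange N)) (K1 z).
Proof.
  intros Hz. apply Lim_seq_correct'.
  destruct (Z.abs_nat z) as [|n] eqn:E; [lia|].
  apply (ex_finite_lim_seq_incr _ (C1 * Rpower (INR (S n)) (- (3 + e)))).
  - intros N. apply lsum_zrange_mono; [lia|]. intros; left; apply KK_pos.
  - intros N. rewrite (lsum_ext _ (KK p (Z.of_nat (S n)))); [apply KK_line_bound|].
    intros b. rewrite KK_abs. f_equal. lia.
Qed.

Lemma K1_ge z l : z <> 0%Z -> NoDup l -> lsum (KK p z) l <= K1 z.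
Proof.
  intros Hz Hl. destruct (incl_zrange l) as [N HN].
  apply Rle_trans with (lsum (KK p z) (zrange N)).
  - apply lsum_incl; auto. intros; left; apply KK_pos.
  - apply (is_lim_seq_incr_compare _ _ (K1_lim z Hz)).
    intros M. apply lsum_zrange_mono; [lia|]. intros; left; apply KK_pos.
Qed.

Lemma k1_pos n : 0 < k1 (S n).
Proof.
  apply Rlt_le_trans with (lsum (KK p (Z.of_nat (S n))) [0%Z]).
  - unfold lsum; simpl. assert (H := KK_pos p (Z.of_nat (S n)) 0). simpl in H. lra.
  - apply K1_ge; [lia|]. repeat constructor. auto.
Qed.

Lemma k1_bound n : k1 (S n) <= C1 * Rpower (INR (S n)) (- (3 + e)).
Proof. apply (lim_le_const _ _ _ (K1_lim (Z.of_nat (S n)) ltac:(lia))). intros; apply KK_line_bound. Qed.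

Lemma KK_decr n b : KK p (Z.of_nat (S (S n))) b < KK p (Z.of_nat (S n)) b.
Proof.
  unfold KK. apply Rinv_lt_contravar; [apply Rmult_lt_0_compat; apply exp_pos|].
  apply Rlt_Rpower_l; [lra|].
  split; [apply IZR_lt; nia|apply IZR_lt; nia].
Qed.

Lemma k1_decr n : k1 (S (S n)) < k1 (S n).
Proof.
  set (d := KK p (Z.of_nat (S n)) 0 - KK p (Z.of_nat (S (S n))) 0).
  assert (0 < d) by (unfold d; assert (H := KK_decr n 0); lra).
  (* A limit preserves only weak inequalities, so the strict gain [d] at the site b = 0 is kept
     aside. *)
  assert (k1 (S (S n)) <= k1 (S n) - d); [|lra].
  apply (lim_le_const _ _ _ (K1_lim (Z.of_nat (S (S n))) ltac:(lia))). intros N.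
  assert (H1 := K1_ge (Z.of_nat (S n)) (zrange N) ltac:(lia) (zrange_NoDup N)). fold (k1 (S n)) in H1.
  rewrite lsum_zrange in *.
  assert (Sg N (fun k => KK p (Z.of_nat (S (S n))) (Z.of_nat (S k)) + KK p (Z.of_nat (S (S n))) (- Z.of_nat (S k)))
    <= Sg N (fun k => KK p (Z.of_nat (S n)) (Z.of_nat (S k)) + KK p (Z.of_nat (S n)) (- Z.of_nat (S k)))).
  { apply Sg_le. intros k _. apply Rplus_le_compat; left; apply KK_decr. }
  unfold d; lra.
Qed.

(** n^2 n^-(3+e) = n^-(1+e) with e > 0. The choice of the trial stripe width rests on the finiteness
    of this moment. *)
Lemma k1_moment2 N : Sg N (fun n => INR (S n) ^ 2 * k1 (S n)) <= C1 * (1 + / e).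
Proof.
  assert (He : 0 < e) by (unfold e; lra).
  assert (HC : 0 <= C1).
  { unfold C1. assert (0 < / e) by (apply Rinv_0_lt_compat; auto). lra. }
  apply Rle_trans with (Sg N (fun n => C1 * zeta_term e n)).
  - apply Sg_le. intros n _. assert (H := k1_bound n). assert (Hn := INR_S_pos n).
    replace (zeta_term e n) with (INR (S n) ^ 2 * Rpower (INR (S n)) (- (3 + e))).
    + assert (0 <= INR (S n) ^ 2) by apply pow2_ge_0. nra.
    + unfold zeta_term. rewrite <- Rpower_pow, <- Rpower_plus by auto. f_equal. simpl. ring.
  - rewrite Sg_scal. apply Rmult_le_compat_l; auto using zeta_bound.
Qed.

Lemma k1_moment1_le n : INR (S n) * k1 (S n) <= INR (S n) ^ 2 * k1 (S n).
Proof.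
  assert (H := k1_pos n). assert (1 <= INR (S n)) by (rewrite S_INR; assert (0 <= INR n) by apply pos_INR; lra).
  apply Rmult_le_compat_r; [lra|].
  rewrite <- Rsqr_pow2. unfold Rsqr. set (x := INR (S n)) in *. clearbody x. nra.
Qed.

Lemma k1_moment1 N : Sg N (fun n => INR (S n) * k1 (S n)) <= C1 * (1 + / e).
Proof.
  apply Rle_trans with (2 := k1_moment2 N). apply Sg_le. intros; apply k1_moment1_le.
Qed.

Definition jc : R := nsum (fun n => INR (S n) * k1 (S n)).

Lemma moment1_nonneg n : 0 <= INR (S n) * k1 (S n).
Proof. assert (H := k1_pos n). assert (0 < INR (S n)) by apply INR_S_pos. nra. Qed.

Lemma jc_lim : is_lim_seq (fun N => Sg N (fun n => INR (S n) * k1 (S n))) jc.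
Proof. apply (nsum_lim _ (C1 * (1 + / e))); auto using moment1_nonneg, k1_moment1. Qed.

Definition k1_second_moment : R := nsum (fun n => INR (S n) ^ 2 * k1 (S n)).

Lemma k1_second_moment_lim : is_lim_seq (fun N => Sg N (fun n => INR (S n) ^ 2 * k1 (S n))) k1_second_moment.
Proof.
  apply (nsum_lim _ (C1 * (1 + / e))); auto using k1_moment2.
  intros n. assert (H := k1_pos n). assert (0 <= INR (S n) ^ 2) by apply pow2_ge_0. nra.
Qed.

End Kernel.

(** * The kernel as a mixture of exponentials *)

(** Positive combinations of the real parts of exp(-a z + i b n). The class is closed under products
    because a product of cosines is half the sum of two cosines; [dwc_ext] admits any pointwise
    equal expression. *)
Inductive damped_wave_comb : (nat -> Z -> R) -> Prop :=
| dwc_base w a b : 0 <= w -> 0 <= a ->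
    damped_wave_comb (fun z n => w * exp (- (a * INR z)) * cos (b * IZR n))
| dwc_plus f g : damped_wave_comb f -> damped_wave_comb g -> damped_wave_comb (fun z n => f z n + g z n)
| dwc_ext f g : (forall z n, f z n = g z n) -> damped_wave_comb f -> damped_wave_comb g.

Lemma dwc_const c : 0 <= c -> damped_wave_comb (fun _ _ => c).
Proof.
  intros Hc. apply (dwc_ext (fun z n => c * exp (- (0 * INR z)) * cos (0 * IZR n))).
  - intros. rewrite !Rmult_0_l, Ropp_0, exp_0, cos_0. ring.
  - apply dwc_base; lra.
Qed.

Lemma dwc_mult f g : damped_wave_comb f -> damped_wave_comb g -> damped_wave_comb (fun z n => f z n * g z n).
Proof.
  intros Hf Hg. induction Hf as [w a b Hw Ha|f1 f2 H1 IH1 H2 IH2|f1 f2 E H IH].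
  - induction Hg as [w' a' b' Hw' Ha'|f1 f2 H1 IH1 H2 IH2|f1 f2 E H IH].
    + apply (dwc_ext (fun z n =>
         (w * w' / 2) * exp (- ((a + a') * INR z)) * cos ((b - b') * IZR n)
         + (w * w' / 2) * exp (- ((a + a') * INR z)) * cos ((b + b') * IZR n))).
      * intros z n.
        replace (- ((a + a') * INR z)) with (- (a * INR z) + - (a' * INR z)) by ring.
        rewrite exp_plus, Rmult_minus_distr_r, Rmult_plus_distr_r, cos_minus, cos_plus. field.
      * assert (0 <= w * w') by nra. apply dwc_plus; apply dwc_base; lra.
    + apply (dwc_ext (fun z n => (w * exp (- (a * INR z)) * cos (b * IZR n)) * f1 z n
          + (w * exp (- (a * INR z)) * cos (b * IZR n)) * f2 z n)); [intros; ring|now apply dwc_plus].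
    + eapply dwc_ext; [|exact IH]. intros; simpl; now rewrite E.
  - apply (dwc_ext (fun z n => f1 z n * g z n + f2 z n * g z n)); [intros; ring|now apply dwc_plus].
  - eapply dwc_ext; [|exact IH]. intros; simpl; now rewrite E.
Qed.

Lemma dwc_pow f j : damped_wave_comb f -> damped_wave_comb (fun z n => f z n ^ j).
Proof.
  intros H. induction j as [|j IH]; simpl.
  - apply dwc_const; lra.
  - now apply dwc_mult.
Qed.

Lemma dwc_Sg m (F : nat -> nat -> Z -> R) : (forall i, damped_wave_comb (F i)) ->
  damped_wave_comb (fun z n => Sg m (fun i => F i z n)).
Proof.
  intros H. induction m as [|m IH].
  - apply (dwc_ext (fun _ _ => 0)); [reflexivity|apply dwc_const; lra].
  - apply (dwc_ext (fun z n => Sg m (fun i => F i z n) + F m z n)).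
    + intros; now rewrite Sg_S.
    + now apply dwc_plus.
Qed.

(** A partial sum of cos(b n) over n may be negative, but the double sum over differences k - l is
    |sum_k exp(i b k)|^2. The argument [S z] stays off the line z = 0, which passes through the
    singularity. *)
Definition toeplitz_sum (f : nat -> Z -> R) (N z : nat) : R :=
  Sg N (fun k => Sg N (fun l => f (S z) (Z.of_nat k - Z.of_nat l)%Z)).

Definition toeplitz_cone (f : nat -> Z -> R) : Prop := forall N, moment_cone (toeplitz_sum f N).

Lemma fejer_nonneg b N :
  0 <= Sg N (fun k => Sg N (fun l => cos (b * IZR (Z.of_nat k - Z.of_nat l)))).
Proof.
  set (c := Sg N (fun k => cos (b * INR k))). set (s := Sg N (fun k => sin (b * INR k))).
  replace (Sg N _) with (c * c + s * s); [nra|].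
  unfold c at 1, s at 1. rewrite <- !Sg_scal_r, <- Sg_plus.
  apply Sg_ext; intros k _. unfold c, s. rewrite <- !Sg_scal, <- Sg_plus.
  apply Sg_ext; intros l _.
  rewrite minus_IZR, <- !INR_IZR_INZ, Rmult_minus_distr_l, cos_minus. ring.
Qed.

Lemma dwc_toeplitz f : damped_wave_comb f -> toeplitz_cone f.
Proof.
  intros Hf N. induction Hf as [w a b Hw Ha|f1 f2 H1 IH1 H2 IH2|f1 f2 E H IH].
  - set (F := Sg N (fun k => Sg N (fun l => cos (b * IZR (Z.of_nat k - Z.of_nat l))))).
    apply (moment_cone_ext (fun z => (w * exp (- a) * F) * exp (- a) ^ z)).
    + intros z. unfold toeplitz_sum.
      rewrite (Sg_ext _ _ (fun k => (w * exp (- (a * INR (S z)))) * Sg N (fun l => cos (b * IZR (Z.of_nat k - Z.of_nat l))))).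
      2:{ intros k _. cbv beta. rewrite <- Sg_scal. reflexivity. }
      rewrite Sg_scal. fold F.
      replace (- (a * INR (S z))) with (- a + INR z * - a) by (rewrite S_INR; ring).
      rewrite exp_plus.
      replace (exp (INR z * - a)) with (exp (- a) ^ z); [ring|].
      rewrite <- Rpower_pow by apply exp_pos. unfold Rpower. now rewrite ln_exp.
    + apply moment_cone_geometric.
      * apply Rmult_le_pos; [|apply fejer_nonneg]. apply Rmult_le_pos; [auto|left; apply exp_pos].
      * split; [left; apply exp_pos|]. rewrite <- exp_0.
        destruct Ha as [Ha| <-]; [left; apply exp_increasing; lra|rewrite Ropp_0; lra].
  - apply (moment_cone_ext (fun z => toeplitz_sum f1 N z + toeplitz_sum f2 N z)).
    + intros z. unfold toeplitz_sum. rewrite <- Sg_plus. apply Sg_ext; intros.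
      now rewrite <- Sg_plus.
    + now apply moment_cone_plus.
  - eapply moment_cone_ext; [|exact IH].
    intros z. unfold toeplitz_sum. apply Sg_ext; intros. apply Sg_ext; intros. apply E.
Qed.

Lemma toeplitz_cone_lim (F : nat -> nat -> Z -> R) (f : nat -> Z -> R) :
  (forall m, toeplitz_cone (F m)) -> (forall z n, is_lim_seq (fun m => F m (S z) n) (f (S z) n)) ->
  toeplitz_cone f.
Proof.
  intros HF Hl N. apply (moment_cone_lim (fun m => toeplitz_sum (F m) N)).
  - intros m; apply HF.
  - intros z. unfold toeplitz_sum, Sg.
    apply (is_lim_seq_lsum (fun m k => lsum (fun l => F m (S z) (Z.of_nat k - Z.of_nat l)%Z) (seq 0 N))
      (fun k => lsum (fun l => f (S z) (Z.of_nat k - Z.of_nat l)%Z) (seq 0 N))).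
    intros k _. apply (is_lim_seq_lsum (fun m l => F m (S z) (Z.of_nat k - Z.of_nat l)%Z)
       (fun l => f (S z) (Z.of_nat k - Z.of_nat l)%Z)). intros l _. apply Hl.
Qed.

Lemma toeplitz_cone_scal c f : 0 <= c -> toeplitz_cone f -> toeplitz_cone (fun z n => c * f z n).
Proof.
  intros Hc Hf N. apply (moment_cone_ext (fun z => c * toeplitz_sum f N z)).
  - intros z. unfold toeplitz_sum. rewrite <- Sg_scal. apply Sg_ext; intros. now rewrite <- Sg_scal.
  - apply moment_cone_scal; auto.
Qed.

Lemma sum_f_R0_Sg f N : sum_f_R0 f N = Sg (S N) f.
Proof.
  induction N as [|N IH]; [rewrite Sg_S, Sg_0; simpl; ring|].
  rewrite Sg_S, <- IH. reflexivity.
Qed.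

Lemma exp_partial_sums x : is_lim_seq (fun J => Sg (S J) (fun j => / INR (fact j) * x ^ j)) (exp x).
Proof.
  apply is_lim_seq_Reals. intros eps He. destruct (E1_cvg x eps He) as [N HN].
  exists N. intros n Hn. rewrite <- sum_f_R0_Sg. apply HN; auto.
Qed.

(** The partial sums of the exponential series are again damped waves, by closure under products,
    and the cone is closed under limits. *)
Lemma toeplitz_cone_exp f : damped_wave_comb f -> toeplitz_cone (fun z n => exp (f z n)).
Proof.
  intros Hf. apply (toeplitz_cone_lim (fun J z n => Sg (S J) (fun j => / INR (fact j) * f z n ^ j))).
  - intros J. apply dwc_toeplitz.
    apply (dwc_Sg (S J) (fun j z n => / INR (fact j) * f z n ^ j)). intros j.
    apply (dwc_mult (fun _ _ => / INR (fact j)) (fun z n => f z n ^ j)).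
    + apply dwc_const. left. apply Rinv_0_lt_compat, INR_fact_lt_0.
    + now apply dwc_pow.
  - intros z n. apply exp_partial_sums.
Qed.

(** * The cosine series of log |1 - x exp(i t)| *)

Lemma cos_sum_closed x t K :
  (1 - 2 * x * cos t + x ^ 2) * Sg K (fun k => x ^ k * cos (INR (S k) * t))
  = cos t - x - x ^ K * cos (INR (S K) * t) + x ^ S K * cos (INR K * t).
Proof.
  induction K as [|K IH].
  - rewrite Sg_0. simpl. rewrite !Rmult_0_l, !Rmult_1_l, cos_0. ring.
  - rewrite Sg_S, Rmult_plus_distr_l, IH.
    assert (H : cos (INR (S (S K)) * t) = 2 * cos t * cos (INR (S K) * t) - cos (INR K * t)).
    { replace (INR (S (S K)) * t) with (INR (S K) * t + t) by (rewrite (S_INR (S K)); ring).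
      replace (INR K * t) with (INR (S K) * t - t) by (rewrite (S_INR K); ring).
      rewrite cos_plus, cos_minus. ring. }
    rewrite H. simpl pow. ring.
Qed.

Lemma trig_quad_pos x t : 0 <= x < 1 -> (1 - x) ^ 2 <= 1 - 2 * x * cos t + x ^ 2.
Proof. intros Hx. assert (H := COS_bound t). nra. Qed.

(** The expression inside the absolute value vanishes at x = 0. By [cos_sum_closed], the real part
    of a geometric sum cleared of its denominator, its derivative consists of the two boundary terms
    of that sum and is at most 4 x^K / (1-x)^2 on [0,x]. The mean value theorem concludes. *)
Lemma log_cos_remainder x t K : 0 <= x < 1 ->
  Rabs (Sg K (fun k => 2 / INR (S k) * (x ^ S k * cos (INR (S k) * t))) + ln (1 - 2 * x * cos t + x ^ 2))
  <= 4 / (1 - x) ^ 2 * x ^ K.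
Proof.
  intros Hx.
  set (F := fun y => Sg K (fun k => 2 / INR (S k) * (y ^ S k * cos (INR (S k) * t))) + ln (1 - 2 * y * cos t + y ^ 2)).
  set (dF := fun y => 2 * (- y ^ K * cos (INR (S K) * t) + y ^ S K * cos (INR K * t)) / (1 - 2 * y * cos t + y ^ 2)).
  assert (HQ : forall y, 0 <= y <= x -> 0 < 1 - 2 * y * cos t + y ^ 2).
  { intros y Hy. assert (H := trig_quad_pos y t ltac:(lra)). assert (0 < (1 - y) ^ 2) by (apply pow_lt; lra). lra. }
  assert (HS : forall n y, is_derive (fun y => Sg n (fun k => 2 / INR (S k) * (y ^ S k * cos (INR (S k) * t)))) y
     (Sg n (fun k => 2 * (y ^ k * cos (INR (S k) * t))))).
  { induction n as [|n IH]; intros y.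
    - apply (is_derive_const 0).
    - apply (is_derive_ext (fun y => plus (Sg n (fun k => 2 / INR (S k) * (y ^ S k * cos (INR (S k) * t))))
         (2 / INR (S n) * (y ^ S n * cos (INR (S n) * t))))).
      + intros u. now rewrite Sg_S.
      + rewrite Sg_S. apply (is_derive_plus (V := R_NormedModule)); [apply IH|].
        assert (Hn := INR_S_pos n).
        auto_derive; [auto|]. cbv [pred].
        change (match n with O => 1 | S _ => INR n + 1 end) with (INR (S n)). field. lra. }
  assert (HD : forall y, 0 <= y <= x -> is_derive F y (dF y)).
  { intros y Hy. unfold F.
    assert (E : dF y = plus (Sg K (fun k => 2 * (y ^ k * cos (INR (S k) * t)))) ((- 2 * cos t + 2 * y) / (1 - 2 * y * cos t + y ^ 2))).
    { unfold dF. change plus with Rplus. rewrite Sg_scal.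
      assert (H := cos_sum_closed y t K). specialize (HQ y Hy).
      set (Q := 1 - 2 * y * cos t + y ^ 2) in *. set (Z := Sg K (fun k => y ^ k * cos (INR (S k) * t))) in *.
      apply Rmult_eq_reg_l with Q; [|lra].
      replace (Q * (2 * Z + (-2 * cos t + 2 * y) / Q)) with (2 * (Q * Z) + (-2 * cos t + 2 * y)) by (field; lra).
      rewrite H. simpl pow. field. lra. }
    rewrite E. apply (is_derive_plus (V := R_NormedModule)); [apply HS|].
    specialize (HQ y Hy). auto_derive; [lra|]. field. lra. }
  destruct (MVT_gen F 0 x dF) as [c [Hc1 Hc2]].
  - rewrite Rmin_left, Rmax_right by lra. intros y Hy. apply HD; lra.
  - rewrite Rmin_left, Rmax_right by lra. intros y Hy.
    apply derivable_continuous_pt. exists (dF y). apply is_derive_Reals, HD; lra.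
  - rewrite Rmin_left, Rmax_right in Hc1 by lra.
    assert (F0 : F 0 = 0).
    { unfold F. rewrite Sg_zero by (intros; simpl; ring).
      replace (1 - 2 * 0 * cos t + 0 ^ 2) with 1 by ring. rewrite ln_1. ring. }
    fold (F x). replace (F x) with (dF c * x) by lra.
    assert (HQc := HQ c Hc1).
    assert (HQ2 := trig_quad_pos c t ltac:(lra)).
    assert (P : 0 <= c ^ K <= x ^ K) by (split; [apply pow_le; lra|apply pow_incr; lra]).
    assert (HP2 : c ^ S K <= c ^ K) by (simpl; nra).
    assert (0 <= c ^ S K) by (apply pow_le; lra).
    assert (B1 := COS_bound (INR (S K) * t)). assert (B2 := COS_bound (INR K * t)).
    assert (N1 : Rabs (2 * (- c ^ K * cos (INR (S K) * t) + c ^ S K * cos (INR K * t))) <= 4 * x ^ K).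
    { apply Rabs_le. nra. }
    assert (X2 : 0 < (1 - x) ^ 2) by (apply pow_lt; lra).
    assert (X3 : (1 - x) ^ 2 <= 1 - 2 * c * cos t + c ^ 2).
    { apply Rle_trans with ((1 - c) ^ 2); auto. apply pow_incr; lra. }
    unfold dF. rewrite Rabs_mult, (Rabs_right x) by lra.
    unfold Rdiv at 1. rewrite Rabs_mult, Rabs_inv, (Rabs_right (1 - 2 * c * cos t + c ^ 2)) by lra.
    apply Rle_trans with (4 * x ^ K * / (1 - x) ^ 2 * 1).
    + apply Rmult_le_compat; try lra.
      * apply Rmult_le_pos; [apply Rabs_pos|left; now apply Rinv_0_lt_compat].
      * apply Rmult_le_compat; auto; [apply Rabs_pos|left; now apply Rinv_0_lt_compat|].
        apply Rinv_le_contravar; auto.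
    + right. field. lra.
Qed.

Lemma log_cos_series x t : 0 <= x < 1 ->
  is_lim_seq (fun K => Sg K (fun k => 2 / INR (S k) * (x ^ S k * cos (INR (S k) * t))))
    (- ln (1 - 2 * x * cos t + x ^ 2)).
Proof.
  intros Hx. apply lim_eps. intros eps He.
  assert (HG := is_lim_seq_geom x ltac:(rewrite Rabs_right; lra)).
  assert (X2 : 0 < (1 - x) ^ 2) by (apply pow_lt; lra).
  assert (HC : 0 < 4 / (1 - x) ^ 2) by (apply Rdiv_lt_0_compat; lra).
  destruct (proj1 (lim_eps _ _) HG (eps / (4 / (1 - x) ^ 2))) as [N HN].
  { apply Rdiv_lt_0_compat; auto. }
  exists N. intros n Hn. specialize (HN n Hn). rewrite Rminus_0_r, Rabs_right in HN by (apply Rle_ge, pow_le; lra).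
  assert (H := log_cos_remainder x t n Hx).
  unfold Rminus at 1. rewrite Ropp_involutive. apply Rle_lt_trans with (1 := H).
  apply Rmult_lt_compat_l with (r := 4 / (1 - x) ^ 2) in HN; auto.
  replace (4 / (1 - x) ^ 2 * (eps / (4 / (1 - x) ^ 2))) with eps in HN by (field; lra). exact HN.
Qed.

Definition mesh (m : nat) : R := / INR (S m).

Lemma mesh_pos m : 0 < mesh m.
Proof. apply Rinv_0_lt_compat, INR_S_pos. Qed.

Lemma mesh_lim : is_lim_seq mesh 0.
Proof.
  apply lim_eps. intros eps He. destruct (archimed_cor1 eps He) as [N [HN1 HN2]].
  exists N. intros n Hn. assert (H := mesh_pos n). rewrite Rminus_0_r, Rabs_right by lra.
  apply Rle_lt_trans with (2 := HN1). apply Rinv_le_contravar; [apply lt_0_INR; lia|apply le_INR; lia].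
Qed.

Lemma mesh_derivative f l : derivable_pt_lim f 0 l -> is_lim_seq (fun m => (f (mesh m) - f 0) / mesh m) l.
Proof.
  intros H. apply lim_eps. intros eps He. destruct (H eps He) as [[d Hd] Hlim]. simpl in Hlim.
  destruct (proj1 (lim_eps _ _) mesh_lim d Hd) as [N HN]. exists N. intros n Hn.
  specialize (HN n Hn). rewrite Rminus_0_r in HN.
  specialize (Hlim (mesh n) ltac:(assert (H1 := mesh_pos n); lra) HN). now rewrite Rplus_0_l in Hlim.
Qed.

(** With x = exp(-d a), the quadratic is (1-x)^2 + 4 x sin^2(d b / 2), so only the derivatives of
    exp and sin at 0 enter. *)
Lemma mesh_quad_lim a b :
  is_lim_seq (fun m => (1 - 2 * exp (- (mesh m * a)) * cos (mesh m * b) + exp (- (mesh m * a)) ^ 2) / mesh m ^ 2)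
    (a ^ 2 + b ^ 2).
Proof.
  assert (H1 : is_lim_seq (fun m => (exp (- (mesh m * a)) - exp (- (0 * a))) / mesh m) (- a)).
  { apply (mesh_derivative (fun t => exp (- (t * a)))). apply is_derive_Reals.
    auto_derive; auto. rewrite Rmult_0_l, Ropp_0, exp_0. ring. }
  assert (H2 : is_lim_seq (fun m => (sin (mesh m * (b / 2)) - sin (0 * (b / 2))) / mesh m) (b / 2)).
  { apply (mesh_derivative (fun t => sin (t * (b / 2)))). apply is_derive_Reals.
    auto_derive; auto. rewrite Rmult_0_l, cos_0. field. }
  assert (H3 : is_lim_seq (fun m => exp (- (mesh m * a))) 1).
  { replace 1 with (exp (- (0 * a))) by (rewrite Rmult_0_l, Ropp_0; apply exp_0).
    apply (is_lim_seq_continuous (fun t => exp (- (t * a)))); [|apply mesh_lim].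
    apply derivable_continuous_pt. exists (- a * exp (- (0 * a))). apply is_derive_Reals. auto_derive; auto. ring. }
  replace (a ^ 2 + b ^ 2) with ((- a) * (- a) + 4 * 1 * ((b / 2) * (b / 2))) by field.
  apply (is_lim_seq_ext (fun m =>
     ((exp (- (mesh m * a)) - exp (- (0 * a))) / mesh m) * ((exp (- (mesh m * a)) - exp (- (0 * a))) / mesh m)
     + 4 * exp (- (mesh m * a)) * (((sin (mesh m * (b / 2)) - sin (0 * (b / 2))) / mesh m) * ((sin (mesh m * (b / 2)) - sin (0 * (b / 2))) / mesh m)))).
  - intros m. assert (Hm := mesh_pos m). rewrite !Rmult_0_l, Ropp_0, exp_0, sin_0.
    replace (mesh m * b) with (2 * (mesh m * (b / 2))) by field. rewrite cos_2a_sin. field. lra.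
  - apply is_lim_seq_plus'; apply is_lim_seq_mult'; auto; [|now apply is_lim_seq_mult'].
    apply is_lim_seq_mult'; auto. apply is_lim_seq_const.
Qed.

Lemma Rpower_lim (u : nat -> R) l c : 0 < l -> is_lim_seq u l -> is_lim_seq (fun n => Rpower (u n) c) (Rpower l c).
Proof.
  intros Hl Hu. apply (is_lim_seq_continuous (fun y => Rpower y c)); auto.
  apply derivable_continuous_pt. exists (c * Rpower l (c - 1)). now apply derivable_pt_lim_power.
Qed.

(* |1 - e^{-d(z+in)}|^{-p} = exp (p Re sum_k e^{-dk(z+in)}/k) is a positive combination of
   damped waves, and d^p times it tends to (z^2+n^2)^{-p/2}. *)
Lemma KK_toeplitz_cone p : 0 < p -> toeplitz_cone (fun z n => KK p (Z.of_nat z) n).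
Proof.
  intros Hp.
  apply (toeplitz_cone_lim (fun m z n => Rpower (mesh m) p *
    Rpower (1 - 2 * exp (- (mesh m * INR z)) * cos (mesh m * IZR n) + exp (- (mesh m * INR z)) ^ 2) (- (p / 2)))).
  - intros m. apply (toeplitz_cone_scal _ (fun z n => Rpower (1 - 2 * exp (- (mesh m * INR z)) * cos (mesh m * IZR n) + exp (- (mesh m * INR z)) ^ 2) (- (p / 2))));
      [left; apply exp_pos|].
    apply (toeplitz_cone_lim (fun K z n => exp (Sg K (fun k =>
       (p / INR (S k)) * exp (- ((INR (S k) * mesh m) * INR z)) * cos ((INR (S k) * mesh m) * IZR n))))).
    + intros K. apply toeplitz_cone_exp.
      apply (dwc_Sg K (fun k z n => (p / INR (S k)) * exp (- ((INR (S k) * mesh m) * INR z)) * cos ((INR (S k) * mesh m) * IZR n))).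
      intros k. assert (H := INR_S_pos k). assert (Hm := mesh_pos m).
      apply dwc_base; [left; apply Rdiv_lt_0_compat; lra|nra].
    + intros z n. assert (Hm := mesh_pos m). assert (Hz := INR_S_pos z).
      set (x := exp (- (mesh m * INR (S z)))).
      assert (Hx : 0 <= x < 1).
      { unfold x; split; [left; apply exp_pos|]. rewrite <- exp_0. apply exp_increasing. nra. }
      unfold Rpower.
      apply (is_lim_seq_continuous exp); [apply derivable_continuous_pt, derivable_pt_exp|].
      replace (- (p / 2) * ln (1 - 2 * x * cos (mesh m * IZR n) + x ^ 2)) with
        (p / 2 * - ln (1 - 2 * x * cos (mesh m * IZR n) + x ^ 2)) by ring.
      apply (is_lim_seq_ext (fun K => p / 2 * Sg K (fun k => 2 / INR (S k) * (x ^ S k * cos (INR (S k) * (mesh m * IZR n)))))).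
      * intros K. rewrite <- Sg_scal. apply Sg_ext. intros k _. assert (H := INR_S_pos k).
        replace (exp (- (INR (S k) * mesh m * INR (S z)))) with (x ^ S k).
        -- replace (INR (S k) * mesh m * IZR n) with (INR (S k) * (mesh m * IZR n)) by ring. field. lra.
        -- rewrite <- Rpower_pow by apply exp_pos. unfold Rpower, x. rewrite ln_exp. f_equal. ring.
      * apply is_lim_seq_mult'; [apply is_lim_seq_const|]. now apply log_cos_series.
  - intros z n.
    replace (KK p (Z.of_nat (S z)) n) with (Rpower (INR (S z) ^ 2 + IZR n ^ 2) (- (p / 2))).
    2:{ unfold KK. rewrite Rpower_Ropp, plus_IZR, INR_IZR_INZ, !pow_IZR. reflexivity. }
    apply (is_lim_seq_ext (fun m => Rpower ((1 - 2 * exp (- (mesh m * INR (S z))) * cos (mesh m * IZR n) + exp (- (mesh m * INR (S z))) ^ 2) / mesh m ^ 2) (- (p / 2)))).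
    + intros m. assert (Hm := mesh_pos m). assert (Hz := INR_S_pos z).
      set (x := exp (- (mesh m * INR (S z)))).
      assert (Hx : 0 <= x < 1).
      { unfold x; split; [left; apply exp_pos|]. rewrite <- exp_0. apply exp_increasing. nra. }
      assert (HQ := trig_quad_pos x (mesh m * IZR n) Hx).
      assert (0 < (1 - x) ^ 2) by (apply pow_lt; lra).
      assert (0 < mesh m ^ 2) by (apply pow_lt; lra).
      unfold Rdiv at 1. rewrite <- Rpower_mult_distr; [|lra|now apply Rinv_0_lt_compat].
      rewrite Rmult_comm. f_equal.
      rewrite <- Rpower_pow by auto. rewrite <- Rpower_Ropp, !Rpower_mult. f_equal. simpl. field.
    + apply Rpower_lim; [|apply mesh_quad_lim].
      assert (Hz := INR_S_pos z). assert (0 <= IZR n ^ 2) by apply pow2_ge_0.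
      assert (0 < INR (S z) ^ 2) by (apply pow_lt; auto). lra.
Qed.

(** Each of the N+1 rows of the double sum is at most the full line sum, and all but 2R of them
    contain its central part of radius R; dividing by N+1 leaves the line sum in the limit. *)
Lemma cesaro_line p (hp : 4 < p) z :
  is_lim_seq (fun N => mesh N * toeplitz_sum (fun z n => KK p (Z.of_nat z) n) (S N) z) (k1 p (S z)).
Proof.
  set (zz := Z.of_nat (S z)). set (k := k1 p (S z)).
  assert (Hin : forall N a, Sg N (fun l => KK p zz (Z.of_nat a - Z.of_nat l)) <= k).
  { intros N a. unfold Sg. rewrite <- (lsum_map (fun l => (Z.of_nat a - Z.of_nat l)%Z) (KK p zz)).
    apply K1_ge; [auto|unfold zz; lia|].
    apply NoDup_map_NoDup_ForallPairs; [|apply seq_NoDup]. intros u v _ _ H; lia. }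
  apply lim_eps. intros eps He.
  destruct (proj1 (lim_eps _ _) (K1_lim p hp zz ltac:(unfold zz; lia)) (eps / 2) ltac:(lra)) as [R HR].
  specialize (HR R (le_n _)). fold k in HR. set (PR := lsum (KK p zz) (zrange R)) in *.
  change (K1 p zz) with k in HR.
  assert (HPR : 0 <= PR) by (apply lsum_nonneg; intros; left; apply KK_pos).
  assert (Hk : PR <= k) by (apply K1_ge; [auto|unfold zz; lia|apply zrange_NoDup]).
  assert (Hlow : forall N a, (R <= a)%nat -> (a + R < N)%nat -> PR <= Sg N (fun l => KK p zz (Z.of_nat a - Z.of_nat l))).
  { intros N a H1 H2. unfold Sg. rewrite <- (lsum_map (fun l => (Z.of_nat a - Z.of_nat l)%Z) (KK p zz)).
    apply lsum_incl; [apply zrange_NoDup| |intros; left; apply KK_pos].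
    intros x Hx. apply in_zrange in Hx. apply in_map_iff. exists (Z.to_nat (Z.of_nat a - x)).
    split; [lia|apply in_seq; lia]. }
  destruct (INR_archimed (eps / 2) (2 * INR R * k) ltac:(lra)) as [M HM].
  exists (M + 2 * R)%nat. intros N HN.
  assert (Hm := mesh_pos N). assert (HmN : mesh N * INR (S N) = 1) by (unfold mesh; field; apply not_0_INR; lia).
  unfold toeplitz_sum. fold zz.
  set (T := Sg (S N) _).
  assert (Hup : T <= INR (S N) * k).
  { unfold T. rewrite <- (Sg_const (S N) k). apply Sg_le. intros a _. apply Hin. }
  assert (Hlo : (INR (S N) - 2 * INR R) * PR <= T).
  { replace (INR (S N) - 2 * INR R) with (INR (Nat.min (S N - R) (S N) - R)).
    2:{ rewrite Nat.min_l by lia. rewrite !minus_INR by lia. ring. }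
    rewrite <- Sg_interval. unfold T, Sg at 1. rewrite <- lsum_scal_r. apply Sg_le. intros a Ha.
    destruct (Nat.leb_spec R a); destruct (Nat.ltb_spec a (S N - R)); simpl ind; rewrite ?Rmult_0_l, ?Rmult_1_l;
      try (apply Sg_nonneg; intros; left; apply KK_pos).
    apply Hlow; lia. }
  apply Rabs_def2 in HR.
  assert (HMN : 2 * INR R * k < INR (S N) * (eps / 2)).
  { apply Rlt_le_trans with (1 := HM). apply Rmult_le_compat_r; [lra|]. apply le_INR; lia. }
  assert (0 <= INR R) by apply pos_INR.
  assert (0 < INR (S N)) by apply INR_S_pos.
  apply Rabs_def1.
  - assert (mesh N * T <= mesh N * (INR (S N) * k)) by (apply Rmult_le_compat_l; lra).
    rewrite <- Rmult_assoc, HmN in H1. lra.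
  - assert (X : INR (S N) * (k - eps) < T).
    { assert (INR R * PR <= INR R * k) by (apply Rmult_le_compat_l; lra). nra. }
    apply Rmult_lt_compat_l with (r := mesh N) in X; auto.
    rewrite <- Rmult_assoc, HmN in X. lra.
Qed.

Lemma k1_moment_cone p : 4 < p -> moment_cone (fun z => k1 p (S z)).
Proof.
  intros hp. apply (moment_cone_lim (fun N z => mesh N * toeplitz_sum (fun z n => KK p (Z.of_nat z) n) (S N) z)).
  - intros N. apply moment_cone_scal; [left; apply mesh_pos|]. apply KK_toeplitz_cone; lra.
  - intros z. now apply cesaro_line.
Qed.

(** * Energy of a row *)

Definition dif (a b : bool) : R := ind (xorb a b).

Lemma dif_nonneg a b : 0 <= dif a b.
Proof. apply ind_nonneg. Qed.

Lemma dif_sym a b : dif a b = dif b a.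
Proof. unfold dif. now rewrite xorb_comm. Qed.

Lemma dif_diag a : dif a a = 0.
Proof. unfold dif. now rewrite xorb_nilpotent. Qed.

Lemma dif_triangle a b c : dif a c <= dif a b + dif b c.
Proof. destruct a, b, c; unfold dif; simpl; lra. Qed.

(* Position s stands for a sign change between s and s+1. *)
Fixpoint breaks (u : nat -> bool) (L : nat) : list nat :=
  match L with
  | O => []
  | S n => match n with
           | O => []
           | S m => if xorb (u m) (u n) then m :: breaks u n else breaks u n
           end
  end.

Lemma breaks_SS u m : breaks u (S (S m)) = if xorb (u m) (u (S m)) then m :: breaks u (S m) else breaks u (S m).
Proof. reflexivity. Qed.

Lemma in_breaks u L s : In s (breaks u L) <-> (S s < L)%nat /\ xorb (u s) (u (S s)) = true.
Proof.
  induction L as [|[|m] IH]; [simpl; intuition lia|simpl; intuition lia|].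
  rewrite breaks_SS. destruct (xorb (u m) (u (S m))) eqn:E.
  - simpl In. rewrite IH. split.
    + intros [<-|[H1 H2]]; split; auto; lia.
    + intros [H1 H2]. destruct (Nat.eq_dec m s); [now left|right; split; auto; lia].
  - rewrite IH. split.
    + intros [H1 H2]; split; auto; lia.
    + intros [H1 H2]. destruct (Nat.eq_dec m s); [subst; congruence|split; auto; lia].
Qed.

Lemma breaks_decreasing u L : decreasing (breaks u L).
Proof.
  induction L as [|[|m] IH]; [constructor|constructor|].
  rewrite breaks_SS. destruct (xorb (u m) (u (S m))); auto.
  constructor; auto. apply Forall_forall. intros x Hx. apply in_breaks in Hx. lia.
Qed.

(** The wall [s] separates the sites a - z and a. *)
Definition straddle (z a s : nat) : bool := (s <? a)%nat && (a <=? s + z)%nat.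

Fixpoint alt_straddle (z a : nat) (l : list nat) : R :=
  match l with
  | [] => 0
  | t :: l' => ind (straddle z a t) - alt_straddle z a l'
  end.

(** If N walls to the left of [a] are straddled this is N - 2 floor(N/2), the parity of N. Written
    as a sum over single walls and pairs of walls, it can be summed over [a]. *)
Fixpoint parity_straddle (z a : nat) (l : list nat) : R :=
  match l with
  | [] => 0
  | s :: l' => ind (straddle z a s) + parity_straddle z a l' - 2 * (ind (straddle z a s) * alt_straddle z a l')
  end.

Lemma straddle_none z a l : (forall t, In t l -> straddle z a t = false) ->
  alt_straddle z a l = 0 /\ parity_straddle z a l = 0.
Proof.
  induction l as [|t l IH]; intros H; simpl; [lra|].
  rewrite H by now left. destruct IH as [-> ->]; [auto with datatypes|]. simpl. lra.
Qed.

(* The straddled walls are consecutive in the list, so the alternating sum is the parity of their number. *)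
Lemma parity_eq_alt z a l : decreasing l -> (forall t, In t l -> (t < a)%nat) ->
  parity_straddle z a l = alt_straddle z a l /\ (alt_straddle z a l = 0 \/ alt_straddle z a l = 1).
Proof.
  induction l as [|t l IH]; intros Hd H; simpl; [auto|].
  destruct (IH (decreasing_tail _ _ Hd)) as [E1 E2]; [auto with datatypes|].
  destruct (straddle z a t) eqn:Et.
  - simpl ind. rewrite E1. split; [ring|]. destruct E2 as [->| ->]; [right|left]; ring.
  - simpl ind. assert (Hn := straddle_none z a l). destruct Hn as [-> ->].
    + intros x Hx. inversion Hd as [|? ? _ HF]; subst. rewrite Forall_forall in HF. specialize (HF x Hx).
      assert (Ht : (t < a)%nat) by (apply H; now left).
      unfold straddle in *. destruct (Nat.ltb_spec t a); [|lia]. rewrite andb_true_l in Et. apply Nat.leb_gt in Et.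
      destruct (Nat.leb_spec a (x + z)); [lia|]. apply andb_false_r.
    + split; [ring|left; ring].
Qed.

Lemma parity_straddle_nonneg z a l : decreasing l -> 0 <= parity_straddle z a l.
Proof.
  induction l as [|s l IH]; intros Hd; simpl; [lra|].
  destruct (Nat.lt_ge_cases s a) as [H|H].
  - assert (P := parity_eq_alt z a (s :: l) Hd). destruct P as [P1 P2].
    + intros t [->|Ht]; auto. inversion Hd as [|? ? _ HF]; subst. rewrite Forall_forall in HF.
      specialize (HF t Ht). lia.
    + simpl in P1. rewrite P1. destruct P2 as [P2|P2]; simpl in P2; rewrite P2; lra.
  - unfold straddle at 1 2. destruct (Nat.ltb_spec s a); [lia|]. simpl ind.
    specialize (IH (decreasing_tail _ _ Hd)). lra.
Qed.

Lemma alt_straddle_breaks u n z : (z <= n)%nat -> alt_straddle z n (breaks u (S n)) = dif (u (n - z)%nat) (u n).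
Proof.
  revert z; induction n as [|m IH]; intros z Hz.
  - replace z with 0%nat by lia. simpl. now rewrite dif_diag.
  - destruct z as [|z].
    + rewrite Nat.sub_0_r, dif_diag. apply straddle_none.
      intros t _. unfold straddle. destruct (Nat.ltb_spec t (S m)); destruct (Nat.leb_spec (S m) (t + 0)); auto; lia.
    + assert (E : alt_straddle (S z) (S m) (breaks u (S m)) = dif (u (m - z)%nat) (u m)).
      { rewrite <- IH by lia.
        assert (HIn : forall t, In t (breaks u (S m)) -> (t < m)%nat) by (intros t Ht; apply in_breaks in Ht; lia).
        revert HIn. generalize (breaks u (S m)). induction l as [|t l IHl]; intros HIn; [reflexivity|].
        simpl. rewrite IHl by auto with datatypes. f_equal. f_equal. assert (t < m)%nat by (apply HIn; now left).
        unfold straddle. destruct (Nat.ltb_spec t (S m)); destruct (Nat.ltb_spec t m); try lia; rewrite !andb_true_l.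
        destruct (Nat.leb_spec (S m) (t + S z)); destruct (Nat.leb_spec m (t + z)); auto; lia. }
      replace (S m - S z)%nat with (m - z)%nat by lia. rewrite breaks_SS.
      destruct (xorb (u m) (u (S m))) eqn:Ex.
      * change (alt_straddle (S z) (S m) (m :: breaks u (S m))) with
          (ind (straddle (S z) (S m) m) - alt_straddle (S z) (S m) (breaks u (S m))). rewrite E. unfold straddle.
        destruct (Nat.ltb_spec m (S m)); [|lia]. destruct (Nat.leb_spec (S m) (m + S z)); [|lia]. simpl ind.
        unfold dif. destruct (u m), (u (S m)), (u (m - z)%nat); simpl in *; try discriminate; lra.
      * rewrite E. unfold dif. destruct (u m), (u (S m)); simpl in *; try discriminate; auto.
Qed.

Lemma parity_straddle_breaks u L z a : (z <= a < L)%nat ->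
  parity_straddle z a (breaks u L) = dif (u (a - z)%nat) (u a).
Proof.
  induction L as [|[|m] IH]; intros H; [lia| |].
  - replace z with 0%nat by lia. replace a with 0%nat by lia. simpl. now rewrite dif_diag.
  - destruct (Nat.eq_dec a (S m)) as [->|Hne].
    + rewrite <- (alt_straddle_breaks u (S m)) by lia. apply parity_eq_alt; [apply breaks_decreasing|].
      intros t Ht. apply in_breaks in Ht. lia.
    + rewrite <- IH by lia. rewrite breaks_SS. destruct (xorb (u m) (u (S m))); auto.
      change (parity_straddle z a (m :: breaks u (S m))) with
        (ind (straddle z a m) + parity_straddle z a (breaks u (S m)) - 2 * (ind (straddle z a m) * alt_straddle z a (breaks u (S m)))).
      unfold straddle at 1 2. destruct (Nat.ltb_spec m a); [lia|]. simpl ind. ring.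
Qed.

(** The range is lengthened to L + z so that every wall, even one near the right end, is straddled
    exactly z times. *)
Lemma sum_straddle L z s : (S s < L)%nat -> Sg (L + z) (fun a => ind (straddle z a s)) = INR z.
Proof.
  intros H. rewrite (Sg_ext _ _ (fun a => ind ((S s <=? a) && (a <? S (s + z)))%nat)).
  - rewrite Sg_interval. f_equal. lia.
  - intros a _. unfold straddle. f_equal; f_equal.
Qed.

(** Two walls at distance r are straddled together by z - r positions; truncated subtraction gives 0
    when r > z. *)
Lemma sum_straddle_alt L z s l : (S s < L)%nat -> (forall t, In t l -> (t < s)%nat) ->
  Sg (L + z) (fun a => ind (straddle z a s) * alt_straddle z a l) = altfrom (fun r => INR (z - r)) s l.
Proof.
  intros Hs. induction l as [|t l IH]; intros H; simpl.
  - apply Sg_zero; intros; ring.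
  - rewrite (Sg_ext _ _ (fun a => ind ((S s <=? a) && (a <? S (t + z)))%nat - ind (straddle z a s) * alt_straddle z a l)).
    + rewrite Sg_minus, IH by auto with datatypes. f_equal. rewrite Sg_interval. f_equal.
      assert (t < s)%nat by (apply H; now left). lia.
    + intros a _. assert (t < s)%nat by (apply H; now left).
      rewrite Rmult_minus_distr_l. f_equal. unfold straddle.
      destruct (Nat.ltb_spec s a); destruct (Nat.leb_spec a (s + z)); destruct (Nat.ltb_spec t a);
        destruct (Nat.leb_spec a (t + z)); destruct (Nat.leb_spec (S s) a); destruct (Nat.ltb_spec a (S (t + z)));
        simpl; try lia; ring.
Qed.

Lemma sum_parity_straddle L z l : decreasing l -> (forall s, In s l -> (S s < L)%nat) ->
  Sg (L + z) (fun a => parity_straddle z a l) = INR (length l) * INR z - 2 * altpairs (fun r => INR (z - r)) l.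
Proof.
  induction l as [|s l IH]; intros Hd H.
  - simpl. rewrite Sg_zero by reflexivity. ring.
  - simpl parity_straddle. rewrite Sg_minus, Sg_plus, Sg_scal.
    rewrite sum_straddle by (apply H; now left).
    rewrite sum_straddle_alt.
    + rewrite IH; [|eapply decreasing_tail; eauto|auto with datatypes].
      change (length (s :: l)) with (S (length l)). rewrite S_INR. simpl altpairs. ring.
    + apply H; now left.
    + intros t Ht. inversion Hd as [|? ? _ HF]; subst. rewrite Forall_forall in HF. now apply HF.
Qed.

Definition shift_count (u : nat -> bool) (L z : nat) : R := Sg (L - z) (fun i => dif (u i) (u (i + z)%nat)).

Lemma shift_count_nonneg u L z : 0 <= shift_count u L z.
Proof. apply Sg_nonneg; intros; apply dif_nonneg. Qed.

(** The left side counts only pairs inside the window. The positions added at both ends have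
    nonnegative parity, so free ends go in the favourable direction. *)
Lemma shift_count_le u L z :
  shift_count u L z <= INR (length (breaks u L)) * INR z - 2 * altpairs (fun r => INR (z - r)) (breaks u L).
Proof.
  rewrite <- (sum_parity_straddle L) by (try apply breaks_decreasing; intros s Hs; now apply in_breaks in Hs).
  unfold shift_count. destruct (Nat.le_gt_cases z L) as [H|H].
  - replace (L + z)%nat with (z + ((L - z) + z))%nat by lia. rewrite !Sg_add.
    assert (H1 : 0 <= Sg z (fun a => parity_straddle z a (breaks u L))).
    { apply Sg_nonneg; intros; apply parity_straddle_nonneg, breaks_decreasing. }
    assert (H2 : 0 <= Sg z (fun k => parity_straddle z (z + (L - z + k)) (breaks u L))).
    { apply Sg_nonneg; intros; apply parity_straddle_nonneg, breaks_decreasing. }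
    rewrite (Sg_ext (L - z) (fun k => parity_straddle z (z + k) (breaks u L)) (fun i => dif (u i) (u (i + z)%nat))); [lra|].
    intros i Hi. rewrite parity_straddle_breaks by lia. do 2 f_equal; lia.
  - replace (L - z)%nat with 0%nat by lia. rewrite Sg_0.
    apply Sg_nonneg; intros; apply parity_straddle_nonneg, breaks_decreasing.
Qed.

Lemma altpairs_lim (F : nat -> nat -> R) (f : nat -> R) l :
  (forall r, is_lim_seq (fun n => F n r) (f r)) -> is_lim_seq (fun n => altpairs (F n) l) (altpairs f l).
Proof.
  intros H. destruct (finite_functional_altpairs l) as [P HP]. rewrite HP.
  apply (is_lim_seq_ext (fun n => lincomb P (F n))); [intros; now rewrite HP|].
  apply (is_lim_seq_lsum (fun n ck => fst ck * F n (snd ck)) (fun ck => fst ck * f (snd ck))).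
  intros [c k] _. simpl. apply (is_lim_seq_mult' (fun _ => c)); [apply is_lim_seq_const|apply H].
Qed.

Lemma altpairs_Sg n (F : nat -> nat -> R) (c : nat -> R) l :
  altpairs (fun r => Sg n (fun i => c i * F i r)) l = Sg n (fun i => c i * altpairs (F i) l).
Proof.
  destruct (finite_functional_altpairs l) as [P HP]. rewrite HP. unfold lincomb.
  rewrite (Sg_ext n (fun i => c i * altpairs (F i) l) (fun i => lsum (fun ck => c i * (fst ck * F i (snd ck))) P)).
  2:{ intros i _. rewrite HP. unfold lincomb. now rewrite <- lsum_scal. }
  unfold Sg. rewrite lsum_swap. apply lsum_ext. intros ck. rewrite <- lsum_scal. apply lsum_ext; intros; ring.
Qed.

Lemma altpairs_scal c f l : altpairs (fun r => c * f r) l = c * altpairs f l.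
Proof.
  assert (H := altpairs_Sg 1 (fun _ => f) (fun _ => c) l). rewrite Sg_S, Sg_0, Rplus_0_l in H. rewrite <- H.
  destruct (finite_functional_altpairs l) as [P HP]. rewrite !HP. apply lsum_ext. intros ck.
  now rewrite Sg_S, Sg_0, Rplus_0_l.
Qed.

Lemma gapsum_lim (F : nat -> nat -> nat -> R) (f : nat -> nat -> R) l :
  (forall t s, is_lim_seq (fun n => F n t s) (f t s)) -> is_lim_seq (fun n => gapsum (F n) l) (gapsum f l).
Proof.
  intros H. induction l as [|s l IH]; simpl; [apply is_lim_seq_const|].
  apply is_lim_seq_plus'; auto. destruct l; [apply is_lim_seq_const|apply H].
Qed.

(** * Periodic chains: the triangle wave and its ramps *)

Definition st (d k : nat) : bool := (k mod (2 * d) <? d)%nat.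
(** The triangle wave: for d >= 1, the distance from [z] to the nearest multiple of 2d. *)
Definition tri (d z : nat) : R := / 2 * Sg (2 * d) (fun k => dif (st d k) (st d (k + z)%nat)).

Lemma st_period d k : (1 <= d)%nat -> st d (k + 2 * d)%nat = st d k.
Proof. intros H. unfold st. replace (k + 2 * d)%nat with (k + 1 * (2 * d))%nat by lia. now rewrite Nat.Div0.mod_add. Qed.

Lemma st_lt d k : (k < d)%nat -> st d k = true.
Proof. intros H. unfold st. rewrite Nat.mod_small by lia. now apply Nat.ltb_lt. Qed.

Lemma st_ge d k : (d <= k < 2 * d)%nat -> st d k = false.
Proof. intros H. unfold st. rewrite Nat.mod_small by lia. now apply Nat.ltb_ge. Qed.

Lemma st_lt2 d k : (2 * d <= k < 3 * d)%nat -> st d k = true.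
Proof.
  intros H. replace k with ((k - 2 * d) + 2 * d)%nat by lia. rewrite st_period by lia. apply st_lt; lia.
Qed.

Lemma tri_nonneg d z : 0 <= tri d z.
Proof. unfold tri. assert (0 <= Sg (2 * d) (fun k => dif (st d k) (st d (k + z)%nat))) by (apply Sg_nonneg; intros; apply dif_nonneg). lra. Qed.

Lemma tri_period d z : (1 <= d)%nat -> tri d (z + 2 * d) = tri d z.
Proof.
  intros H. unfold tri. f_equal. apply Sg_ext. intros k _.
  replace (k + (z + 2 * d))%nat with ((k + z) + 2 * d)%nat by lia. now rewrite st_period.
Qed.

Lemma tri_ge_low d z : (z <= d)%nat -> INR z <= tri d z.
Proof.
  intros H. unfold tri.
  assert (K : Sg (2 * d) (fun k => ind ((d - z <=? k) && (k <? d))%nat + ind ((2 * d - z <=? k) && (k <? 2 * d))%nat)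
     <= Sg (2 * d) (fun k => dif (st d k) (st d (k + z)%nat))).
  { apply Sg_le. intros k Hk.
    destruct (Nat.leb_spec (d - z) k); destruct (Nat.ltb_spec k d); destruct (Nat.leb_spec (2 * d - z) k);
      destruct (Nat.ltb_spec k (2 * d)); try lia; simpl; try (rewrite Rplus_0_r; apply dif_nonneg).
    - rewrite (st_lt d k), (st_ge d (k + z)) by lia. unfold dif; simpl; lra.
    - rewrite (st_ge d k), (st_lt2 d (k + z)) by lia. unfold dif; simpl; lra. }
  rewrite Sg_plus, !Sg_interval in K.
  replace (Nat.min d (2 * d) - (d - z))%nat with z in K by lia.
  replace (Nat.min (2 * d) (2 * d) - (2 * d - z))%nat with z in K by lia. lra.
Qed.

Lemma tri_ge_high d z : (d <= z <= 2 * d)%nat -> INR (2 * d - z) <= tri d z.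
Proof.
  intros H. unfold tri.
  assert (K : Sg (2 * d) (fun k => ind ((0 <=? k) && (k <? 2 * d - z))%nat + ind ((d <=? k) && (k <? 3 * d - z))%nat)
     <= Sg (2 * d) (fun k => dif (st d k) (st d (k + z)%nat))).
  { apply Sg_le. intros k Hk.
    destruct (Nat.leb_spec 0 k); destruct (Nat.ltb_spec k (2 * d - z)); destruct (Nat.leb_spec d k);
      destruct (Nat.ltb_spec k (3 * d - z)); try lia; simpl; try (rewrite Rplus_0_r; apply dif_nonneg).
    - rewrite (st_lt d k), (st_ge d (k + z)) by lia. unfold dif; simpl; lra.
    - rewrite (st_ge d k), (st_lt2 d (k + z)) by lia. unfold dif; simpl; lra. }
  rewrite Sg_plus, !Sg_interval in K.
  replace (Nat.min (2 * d - z) (2 * d) - 0)%nat with (2 * d - z)%nat in K by lia.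
  replace (Nat.min (3 * d - z) (2 * d) - d)%nat with (2 * d - z)%nat in K by lia. lra.
Qed.

Lemma Sg_periodic P f z : (forall k, f (k + P)%nat = f k) -> Sg P (fun k => f (k + z)%nat) = Sg P f.
Proof.
  intros H. induction z as [|z IH].
  - apply Sg_ext; intros; f_equal; lia.
  - rewrite <- IH. destruct P as [|P]; [reflexivity|].
    rewrite Sg_S, Sg_head. replace (P + S z)%nat with (z + S P)%nat by lia. rewrite H.
    rewrite Rplus_comm. f_equal; [apply Sg_ext; intros; f_equal; lia].
Qed.

Lemma tri_le d z : (1 <= d)%nat -> tri d z <= INR z.
Proof.
  intros Hd. induction z as [|z IH].
  - unfold tri. rewrite Sg_zero; [simpl; lra|]. intros k _. rewrite Nat.add_0_r. apply dif_diag.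
  - assert (K : Sg (2 * d) (fun k => dif (st d k) (st d (k + S z)%nat)) <=
       Sg (2 * d) (fun k => dif (st d k) (st d (k + z)%nat)) + 2).
    { apply Rle_trans with (Sg (2 * d) (fun k => dif (st d k) (st d (k + z)%nat)) +
        Sg (2 * d) (fun k => dif (st d (k + z)%nat) (st d (S (k + z))))).
      - rewrite <- Sg_plus. apply Sg_le. intros k _. rewrite Nat.add_succ_r. apply dif_triangle.
      (* One more unit of shift crosses at most the two walls of a period, at d - 1 and 2d - 1. *)
      - apply Rplus_le_compat_l. rewrite (Sg_periodic _ (fun k => dif (st d k) (st d (S k)))).
        2:{ intros k. replace (S (k + 2 * d)) with (S k + 2 * d)%nat by lia. now rewrite !st_period. }
        apply Rle_trans with (Sg (2 * d) (fun k => (if Nat.eqb k (d - 1) then 1 else 0) + (if Nat.eqb k (2 * d - 1) then 1 else 0))).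
        + apply Sg_le. intros k Hk.
          destruct (Nat.eqb_spec k (d - 1)); [|destruct (Nat.eqb_spec k (2 * d - 1))].
          * assert (dif (st d k) (st d (S k)) <= 1) by apply ind_le1. destruct (Nat.eqb k (2 * d - 1)); lra.
          * assert (dif (st d k) (st d (S k)) <= 1) by apply ind_le1. lra.
          * destruct (Nat.lt_ge_cases k d).
            -- rewrite !st_lt by lia. rewrite dif_diag. lra.
            -- rewrite !st_ge by lia. rewrite dif_diag. lra.
        + rewrite Sg_plus, !Sg_delta. destruct (Nat.ltb_spec (d - 1) (2 * d)); destruct (Nat.ltb_spec (2 * d - 1) (2 * d)); try lia; lra. }
    unfold tri in *. rewrite S_INR. lra.
Qed.

(** z minus the triangle wave is piecewise linear with slopes 0 and 2, namely 2 (z-d)_+ - 2 (z-2d)_+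
    + ...; truncated subtraction supplies the positive parts. This links the alternating series of
    the chessboard estimate to the energy of periodic stripes. *)
Definition alt_ramp (m d z : nat) : R :=
  2 * Sg m (fun k => INR (z - (2 * k + 1) * d) - INR (z - (2 * k + 2) * d)).

Lemma alt_ramp_nonneg m d z : 0 <= alt_ramp m d z.
Proof.
  unfold alt_ramp. assert (0 <= Sg m (fun k => INR (z - (2 * k + 1) * d) - INR (z - (2 * k + 2) * d))); [|lra].
  apply Sg_nonneg. intros k _. assert (INR (z - (2 * k + 2) * d) <= INR (z - (2 * k + 1) * d)) by (apply le_INR; nia). lra.
Qed.

Lemma alt_ramp_ge m d z : (1 <= d)%nat -> (z <= 2 * m * d)%nat -> INR z - tri d z <= alt_ramp m d z.
Proof.
  intros Hd. revert z; induction m as [|m IH]; intros z Hz.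
  - replace z with 0%nat by lia. unfold alt_ramp. rewrite Sg_0. assert (H := tri_nonneg d 0). simpl INR. lra.
  - assert (Hrec : alt_ramp (S m) d z = 2 * (INR (z - d) - INR (z - 2 * d)) + alt_ramp m d (z - 2 * d)).
    { unfold alt_ramp. rewrite Sg_head, Rmult_plus_distr_l. f_equal.
      - replace ((2 * 0 + 1) * d)%nat with d by lia. now replace ((2 * 0 + 2) * d)%nat with (2 * d)%nat by lia.
      - f_equal. apply Sg_ext. intros k _.
        replace (z - 2 * d - (2 * k + 1) * d)%nat with (z - (2 * S k + 1) * d)%nat by (rewrite <- Nat.sub_add_distr; f_equal; ring).
        now replace (z - 2 * d - (2 * k + 2) * d)%nat with (z - (2 * S k + 2) * d)%nat by (rewrite <- Nat.sub_add_distr; f_equal; ring). }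
    rewrite Hrec. destruct (Nat.le_gt_cases (2 * d) z) as [H|H].
    + specialize (IH (z - 2 * d)%nat ltac:(nia)).
      replace (tri d z) with (tri d (z - 2 * d)).
      2:{ rewrite <- (tri_period d (z - 2 * d)) by auto. f_equal. lia. }
      rewrite !minus_INR in * by lia. rewrite mult_INR in *. simpl (INR 2) in *. lra.
    + replace (z - 2 * d)%nat with 0%nat by lia. assert (P := alt_ramp_nonneg m d 0). simpl (INR 0).
      destruct (Nat.le_gt_cases z d) as [H1|H1].
      * replace (z - d)%nat with 0%nat by lia. assert (T := tri_ge_low d z H1). simpl (INR 0). lra.
      * assert (T := tri_ge_high d z ltac:(lia)). rewrite !minus_INR in * by lia.
        rewrite mult_INR in *. simpl (INR 2) in *. lra.
Qed.

(** * Interaction of walls and the energy of a row in terms of its gaps *)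

Section Rows.
Context (p : R) (hp : 4 < p).

(** A pair of sites at distance z straddles two walls at distance r in (z - r)_+ positions, so this
    is 2 sum_z k1(z) (z - r)_+; the factor 2 is that of the parity formula. *)
Definition wall_potential (r : nat) : R := 2 * nsum (fun m => INR (S m) * k1 p (S (m + r))).

Lemma k1_antitone n m : k1 p (S (n + m)) <= k1 p (S n).
Proof.
  induction m as [|m IH]; [rewrite Nat.add_0_r; lra|].
  rewrite Nat.add_succ_r. assert (H := k1_decr p hp (n + m)). lra.
Qed.

Lemma wall_potential_lim r :
  is_lim_seq (fun N => 2 * Sg N (fun m => INR (S m) * k1 p (S (m + r)))) (wall_potential r).
Proof.
  unfold wall_potential. apply (is_lim_seq_mult' (fun _ => 2)); [apply is_lim_seq_const|].
  apply (nsum_lim _ (jc p)).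
  - intros n. assert (H := k1_pos p hp (n + r)). assert (H0 := INR_S_pos n). nra.
  - intros n. apply Rle_trans with (Sg n (fun n => INR (S n) * k1 p (S n))).
    + apply Sg_le. intros m _. assert (H := k1_antitone m r). assert (H0 := INR_S_pos m). nra.
    + apply Sg_le_lim; [apply moment1_nonneg; auto|now apply jc_lim].
Qed.

Lemma wall_potential_cone : moment_cone wall_potential.
Proof.
  apply (moment_cone_lim (fun N r => 2 * Sg N (fun m => INR (S m) * k1 p (S (m + r))))).
  - intros N. apply moment_cone_scal; [lra|].
    apply (moment_cone_Sg N (fun m r => INR (S m) * k1 p (S (m + r)))). intros m.
    apply moment_cone_scal; [left; apply INR_S_pos|].
    apply (moment_cone_ext (fun r => k1 p (S (r + m)))); [intros; now rewrite Nat.add_comm|].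
    apply (moment_cone_shift m (fun z => k1 p (S z))). now apply k1_moment_cone.
  - apply wall_potential_lim.
Qed.

Lemma wall_potential_pos r : 0 < wall_potential r.
Proof.
  assert (Hk := k1_pos p hp r).
  apply Rlt_le_trans with (2 * k1 p (S r)); [lra|].
  apply (lim_ge_const_loc _ _ _ 1 (wall_potential_lim r)). intros n Hn.
  assert (H := Sg_mono 1 n (fun m => INR (S m) * k1 p (S (m + r))) Hn).
  rewrite Sg_S, Sg_0 in H. simpl (INR 1) in H. simpl (0 + r)%nat in H.
  assert (forall i, (i < n)%nat -> 0 <= INR (S i) * k1 p (S (i + r))).
  { intros i _. assert (H1 := k1_pos p hp (i + r)). assert (H0 := INR_S_pos i). nra. }
  specialize (H H0). lra.
Qed.

Lemma wall_potential_decr r : wall_potential (S r) < wall_potential r.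
Proof.
  assert (Hk := k1_decr p hp r).
  enough (wall_potential (S r) <= wall_potential r - 2 * (k1 p (S r) - k1 p (S (S r)))) by lra.
  apply (lim_le_const _ _ _ (wall_potential_lim (S r))). intros N.
  assert (H1 : 2 * Sg (S N) (fun m => INR (S m) * k1 p (S (m + r))) <= wall_potential r).
  { apply (is_lim_seq_incr_compare (fun N => 2 * Sg N (fun m => INR (S m) * k1 p (S (m + r)))) _ (wall_potential_lim r)).
    intros n. rewrite Sg_S. assert (H1 := k1_pos p hp (n + r)). assert (H0 := INR_S_pos n). nra. }
  assert (H2 : Sg N (fun m => INR (S m) * k1 p (S (m + S r))) <= Sg (S N) (fun m => INR (S m) * k1 p (S (m + S r)))).
  { rewrite Sg_S. assert (H3 := k1_pos p hp (N + S r)). assert (H0 := INR_S_pos N). nra. }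
  rewrite Sg_head in H1, H2. simpl (INR 1) in *. simpl (0 + r)%nat in *. simpl (0 + S r)%nat in *.
  assert (H4 : Sg N (fun k => INR (S (S k)) * k1 p (S (S k + S r))) <= Sg N (fun k => INR (S (S k)) * k1 p (S (S k + r)))).
  { apply Sg_le. intros k _. apply Rmult_le_compat_l; [left; apply INR_S_pos|].
    assert (H5 := k1_antitone (S k + r) 1). replace (S k + r + 1)%nat with (S k + S r)%nat in H5 by lia. exact H5. }
  lra.
Qed.

Lemma gap_penalty_nonneg d d' : 0 <= gap_penalty wall_potential d d'.
Proof.
  unfold gap_penalty. destruct (Nat.eqb d d'); [lra|].
  assert (0 < bdiff wall_potential 5 (2 * Nat.min d d')); [|lra].
  apply bdiff_pos; auto using wall_potential_cone, wall_potential_pos, wall_potential_decr.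
Qed.

Lemma gap_penalty_pos d d' : d <> d' -> 0 < gap_penalty wall_potential d d'.
Proof.
  intros Hne. unfold gap_penalty. destruct (Nat.eqb_spec d d'); [contradiction|].
  assert (0 < bdiff wall_potential 5 (2 * Nat.min d d')); [|lra].
  apply bdiff_pos; auto using wall_potential_cone, wall_potential_pos, wall_potential_decr.
Qed.

Lemma wall_potential_ramp r :
  is_lim_seq (fun Z => Sg Z (fun z => k1 p (S z) * (2 * INR (S z - r)))) (wall_potential r).
Proof.
  apply (is_lim_seq_incr_n _ r).
  apply (is_lim_seq_ext (fun N => 2 * Sg N (fun m => INR (S m) * k1 p (S (m + r))))).
  2: apply wall_potential_lim.
  intros N. rewrite (Nat.add_comm N r), Sg_add, (Sg_zero r).
  - rewrite Rplus_0_l, <- Sg_scal. apply Sg_ext. intros m _.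
    replace (S (r + m) - r)%nat with (S m) by lia. rewrite (Nat.add_comm r m). ring.
  - intros z Hz. replace (S z - r)%nat with 0%nat by lia. simpl. ring.
Qed.

Definition row_interaction (u : nat -> bool) (L : nat) : R := Sg L (fun z => k1 p (S z) * shift_count u L (S z)).

(** A single wall contributes sum_z z k1(z) = jc. Pairs straddling two walls are not separated by
    both, which is corrected by the alternating wall interaction. *)
Lemma row_interaction_le u L :
  row_interaction u L <= INR (length (breaks u L)) * jc p - altpairs wall_potential (breaks u L).
Proof.
  set (n := INR (length (breaks u L))).
  assert (Hl : is_lim_seq (fun Z => n * Sg Z (fun z => INR (S z) * k1 p (S z))
     - altpairs (fun r => Sg Z (fun z => k1 p (S z) * (2 * INR (S z - r)))) (breaks u L))
     (n * jc p - altpairs wall_potential (breaks u L))).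
  { apply is_lim_seq_minus'.
    - apply (is_lim_seq_mult' (fun _ => n)); [apply is_lim_seq_const|now apply jc_lim].
    - apply altpairs_lim. intros r. apply wall_potential_ramp. }
  apply (lim_ge_const_loc _ _ _ L Hl). intros Z HZ.
  rewrite (altpairs_Sg Z (fun z r => 2 * INR (S z - r)) (fun z => k1 p (S z))).
  rewrite <- Sg_scal, <- Sg_minus.
  apply Rle_trans with (Sg Z (fun z => k1 p (S z) * shift_count u L (S z))).
  - apply Sg_mono; auto. intros i _. apply Rmult_le_pos; [left; now apply k1_pos|apply shift_count_nonneg].
  - apply Sg_le. intros z _. assert (Hk := k1_pos p hp z).
    assert (H := shift_count_le u L (S z)). fold n in H.
    assert (E : altpairs (fun r => 2 * INR (S z - r)) (breaks u L) = 2 * altpairs (fun r => INR (S z - r)) (breaks u L)).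
    { apply (altpairs_scal 2). }
    rewrite E. nra.
Qed.

Definition tri_energy (d : nat) : R := nsum (fun z => k1 p (S z) * tri d (S z)).

Lemma tri_energy_lim d : (1 <= d)%nat -> is_lim_seq (fun N => Sg N (fun z => k1 p (S z) * tri d (S z))) (tri_energy d).
Proof.
  intros Hd. apply (nsum_lim _ (jc p)).
  - intros n. apply Rmult_le_pos; [left; now apply k1_pos|apply tri_nonneg].
  - intros n. apply Rle_trans with (Sg n (fun n => INR (S n) * k1 p (S n))).
    + apply Sg_le. intros m _. assert (H := tri_le d (S m) Hd). assert (H0 := k1_pos p hp m). nra.
    + apply Sg_le_lim; [apply moment1_nonneg; auto|now apply jc_lim].
Qed.

(* Half the energy, per unit length in the perpendicular direction, of one stripe of width d. *)
Definition phi (J : R) (d : nat) : R := J - tri_energy d.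

Lemma phi_lower J d : (1 <= d)%nat -> J - jc p <= phi J d.
Proof.
  intros Hd. unfold phi. enough (tri_energy d <= jc p) by lra.
  apply (lim_le_const _ _ _ (tri_energy_lim d Hd)). intros n.
  apply Rle_trans with (Sg n (fun n => INR (S n) * k1 p (S n))).
  + apply Sg_le. intros m _. assert (H := tri_le d (S m) Hd). assert (H0 := k1_pos p hp m). nra.
  + apply Sg_le_lim; [apply moment1_nonneg; auto|now apply jc_lim].
Qed.

Lemma psi_trunc_lim m d :
  is_lim_seq (fun Z => Sg Z (fun z => k1 p (S z) * alt_ramp m d (S z))) (psi_trunc m wall_potential d).
Proof.
  unfold psi_trunc.
  apply (is_lim_seq_ext (fun Z => Sg m (fun k =>
     Sg Z (fun z => k1 p (S z) * (2 * INR (S z - (2 * k + 1) * d))) - Sg Z (fun z => k1 p (S z) * (2 * INR (S z - (2 * k + 2) * d)))))).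
  - intros Z. rewrite (Sg_ext m _ (fun k => Sg Z (fun z => k1 p (S z) * (2 * (INR (S z - (2 * k + 1) * d) - INR (S z - (2 * k + 2) * d)))))).
    + rewrite Sg_swap. apply Sg_ext. intros z _. unfold alt_ramp. now rewrite !Sg_scal.
    + intros k _. rewrite <- Sg_minus. apply Sg_ext. intros; ring.
  - apply (is_lim_seq_lsum (fun Z k =>
     Sg Z (fun z => k1 p (S z) * (2 * INR (S z - (2 * k + 1) * d))) - Sg Z (fun z => k1 p (S z) * (2 * INR (S z - (2 * k + 2) * d))))
     (fun k => wall_potential ((2 * k + 1) * d)%nat - wall_potential ((2 * k + 2) * d)%nat)).
    intros k _. apply is_lim_seq_minus'; apply wall_potential_ramp.
Qed.

Lemma psi_trunc_ge Z d : (1 <= d)%nat ->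
  Sg Z (fun z => k1 p (S z) * (INR (S z) - tri d (S z))) <= psi_trunc Z wall_potential d.
Proof.
  intros Hd. apply (lim_ge_const_loc _ _ _ Z (psi_trunc_lim Z d)). intros n Hn.
  apply Rle_trans with (Sg Z (fun z => k1 p (S z) * alt_ramp Z d (S z))).
  - apply Sg_le. intros z Hz. apply Rmult_le_compat_l; [left; now apply k1_pos|]. apply alt_ramp_ge; auto. nia.
  - apply Sg_mono; auto. intros z _. apply Rmult_le_pos; [left; now apply k1_pos|apply alt_ramp_nonneg].
Qed.

Lemma altpairs_wall_ge u L :
  gapsum (fun t s => jc p - tri_energy (s - t)) (breaks u L)
  + gap2sum (fun r t s => gap_penalty wall_potential (s - t) (t - r)) (breaks u L)
  <= altpairs wall_potential (breaks u L).
Proof.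
  (* The test t < s holds on consecutive walls; it supplies the width >= 1 under which the energy of
     the periodic chain converges. *)
  assert (Hl : is_lim_seq (fun Z => gapsum (fun t s => if (t <? s)%nat then Sg Z (fun z => k1 p (S z) * (INR (S z) - tri (s - t) (S z))) else 0) (breaks u L))
     (gapsum (fun t s => if (t <? s)%nat then jc p - tri_energy (s - t) else 0) (breaks u L))).
  { apply gapsum_lim. intros t s. destruct (Nat.ltb_spec t s); [|apply is_lim_seq_const].
    apply (is_lim_seq_ext (fun Z => Sg Z (fun z => INR (S z) * k1 p (S z)) - Sg Z (fun z => k1 p (S z) * tri (s - t) (S z)))).
    - intros Z. rewrite <- Sg_minus. apply Sg_ext. intros; ring.
    - apply is_lim_seq_minus'; [now apply jc_lim|apply tri_energy_lim; lia]. }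
  set (G := gap2sum _ _).
  enough (gapsum (fun t s => if (t <? s)%nat then jc p - tri_energy (s - t) else 0) (breaks u L) <= altpairs wall_potential (breaks u L) - G).
  { assert (gapsum (fun t s => jc p - tri_energy (s - t)) (breaks u L) <= gapsum (fun t s => if (t <? s)%nat then jc p - tri_energy (s - t) else 0) (breaks u L)).
    { apply gapsum_le; [apply breaks_decreasing|]. intros t s Hts. destruct (Nat.ltb_spec t s); [lra|lia]. }
    lra. }
  apply (lim_le_const _ _ _ Hl). intros Z.
  (* The truncation of the periodic series and the range of the kernel sum go to infinity
     together. *)
  assert (H := chessboard wall_potential Z (breaks u L) wall_potential_cone (breaks_decreasing u L)). fold G in H.
  assert (gapsum (fun t s => if (t <? s)%nat then Sg Z (fun z => k1 p (S z) * (INR (S z) - tri (s - t) (S z))) else 0) (breaks u L)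
    <= gapsum (fun t s => psi_trunc Z wall_potential (s - t)) (breaks u L)).
  { apply gapsum_le; [apply breaks_decreasing|]. intros t s Hts. destruct (Nat.ltb_spec t s); [|lia].
    apply psi_trunc_ge. lia. }
  lra.
Qed.

(** n walls bound only n - 1 gaps: charging one wall to each gap leaves J - jc over, the boundary
    cost of the row. Since J <= jc this also covers rows without walls. *)
Lemma row_energy_ge J u L : J <= jc p ->
  J - jc p + gapsum (fun t s => phi J (s - t)) (breaks u L)
  + gap2sum (fun r t s => gap_penalty wall_potential (s - t) (t - r)) (breaks u L)
  <= J * INR (length (breaks u L)) - row_interaction u L.
Proof.
  intros HJ. assert (H1 := row_interaction_le u L). assert (H2 := altpairs_wall_ge u L).
  set (G := gap2sum _ _) in *. set (W := altpairs _ _) in *.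
  assert (H3 : forall l, J - jc p + gapsum (fun t s => phi J (s - t)) l
     <= INR (length l) * (J - jc p) + gapsum (fun t s => jc p - tri_energy (s - t)) l).
  { induction l as [|s l IH]; [simpl; lra|].
    change (length (s :: l)) with (S (length l)). rewrite S_INR.
    destruct l as [|t l]; [simpl; lra|].
    change (gapsum ?X (s :: t :: l)) with (X t s + gapsum X (t :: l)). cbv beta. unfold phi at 1. lra. }
  specialize (H3 (breaks u L)). lra.
Qed.

End Rows.

(** * Runs and corners in a square *)

Definition asb (P : Prop) : bool := if excluded_middle_informative P then true else false.

Lemma asb_true (P : Prop) : asb P = true <-> P.
Proof. unfold asb. destruct (excluded_middle_informative P); split; auto; discriminate. Qed.

Lemma asb_spec (P : Prop) : reflect P (asb P).
Proof. unfold asb. destruct (excluded_middle_informative P); now constructor. Qed.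

Definition consec (l : list nat) (t s : nat) : Prop := exists l1 l2, l = l1 ++ s :: t :: l2.
Definition consec3 (l : list nat) (r t s : nat) : Prop := exists l1 l2, l = l1 ++ s :: t :: r :: l2.

Lemma consec_cons x l t s : consec l t s -> consec (x :: l) t s.
Proof. intros (l1 & l2 & ->). now exists (x :: l1), l2. Qed.

Lemma consec3_cons x l r t s : consec3 l r t s -> consec3 (x :: l) r t s.
Proof. intros (l1 & l2 & ->). now exists (x :: l1), l2. Qed.

Lemma gapsum_le_in X Y l : (forall t s, consec l t s -> X t s <= Y t s) -> gapsum X l <= gapsum Y l.
Proof.
  induction l as [|s l IH]; intros H; simpl; [lra|].
  assert (gapsum X l <= gapsum Y l) by (apply IH; auto using consec_cons).
  destruct l as [|t l]; [lra|]. assert (X t s <= Y t s) by (apply H; now exists [], l). lra.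
Qed.

Lemma gapsum_Sg n (c : nat -> R) (X : nat -> nat -> nat -> R) l :
  gapsum (fun t s => Sg n (fun k => c k * X k t s)) l = Sg n (fun k => c k * gapsum (X k) l).
Proof.
  induction l as [|s l IH]; simpl.
  - rewrite Sg_zero; [reflexivity|intros; ring].
  - rewrite IH. destruct l as [|t l].
    + rewrite Rplus_0_l. apply Sg_ext. intros; ring.
    + rewrite <- Sg_plus. apply Sg_ext. intros; ring.
Qed.

Lemma gapsum_minus_scal X Y c l : gapsum (fun t s => X t s - c * Y t s) l = gapsum X l - c * gapsum Y l.
Proof.
  induction l as [|s l IH]; simpl; [ring|]. rewrite IH. destruct l; ring.
Qed.

Lemma decreasing_lt s l x : decreasing (s :: l) -> In x l -> (x < s)%nat.
Proof. intros H Hx. inversion H as [|? ? _ HF]; subst. rewrite Forall_forall in HF. now apply HF. Qed.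

(** Gaps are disjoint, so at most one of them contains [i]. The second conjunct serves the
    induction: below the gap just found nothing more is selected. *)
Lemma gap_select (P : nat -> nat -> Prop) X i l : decreasing l ->
  (gapsum (fun t s => if asb ((t < i <= s)%nat /\ P t s) then X t s else 0) l = 0
  \/ exists t s, consec l t s /\ (t < i <= s)%nat /\ P t s /\
    gapsum (fun t s => if asb ((t < i <= s)%nat /\ P t s) then X t s else 0) l = X t s)
  /\ ((forall x, In x l -> (x < i)%nat) ->
    gapsum (fun t s => if asb ((t < i <= s)%nat /\ P t s) then X t s else 0) l = 0).
Proof.
  induction l as [|s l IH]; intros Hd; [simpl; auto|].
  destruct (IH (decreasing_tail _ _ Hd)) as [IH1 IH2].
  destruct l as [|t l]; [simpl; split; [left|intros]; ring|].
  change (gapsum ?X (s :: t :: l)) with (X t s + gapsum X (t :: l)). cbv beta.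
  split.
  - destruct (asb_spec ((t < i <= s)%nat /\ P t s)) as [[H1 H2]|H].
    + right. exists t, s. rewrite IH2.
      * repeat split; try tauto. now exists [], l. ring.
      * intros x [->|Hx]; [lia|]. apply (decreasing_lt _ _ x (decreasing_tail _ _ Hd)) in Hx. lia.
    + rewrite Rplus_0_l. destruct IH1 as [->|(t' & s' & H1 & H2 & H3 & ->)]; [now left|].
      right. exists t', s'. repeat split; try tauto. now apply consec_cons.
  - intros Hx. rewrite IH2 by auto with datatypes.
    destruct (asb_spec ((t < i <= s)%nat /\ P t s)) as [[H1 H2]|H]; [|ring].
    specialize (Hx s ltac:(now left)). lia.
Qed.

Lemma gap_cover i l : decreasing l -> gapsum (fun t s => ind ((t <? i) && (i <=? s))%nat) l <= 1.
Proof.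
  intros Hd. destruct (gap_select (fun _ _ => True) (fun _ _ => 1) i l Hd) as [H _].
  replace (gapsum (fun t s => ind ((t <? i) && (i <=? s))%nat) l)
    with (gapsum (fun t s => if asb ((t < i <= s)%nat /\ True) then 1 else 0) l).
  - destruct H as [->|(t & s & _ & _ & _ & ->)]; lra.
  - clear. induction l as [|s l IH]; simpl; [reflexivity|]. rewrite IH. destruct l as [|t l]; [reflexivity|].
    f_equal. destruct (asb_spec ((t < i <= s)%nat /\ True)); destruct (Nat.ltb_spec t i); destruct (Nat.leb_spec i s); simpl; auto; lia.
Qed.

Lemma gap2sum_nonneg X l : (forall r t s, 0 <= X r t s) -> 0 <= gap2sum X l.
Proof.
  intros H. induction l as [|s l IH]; simpl; [lra|]. destruct l as [|t [|r l]]; try lra. specialize (H r t s). lra.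
Qed.

Lemma gap2sum_in_le X l r t s : (forall r t s, 0 <= X r t s) -> consec3 l r t s -> X r t s <= gap2sum X l.
Proof.
  intros H (l1 & l2 & ->). induction l1 as [|x l1 IH].
  - simpl app. change (gap2sum X (s :: t :: r :: l2)) with (X r t s + gap2sum X (t :: r :: l2)).
    assert (H0 := gap2sum_nonneg X (t :: r :: l2) H). lra.
  - simpl app. apply Rle_trans with (1 := IH). simpl gap2sum.
    destruct (l1 ++ s :: t :: r :: l2) as [|a [|b l]]; try lra. specialize (H b a x). lra.
Qed.

Lemma gap2sum_Sg n (X : nat -> nat -> nat -> nat -> R) l :
  gap2sum (fun r t s => Sg n (fun k => X k r t s)) l = Sg n (fun k => gap2sum (X k) l).
Proof.
  induction l as [|s l IH]; simpl.
  - rewrite Sg_zero; auto.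
  - rewrite IH. destruct l as [|t [|r l]].
    + rewrite Rplus_0_l. apply Sg_ext. intros; ring.
    + rewrite Rplus_0_l. apply Sg_ext. intros; ring.
    + now rewrite <- Sg_plus.
Qed.

Lemma gap2sum_scal c X l : gap2sum (fun r t s => c * X r t s) l = c * gap2sum X l.
Proof. induction l as [|s l IH]; simpl; [ring|]. rewrite IH. destruct l as [|t [|r l]]; ring. Qed.

Lemma consec_breaks u L t s : consec (breaks u L) t s <->
  (t < s)%nat /\ (S s < L)%nat /\ xorb (u t) (u (S t)) = true /\ xorb (u s) (u (S s)) = true
  /\ (forall k, (t < k < s)%nat -> u k = u (S k)).
Proof.
  assert (Hd := breaks_decreasing u L). split.
  - intros (l1 & l2 & E).
    assert (Hin : forall x, In x (breaks u L) <-> In x (l1 ++ s :: t :: l2)) by (intros; now rewrite E).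
    rewrite E in Hd.
    assert (Hs : In s (breaks u L)) by (apply Hin, in_or_app; right; now left).
    assert (Ht : In t (breaks u L)) by (apply Hin, in_or_app; right; right; now left).
    apply in_breaks in Hs, Ht.
    assert (Hd2 : decreasing (s :: t :: l2) /\ forall x, In x l1 -> (s < x)%nat).
    { clear -Hd. induction l1 as [|x l1 IH]; [split; [auto|intros x []]|].
      simpl in Hd. destruct (IH (decreasing_tail _ _ Hd)) as [H1 H2]. split; auto.
      intros y [->|Hy]; auto. apply (decreasing_lt _ _ s Hd). apply in_or_app; right; now left. }
    destruct Hd2 as [Hd2 Hl1].
    assert (Hts := decreasing_head _ _ _ Hd2).
    repeat split; try tauto.
    intros k Hk. destruct (xorb (u k) (u (S k))) eqn:Ek.
    + assert (In k (breaks u L)) as Hk2 by (apply in_breaks; split; auto; lia).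
      apply Hin, in_app_or in Hk2. destruct Hk2 as [Hk2|[->|[->|Hk2]]]; try lia.
      * apply Hl1 in Hk2. lia.
      * apply (decreasing_lt _ _ k (decreasing_tail _ _ Hd2)) in Hk2. lia.
    + now apply xorb_eq.
  - intros (H1 & H2 & H3 & H4 & H5).
    assert (Hs : In s (breaks u L)) by (apply in_breaks; auto).
    assert (Ht : In t (breaks u L)) by (apply in_breaks; split; auto; lia).
    destruct (in_split _ _ Hs) as (l1 & l2 & E).
    assert (Hd2 : decreasing (s :: l2) /\ forall x, In x l1 -> (s < x)%nat).
    { rewrite E in Hd. clear -Hd. induction l1 as [|x l1 IH]; [split; [auto|intros x []]|].
      simpl in Hd. destruct (IH (decreasing_tail _ _ Hd)) as [H1 H2]. split; auto.
      intros y [->|Hy]; auto. apply (decreasing_lt _ _ s Hd). apply in_or_app; right; now left. }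
    destruct Hd2 as [Hd2 Hl1].
    assert (Ht2 : In t l2).
    { rewrite E in Ht. apply in_app_or in Ht. destruct Ht as [Ht|[->|Ht]]; auto; [apply Hl1 in Ht|]; lia. }
    destruct l2 as [|x l2]; [destruct Ht2|].
    assert (Hx : In x (breaks u L)) by (rewrite E; apply in_or_app; right; right; now left).
    apply in_breaks in Hx. destruct Hx as [Hx1 Hx2].
    assert (Hxs := decreasing_head _ _ _ Hd2).
    assert (x = t).
    { destruct Ht2 as [->|Ht2]; auto. apply (decreasing_lt _ _ t (decreasing_tail _ _ Hd2)) in Ht2.
      rewrite H5 in Hx2 by lia. now rewrite xorb_nilpotent in Hx2. }
    subst x. now exists l1, l2.
Qed.

Lemma consec_consec3 l r t s : decreasing l -> consec l r t -> consec l t s -> consec3 l r t s.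
Proof.
  intros Hd H1 (l1 & l2 & E). subst l. revert Hd H1. induction l1 as [|x l1 IH]; intros Hd H1.
  - simpl in *. destruct H1 as (m1 & m2 & E). destruct m1 as [|y m1].
    + injection E as -> _ _. apply decreasing_head in Hd. lia.
    + injection E as -> E. destruct m1 as [|z m1].
      * injection E as ->. now exists [], m2.
      * injection E as E0 E. subst z. assert (In t l2) by (rewrite E; apply in_or_app; right; now left).
        apply (decreasing_lt _ _ t (decreasing_tail _ _ Hd)) in H. lia.
  - simpl in *. apply consec3_cons. apply IH; [now apply decreasing_tail in Hd|].
    destruct H1 as (m1 & m2 & E). destruct m1 as [|y m1].
    + injection E as E0 E. subst x. assert (In t (l1 ++ s :: t :: l2)) by (apply in_or_app; right; right; now left).
      apply (decreasing_lt _ _ t Hd) in H. lia.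
    + injection E as E0 E. now exists m1, m2.
Qed.

(** * Corners, and the row runs that are given up because of them *)

Definition transpose (c : nat -> nat -> bool) : nat -> nat -> bool := fun i j => c j i.

Definition side_diff (u : nat -> bool) (L i : nat) : bool :=
  ((S i <? L)%nat && xorb (u i) (u (S i))) || ((0 <? i)%nat && xorb (u (i - 1)%nat) (u i)).

Definition corner_at (c : nat -> nat -> bool) (L i j : nat) : bool :=
  (i <? L)%nat && (j <? L)%nat && side_diff (fun a => c a j) L i && side_diff (fun b => c i b) L j.

Lemma corner_transpose c L i j : corner_at (transpose c) L i j = corner_at c L j i.
Proof.
  unfold corner_at, transpose.
  destruct (i <? L)%nat, (j <? L)%nat; simpl; auto. apply andb_comm.
Qed.

Lemma side_diff_right u L i : (S i < L)%nat -> xorb (u i) (u (S i)) = true -> side_diff u L i = true.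
Proof. intros H1 H2. unfold side_diff. apply Nat.ltb_lt in H1. now rewrite H1, H2. Qed.

Lemma side_diff_left u L i : xorb (u i) (u (S i)) = true -> side_diff u L (S i) = true.
Proof. intros H2. unfold side_diff. replace (S i - 1)%nat with i by lia. rewrite H2. simpl. apply orb_true_r. Qed.

(** Without corners a wall can neither end nor turn: the wall between columns b and b+1 climbs from
    row j to row s, the wall between rows s and s+1 goes from column i to column b, and they cross
    at (b, s), which is then a corner. *)
Lemma corner_exists c L i j b s : (i <= b)%nat -> (j <= s)%nat -> (S b < L)%nat -> (S s < L)%nat ->
  xorb (c i s) (c i (S s)) = true -> xorb (c b j) (c (S b) j) = true ->
  exists i' j', (i <= i' <= S b)%nat /\ (j <= j' <= S s)%nat /\ corner_at c L i' j' = true.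
Proof.
  intros Hib Hjs Hb Hs Hv Hh.
  apply NNPP. intros Hno.
  assert (Hc : forall i' j', (i <= i' <= S b)%nat -> (j <= j' <= S s)%nat -> corner_at c L i' j' = false).
  { intros i' j' H1 H2. destruct (corner_at c L i' j') eqn:E; auto. exfalso; apply Hno. eauto. }
  assert (Hc' : forall i' j', (i <= i' <= S b)%nat -> (j <= j' <= S s)%nat ->
     side_diff (fun a => c a j') L i' = true -> side_diff (fun b => c i' b) L j' = true -> False).
  { intros i' j' H1 H2 H3 H4. specialize (Hc i' j' H1 H2). unfold corner_at in Hc. rewrite H3, H4 in Hc.
    destruct (Nat.ltb_spec i' L); destruct (Nat.ltb_spec j' L); simpl in Hc; try discriminate; lia. }
  assert (Hup : forall m, (j + m <= s)%nat -> xorb (c b (j + m)%nat) (c (S b) (j + m)%nat) = true).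
  { induction m as [|m IH]; intros Hm; [now rewrite Nat.add_0_r|].
    specialize (IH ltac:(lia)).
    assert (E1 : xorb (c b (j + m)%nat) (c b (S (j + m))) = false).
    { destruct (xorb (c b (j + m)%nat) (c b (S (j + m)))) eqn:E; auto. exfalso.
      apply (Hc' b (j + m)%nat); try lia; [now apply side_diff_right|apply side_diff_right; auto; lia]. }
    assert (E2 : xorb (c (S b) (j + m)%nat) (c (S b) (S (j + m))) = false).
    { destruct (xorb (c (S b) (j + m)%nat) (c (S b) (S (j + m)))) eqn:E; auto. exfalso.
      apply (Hc' (S b) (j + m)%nat); try lia; [apply (side_diff_left (fun a => c a (j + m)%nat)); auto|apply side_diff_right; auto; lia]. }
    rewrite Nat.add_succ_r. apply xorb_eq in E1, E2. now rewrite <- E1, <- E2. }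
  assert (Hrt : forall m, (i + m <= b)%nat -> xorb (c (i + m)%nat s) (c (i + m)%nat (S s)) = true).
  { induction m as [|m IH]; intros Hm; [now rewrite Nat.add_0_r|].
    specialize (IH ltac:(lia)).
    assert (E1 : xorb (c (i + m)%nat s) (c (S (i + m)) s) = false).
    { destruct (xorb (c (i + m)%nat s) (c (S (i + m)) s)) eqn:E; auto. exfalso.
      apply (Hc' (i + m)%nat s); try lia; [apply side_diff_right; auto; lia|now apply side_diff_right]. }
    assert (E2 : xorb (c (i + m)%nat (S s)) (c (S (i + m)) (S s)) = false).
    { destruct (xorb (c (i + m)%nat (S s)) (c (S (i + m)) (S s))) eqn:E; auto. exfalso.
      apply (Hc' (i + m)%nat (S s)); try lia; [apply side_diff_right; auto; lia|apply (side_diff_left (fun b => c (i + m)%nat b)); auto]. }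
    rewrite Nat.add_succ_r. apply xorb_eq in E1, E2. now rewrite <- E1, <- E2. }
  specialize (Hup (s - j)%nat ltac:(lia)). replace (j + (s - j))%nat with s in Hup by lia.
  specialize (Hrt (b - i)%nat ltac:(lia)). replace (i + (b - i))%nat with b in Hrt by lia.
  apply (Hc' b s); try lia; now apply side_diff_right.
Qed.

Definition corner_count c L : R := Sg L (fun i => Sg L (fun j => ind (corner_at c L i j))).

Lemma corner_count_transpose c L : corner_count (transpose c) L = corner_count c L.
Proof.
  unfold corner_count. rewrite Sg_swap. apply Sg_ext; intros; apply Sg_ext; intros. now rewrite corner_transpose.
Qed.

(** The run (t,s] of row [j] contains a site (i,j) whose column run is bounded by two walls of the
    window and has length at most D. Such row runs are given up in the energy count. *)
Definition bad_run (c : nat -> nat -> bool) (L D j t s : nat) : Prop :=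
  exists i a b, (t < i <= s)%nat /\ consec (breaks (c i) L) a b /\ (a < j <= b)%nat /\ (b - a <= D)%nat.

Definition row (c : nat -> nat -> bool) (j : nat) : nat -> bool := fun i => c i j.

Lemma bad_run_corner c L D j t s : consec (breaks (row c j) L) t s -> bad_run c L D j t s ->
  exists i' k, (t < i' <= S s)%nat /\ (i' < L)%nat /\ (k <= D)%nat /\ corner_at c L i' (j + k) = true.
Proof.
  intros Hc (i & a & b & Hi & Hab & Hj & HD).
  apply consec_breaks in Hc, Hab.
  destruct (corner_exists c L i j s b) as (i' & j' & H1 & H2 & H3); try lia; try tauto.
  exists i', (j' - j)%nat. replace (j + (j' - j))%nat with j' by lia. repeat split; auto; lia.
Qed.

Lemma Sg_shift_le L k f : (forall i, 0 <= f i) -> (forall i, (L <= i)%nat -> f i = 0) ->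
  Sg L (fun i => f (i + k)%nat) <= Sg L f.
Proof.
  intros H0 H1.
  apply Rle_trans with (Sg (L + k) f).
  - rewrite Nat.add_comm, Sg_add. assert (0 <= Sg k f) by (apply Sg_nonneg; auto).
    rewrite (Sg_ext L (fun i => f (i + k)%nat) (fun i => f (k + i)%nat)) by (intros; f_equal; lia). lra.
  - rewrite Sg_add, (Sg_zero k); [lra|]. intros; apply H1; lia.
Qed.

(** A bad run sees a corner at most D rows above it, in columns t+1 to s+1. Conversely a corner is
    seen from at most D+1 rows, and in each of them by at most two runs, those containing its column
    or the column before. *)
Lemma bad_run_count c L D :
  Sg L (fun j => gapsum (fun t s => ind (asb (bad_run c L D j t s))) (breaks (row c j) L))
  <= 2 * INR (S D) * corner_count c L.
Proof.
  set (cr := fun i j => ind (corner_at c L i j)).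
  assert (Hcr : forall i j, 0 <= cr i j) by (intros; apply ind_nonneg).
  apply Rle_trans with (Sg L (fun j => Sg (S D) (fun k => Sg L (fun i => 2 * cr i (j + k)%nat)))).
  - apply Sg_le. intros j Hj.
    apply Rle_trans with (gapsum (fun t s => Sg (S D) (fun k => 1 * Sg L (fun i => cr i (j + k)%nat * ind ((t <? i) && (i <=? S s))%nat))) (breaks (row c j) L)).
    + apply gapsum_le_in. intros t s Hc.
      assert (Hnn : forall k, 0 <= 1 * Sg L (fun i => cr i (j + k)%nat * ind ((t <? i) && (i <=? S s))%nat)).
      { intros k. rewrite Rmult_1_l. apply Sg_nonneg. intros. apply Rmult_le_pos; auto using ind_nonneg. }
      destruct (asb_spec (bad_run c L D j t s)) as [Hb|Hb]; simpl ind; [|apply Sg_nonneg; auto].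
      destruct (bad_run_corner _ _ _ _ _ _ Hc Hb) as (i & k & H1 & H2 & H3 & H4).
      apply Rle_trans with (1 * Sg L (fun i => cr i (j + k)%nat * ind ((t <? i) && (i <=? S s))%nat)).
      * rewrite Rmult_1_l.
        apply Rle_trans with (cr i (j + k)%nat * ind ((t <? i) && (i <=? S s))%nat).
        -- unfold cr. rewrite H4. destruct (Nat.ltb_spec t i); [|lia]. destruct (Nat.leb_spec i (S s)); [|lia]. simpl; lra.
        -- apply (Sg_in_le L (fun i => cr i (j + k)%nat * ind ((t <? i) && (i <=? S s))%nat)); auto.
           intros. apply Rmult_le_pos; auto using ind_nonneg.
      * apply (Sg_in_le (S D) (fun k => 1 * Sg L (fun i => cr i (j + k)%nat * ind ((t <? i) && (i <=? S s))%nat))); auto. lia.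
    + rewrite (gapsum_Sg (S D) (fun _ => 1) (fun k t s => Sg L (fun i => cr i (j + k)%nat * ind ((t <? i) && (i <=? S s))%nat))).
      apply Sg_le. intros k _. rewrite Rmult_1_l.
      rewrite (gapsum_Sg L (fun i => cr i (j + k)%nat) (fun i t s => ind ((t <? i) && (i <=? S s))%nat)).
      apply Sg_le. intros i _. rewrite (Rmult_comm 2). apply Rmult_le_compat_l; auto.
      apply Rle_trans with (gapsum (fun t s => ind ((t <? i) && (i <=? s))%nat - (-1) * ind ((t <? (i - 1)) && ((i - 1) <=? s))%nat) (breaks (row c j) L)).
      * apply gapsum_le_in. intros t s Hc. apply consec_breaks in Hc. destruct Hc as [Hts _].
        destruct (Nat.ltb_spec t i); destruct (Nat.leb_spec i (S s)); destruct (Nat.leb_spec i s);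
          destruct (Nat.ltb_spec t (i - 1)); destruct (Nat.leb_spec (i - 1) s); simpl; try lia; lra.
      * rewrite gapsum_minus_scal.
        assert (H1 := gap_cover i _ (breaks_decreasing (row c j) L)).
        assert (H2 := gap_cover (i - 1) _ (breaks_decreasing (row c j) L)). lra.
  - rewrite Sg_swap.
    apply Rle_trans with (Sg (S D) (fun _ => 2 * corner_count c L)).
    + apply Sg_le. intros k _.
      rewrite Sg_swap. unfold corner_count. rewrite <- Sg_scal. apply Sg_le. intros i _.
      rewrite <- Sg_scal.
      apply (Sg_shift_le L k (fun j => 2 * cr i j)).
      * intros j. specialize (Hcr i j). lra.
      * intros j Hj. unfold cr, corner_at. destruct (Nat.ltb_spec j L); [lia|]. rewrite andb_false_r. simpl. ring.
    + rewrite Sg_const. right. ring.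
Qed.

Section Plane.
Context (p : R) (hp : 4 < p).

(** The pairs are ordered, so every pair of sites counts twice. *)
Definition pair_interaction (c : nat -> nat -> bool) (L : nat) : R :=
  Sg L (fun i => Sg L (fun j => Sg L (fun i' => Sg L (fun j' =>
    KK p (Z.of_nat i - Z.of_nat i') (Z.of_nat j - Z.of_nat j') * dif (c i j) (c i' j'))))).

Lemma pair_sum_by_distance (g : nat -> R) u L :
  Sg L (fun i => Sg L (fun i' => g (Z.abs_nat (Z.of_nat i - Z.of_nat i')) * dif (u i) (u i')))
  = 2 * Sg L (fun z => g (S z) * shift_count u L (S z)).
Proof.
  induction L as [|L IH]; [rewrite !Sg_0; ring|].
  rewrite Sg_S.
  rewrite (Sg_ext L _ (fun i => Sg L (fun i' => g (Z.abs_nat (Z.of_nat i - Z.of_nat i')) * dif (u i) (u i'))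
     + g (L - i)%nat * dif (u i) (u L))).
  2:{ intros i Hi. rewrite Sg_S. do 2 f_equal. f_equal. lia. }
  rewrite Sg_plus, IH, Sg_S.
  rewrite (Sg_ext L (fun i' => g (Z.abs_nat (Z.of_nat L - Z.of_nat i')) * dif (u L) (u i')) (fun i => g (L - i)%nat * dif (u i) (u L))).
  2:{ intros i Hi. rewrite dif_sym. do 2 f_equal. lia. }
  rewrite dif_diag, Rmult_0_r, Rplus_0_r.
  rewrite (Sg_S L (fun z => g (S z) * shift_count u (S L) (S z))).
  unfold shift_count at 3. rewrite Nat.sub_diag, Sg_0, Rmult_0_r, Rplus_0_r.
  rewrite (Sg_ext L (fun z => g (S z) * shift_count u (S L) (S z)) (fun z => g (S z) * shift_count u L (S z) + g (S z) * dif (u (L - 1 - z)%nat) (u L))).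
  2:{ intros z Hz. unfold shift_count. replace (S L - S z)%nat with (S (L - S z)) by lia.
      rewrite Sg_S, Rmult_plus_distr_l. do 3 f_equal; f_equal; lia. }
  rewrite Sg_plus, (Sg_rev L (fun i => g (L - i)%nat * dif (u i) (u L))).
  rewrite (Sg_ext L (fun k => g (L - (L - 1 - k))%nat * dif (u (L - 1 - k)%nat) (u L)) (fun z => g (S z) * dif (u (L - 1 - z)%nat) (u L))).
  2:{ intros z Hz. do 2 f_equal. lia. }
  ring.
Qed.

Lemma KK_row_sum_le L i i' j : i <> i' ->
  Sg L (fun j' => KK p (Z.of_nat i - Z.of_nat i') (Z.of_nat j - Z.of_nat j')) <= k1 p (Z.abs_nat (Z.of_nat i - Z.of_nat i')).
Proof.
  intros H. rewrite <- K1_abs. unfold Sg. rewrite <- (lsum_map (fun j' => (Z.of_nat j - Z.of_nat j')%Z) (KK p (Z.of_nat i - Z.of_nat i'))).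
  apply K1_ge; auto; [lia|]. apply NoDup_map_NoDup_ForallPairs; [|apply seq_NoDup]. intros a b _ _ E. lia.
Qed.

Lemma dif_split a b m : dif a b = dif a m + dif m b - 2 * (dif a m * dif m b).
Proof. destruct a, b, m; unfold dif; simpl; lra. Qed.

Lemma horizontal_part_le c L :
  Sg L (fun i => Sg L (fun j => Sg L (fun i' => Sg L (fun j' =>
    KK p (Z.of_nat i - Z.of_nat i') (Z.of_nat j - Z.of_nat j') * dif (c i j) (c i' j)))))
  <= 2 * Sg L (fun j => row_interaction p (row c j) L).
Proof.
  rewrite Sg_swap, <- Sg_scal. apply Sg_le. intros j _. unfold row_interaction.
  rewrite <- (pair_sum_by_distance (k1 p) (row c j) L).
  apply Sg_le. intros i _. apply Sg_le. intros i' _. rewrite Sg_scal_r. unfold row.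
  destruct (Nat.eq_dec i i') as [<-|Hne]; [rewrite dif_diag; lra|].
  apply Rmult_le_compat_r; [apply dif_nonneg|now apply KK_row_sum_le].
Qed.

Lemma vertical_part_le c L :
  Sg L (fun i => Sg L (fun j => Sg L (fun i' => Sg L (fun j' =>
    KK p (Z.of_nat i - Z.of_nat i') (Z.of_nat j - Z.of_nat j') * dif (c i' j) (c i' j')))))
  <= 2 * Sg L (fun i => row_interaction p (row (transpose c) i) L).
Proof.
  rewrite Sg_swap.
  rewrite (Sg_ext L _ (fun j => Sg L (fun i' => Sg L (fun j' => Sg L (fun i =>
     KK p (Z.of_nat i - Z.of_nat i') (Z.of_nat j - Z.of_nat j') * dif (c i' j) (c i' j')))))).
  2:{ intros j _. rewrite Sg_swap. apply Sg_ext; intros i' _. apply Sg_swap. }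
  rewrite Sg_swap, <- Sg_scal. apply Sg_le. intros i' _. unfold row_interaction.
  rewrite <- (pair_sum_by_distance (k1 p) (row (transpose c) i') L).
  apply Sg_le. intros j _. apply Sg_le. intros j' _. rewrite Sg_scal_r. unfold row, transpose.
  destruct (Nat.eq_dec j j') as [<-|Hne]; [rewrite dif_diag; lra|].
  apply Rmult_le_compat_r; [apply dif_nonneg|].
  rewrite (Sg_ext L _ (fun i => KK p (Z.of_nat j - Z.of_nat j') (Z.of_nat i' - Z.of_nat i))).
  - now apply KK_row_sum_le.
  - intros i _. rewrite KK_sym, <- KK_opp_r. f_equal. lia.
Qed.

Lemma corner_part_ge c L :
  KK p 1 1 * corner_count c L <=
  Sg L (fun i => Sg L (fun j => Sg L (fun i' => Sg L (fun j' =>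
    KK p (Z.of_nat i - Z.of_nat i') (Z.of_nat j - Z.of_nat j') * (dif (c i j) (c i' j) * dif (c i' j) (c i' j')))))).
Proof.
  rewrite Sg_swap.
  rewrite (Sg_ext L (fun j => Sg L (fun i => Sg L (fun i' => Sg L (fun j' =>
    KK p (Z.of_nat i - Z.of_nat i') (Z.of_nat j - Z.of_nat j') * (dif (c i j) (c i' j) * dif (c i' j) (c i' j'))))))
   (fun j => Sg L (fun i' => Sg L (fun i => Sg L (fun j' =>
    KK p (Z.of_nat i - Z.of_nat i') (Z.of_nat j - Z.of_nat j') * (dif (c i j) (c i' j) * dif (c i' j) (c i' j'))))))).
  2:{ intros j _. apply Sg_swap. }
  rewrite Sg_swap. unfold corner_count. rewrite <- Sg_scal. apply Sg_le. intros i0 Hi0.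
  rewrite <- Sg_scal. apply Sg_le. intros j0 Hj0.
  (* These are the terms whose third corner is (i0, j0). One of them, with both other sites nearest
     neighbours of it, suffices. *)
  set (T := fun i j' => KK p (Z.of_nat i - Z.of_nat i0) (Z.of_nat j0 - Z.of_nat j') * (dif (c i j0) (c i0 j0) * dif (c i0 j0) (c i0 j'))).
  assert (HT : forall i j', 0 <= T i j').
  { intros. apply Rmult_le_pos; [left; apply KK_pos|apply Rmult_le_pos; apply dif_nonneg]. }
  change (KK p 1 1 * ind (corner_at c L i0 j0) <= Sg L (fun i => Sg L (fun j' => T i j'))).
  destruct (corner_at c L i0 j0) eqn:E; simpl ind.
  2:{ rewrite Rmult_0_r. apply Sg_nonneg; intros; apply Sg_nonneg; auto. }
  assert (Hnb : forall u i, side_diff u L i = true -> (i < L)%nat -> exists k, (k < L)%nat /\ dif (u k) (u i) = 1 /\ Z.abs (Z.of_nat k - Z.of_nat i) = 1%Z).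
  { intros u i Hs Hi. unfold side_diff in Hs. apply orb_true_iff in Hs. destruct Hs as [Hs|Hs]; apply andb_true_iff in Hs; destruct Hs as [H1 H2].
    - apply Nat.ltb_lt in H1. exists (S i). repeat split; [lia| |lia]. unfold dif. rewrite xorb_comm. now rewrite H2.
    - apply Nat.ltb_lt in H1. exists (i - 1)%nat. repeat split; [lia| |lia]. unfold dif. now rewrite H2. }
  unfold corner_at in E. apply andb_true_iff in E. destruct E as [E E2]. apply andb_true_iff in E. destruct E as [_ E1].
  destruct (Hnb _ _ E1 Hi0) as (k & Hk1 & Hk2 & Hk3). destruct (Hnb _ _ E2 Hj0) as (m & Hm1 & Hm2 & Hm3).
  apply Rle_trans with (T k m).
  - unfold T. rewrite Hk2, (dif_sym (c i0 j0)), Hm2.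
    rewrite (KK_abs p (Z.of_nat k - Z.of_nat i0)), Hk3, (KK_sym p 1 (Z.of_nat j0 - Z.of_nat m)), (KK_abs p (Z.of_nat j0 - Z.of_nat m)).
    replace (Z.abs (Z.of_nat j0 - Z.of_nat m)) with 1%Z by lia. lra.
  - apply Rle_trans with (Sg L (fun j' => T k j')).
    + now apply (Sg_in_le L (fun j' => T k j')).
    + apply (Sg_in_le L (fun i => Sg L (fun j' => T i j'))); auto. intros; apply Sg_nonneg; auto.
Qed.

Lemma pair_interaction_le c L :
  / 2 * pair_interaction c L <=
  Sg L (fun j => row_interaction p (row c j) L) + Sg L (fun i => row_interaction p (row (transpose c) i) L)
  - KK p 1 1 * corner_count c L.
Proof.
  assert (E : pair_interaction c L =
    Sg L (fun i => Sg L (fun j => Sg L (fun i' => Sg L (fun j' =>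
      KK p (Z.of_nat i - Z.of_nat i') (Z.of_nat j - Z.of_nat j') * dif (c i j) (c i' j)))))
    + Sg L (fun i => Sg L (fun j => Sg L (fun i' => Sg L (fun j' =>
      KK p (Z.of_nat i - Z.of_nat i') (Z.of_nat j - Z.of_nat j') * dif (c i' j) (c i' j')))))
    - 2 * Sg L (fun i => Sg L (fun j => Sg L (fun i' => Sg L (fun j' =>
      KK p (Z.of_nat i - Z.of_nat i') (Z.of_nat j - Z.of_nat j') * (dif (c i j) (c i' j) * dif (c i' j) (c i' j'))))))).
  { unfold pair_interaction. rewrite <- Sg_scal, <- Sg_plus, <- Sg_minus. apply Sg_ext; intros i _.
    rewrite <- Sg_scal, <- Sg_plus, <- Sg_minus. apply Sg_ext; intros j _.
    rewrite <- Sg_scal, <- Sg_plus, <- Sg_minus. apply Sg_ext; intros i' _.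
    rewrite <- Sg_scal, <- Sg_plus, <- Sg_minus. apply Sg_ext; intros j' _.
    rewrite (dif_split (c i j) (c i' j') (c i' j)). ring. }
  assert (H1 := horizontal_part_le c L). assert (H2 := vertical_part_le c L). assert (H3 := corner_part_ge c L).
  rewrite E. lra.
Qed.

End Plane.

(** * Lower bound for the energy of a square with its defects *)

Definition in_opt_run (opt : nat -> Prop) (u : nat -> bool) (L i : nat) : Prop :=
  exists t s, consec (breaks u L) t s /\ (t < i <= s)%nat /\ opt (s - t)%nat.

Definition mismatch (opt : nat -> Prop) (u : nat -> bool) (L i : nat) : Prop :=
  exists r s, consec (breaks u L) r i /\ consec (breaks u L) i s /\
    opt (i - r)%nat /\ opt (s - i)%nat /\ (i - r <> s - i)%nat.

Definition nonopt_at (opt : nat -> Prop) (c : nat -> nat -> bool) (L i j : nat) : Prop :=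
  ~ in_opt_run opt (row c j) L i /\ ~ in_opt_run opt (row (transpose c) i) L j.

Section LowerBound.
Context (p : R) (hp : 4 < p) (J : R) (HJ : J <= jc p).

Let tau := jc p - J.
Definition density (d : nat) : R := phi p J d / INR d.

(** [HD] gives runs longer than D a density of at least estar/3; [HDtau] makes the discarded runs
    cost at most half of the corner energy; [Heta3] puts estar + eta below (2/3) estar, the energy
    guaranteed by two long runs through one site. *)
Context (estar eta kappa : R) (D : nat).
Let opt (d : nat) : Prop := (1 <= d)%nat /\ density d = estar.
Context (Hestar : estar < 0) (Hmin : forall d, (1 <= d)%nat -> estar <= density d)
  (Heta0 : 0 <= eta) (Heta : forall d, (1 <= d)%nat -> ~ opt d -> estar + eta <= density d)
  (Heta3 : 3 * eta <= - estar) (HD : 3 * tau <= - estar * INR (S D))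
  (HDtau : 8 * tau * INR (S D) <= KK p 1 1)
  (Hkappa0 : 0 <= kappa)
  (Hkappa : forall d d', opt d -> opt d' -> d <> d' -> kappa <= gap_penalty (wall_potential p) d d').

Definition good_density (c : nat -> nat -> bool) (L j i : nat) : R :=
  gapsum (fun t s => if asb ((t < i <= s)%nat /\ ~ bad_run c L D j t s) then density (s - t) else 0)
    (breaks (row c j) L).

Lemma tau_nonneg : 0 <= tau.
Proof. unfold tau; lra. Qed.

Lemma row_phi_ge c L j :
  Sg L (fun i => good_density c L j i)
  - tau * gapsum (fun t s => ind (asb (bad_run c L D j t s))) (breaks (row c j) L)
  <= gapsum (fun t s => phi p J (s - t)) (breaks (row c j) L).
Proof.
  unfold good_density.
  rewrite (Sg_ext L _ (fun i => 1 * gapsum (fun t s => if asb ((t < i <= s)%nat /\ ~ bad_run c L D j t s) then density (s - t) else 0)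
    (breaks (row c j) L))) by (intros; ring).
  rewrite <- (gapsum_Sg L (fun _ => 1) (fun i t s => if asb ((t < i <= s)%nat /\ ~ bad_run c L D j t s) then density (s - t) else 0)).
  rewrite <- gapsum_minus_scal. apply gapsum_le_in. intros t s Hc.
  apply consec_breaks in Hc. destruct Hc as (Hts & HsL & _).
  assert (Hphi := phi_lower p hp J (s - t) ltac:(lia)).
  destruct (asb_spec (bad_run c L D j t s)) as [Hb|Hb]; simpl ind.
  - rewrite Sg_zero.
    + unfold tau; lra.
    + intros i _. destruct (asb_spec ((t < i <= s)%nat /\ ~ bad_run c L D j t s)) as [[_ ?]|]; [contradiction|ring].
  - rewrite (Sg_ext L _ (fun i => density (s - t) * ind ((S t <=? i) && (i <? S s))%nat)).
    + rewrite Sg_scal, Sg_interval. replace (Nat.min (S s) L - S t)%nat with (s - t)%nat by lia.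
      unfold density. right. field. apply not_0_INR. lia.
    + intros i _. destruct (asb_spec ((t < i <= s)%nat /\ ~ bad_run c L D j t s)) as [[? _]|Hn];
        destruct (Nat.leb_spec (S t) i); destruct (Nat.ltb_spec i (S s)); simpl; try lia; try ring.
      exfalso; apply Hn; split; auto; lia.
Qed.

Lemma good_density_cases c L j i : good_density c L j i = 0 \/
  exists t s, consec (breaks (row c j) L) t s /\ (t < i <= s)%nat /\ ~ bad_run c L D j t s /\
    good_density c L j i = density (s - t).
Proof.
  destruct (gap_select (fun t s => ~ bad_run c L D j t s) (fun t s => density (s - t)) i _ (breaks_decreasing (row c j) L))
    as [[H|(t & s & H1 & H2 & H3 & H4)] _]; [left; exact H|right].
  exists t, s. auto.
Qed.

Lemma density_lower d : (1 <= d)%nat -> - tau / INR d <= density d.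
Proof.
  intros Hd. unfold density. assert (0 < INR d) by (apply lt_0_INR; lia).
  apply Rmult_le_compat_r; [left; now apply Rinv_0_lt_compat|].
  assert (H1 := phi_lower p hp J d Hd). unfold tau; lra.
Qed.

Lemma long_run_density d : (D < d)%nat -> estar / 3 <= density d.
Proof.
  intros Hd. assert (H := density_lower d ltac:(lia)).
  assert (H0 : 0 < INR (S D)) by apply INR_S_pos.
  assert (H1 : INR (S D) <= INR d) by (apply le_INR; lia).
  apply Rle_trans with (2 := H). unfold Rdiv.
  apply Rmult_le_reg_r with (INR d); [lra|]. rewrite (Rmult_assoc (- tau)), Rinv_l by lra. nra.
Qed.

(** If only one direction contributes, minimality or the gap [eta] applies; if none does, 0 exceeds
    estar + eta. If both do, neither run is bad, so both are longer than D: a row run of length at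
    most D would make the column run bad, and vice versa. Two long runs give at least (2/3)
    estar. *)
Lemma site_density_ge c L i j :
  estar + eta * ind (asb (nonopt_at opt c L i j)) <= good_density c L j i + good_density (transpose c) L i j.
Proof.
  assert (Hi := ind_le1 (asb (nonopt_at opt c L i j))).
  assert (Hi0 := ind_nonneg (asb (nonopt_at opt c L i j))).
  assert (Hone : forall c i j, good_density (transpose c) L i j = 0 ->
     estar + eta * ind (asb (nonopt_at opt c L i j)) <= good_density c L j i).
  { clear i j c Hi Hi0. intros c i j _.
    assert (Hi := ind_le1 (asb (nonopt_at opt c L i j))).
    assert (Hi0 := ind_nonneg (asb (nonopt_at opt c L i j))).
    destruct (good_density_cases c L j i) as [->|(t & s & H1 & H2 & H3 & ->)]; [nra|].
    destruct (classic (opt (s - t)%nat)) as [Ho|Ho].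
    - destruct (asb_spec (nonopt_at opt c L i j)) as [[Hn _]|Hn].
      + exfalso. apply Hn. exists t, s. auto.
      + simpl ind. rewrite Rmult_0_r, Rplus_0_r. apply Hmin. lia.
    - assert (H := Heta (s - t)%nat ltac:(lia) Ho). nra. }
  destruct (good_density_cases (transpose c) L i j) as [E|(a & b & G1 & G2 & G3 & E)].
  - rewrite E, Rplus_0_r. now apply Hone.
  - destruct (good_density_cases c L j i) as [E'|(t & s & H1 & H2 & H3 & E')].
    + rewrite E', Rplus_0_l.
      assert (Es : asb (nonopt_at opt c L i j) = asb (nonopt_at opt (transpose c) L j i)).
      { destruct (asb_spec (nonopt_at opt c L i j)) as [[X Y]|X]; destruct (asb_spec (nonopt_at opt (transpose c) L j i)) as [[X' Y']|X']; auto.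
        - exfalso; apply X'; split; auto.
        - exfalso; apply X; split; auto. }
      rewrite Es. apply (Hone (transpose c) j i). exact E'.
    + rewrite E, E'.
      assert (Hts : (D < s - t)%nat).
      { apply Nat.lt_nge. intros Hle. apply G3. exists j, t, s. auto. }
      assert (Hab : (D < b - a)%nat).
      { apply Nat.lt_nge. intros Hle. apply H3. exists i, a, b. auto. }
      assert (X := long_run_density _ Hts). assert (Y := long_run_density _ Hab). nra.
Qed.

(** The middle wall of two adjacent gaps serves as the address of their penalty, which can thus be
    counted site by site. *)
Lemma mismatch_penalty u L :
  kappa * Sg L (fun i => ind (asb (mismatch opt u L i)))
  <= gap2sum (fun r t s => gap_penalty (wall_potential p) (s - t) (t - r)) (breaks u L).
Proof.
  set (X := fun r t s : nat => ind (asb (opt (t - r)%nat /\ opt (s - t)%nat /\ (t - r <> s - t)%nat))).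
  apply Rle_trans with (kappa * gap2sum (fun r t s => Sg L (fun i => if Nat.eqb i t then X r t s else 0)) (breaks u L)).
  - apply Rmult_le_compat_l; auto.
    rewrite (gap2sum_Sg L (fun i r t s => if Nat.eqb i t then X r t s else 0)).
    apply Sg_le. intros i Hi.
    assert (Hnn : forall r t s, 0 <= (if Nat.eqb i t then X r t s else 0)).
    { intros. destruct (Nat.eqb i t); [apply ind_nonneg|lra]. }
    destruct (asb_spec (mismatch opt u L i)) as [(r & s & H1 & H2 & H3 & H4 & H5)|_]; simpl ind; [|now apply gap2sum_nonneg].
    assert (H6 := consec_consec3 _ _ _ _ (breaks_decreasing u L) H1 H2).
    apply Rle_trans with (2 := gap2sum_in_le _ _ _ _ _ Hnn H6).
    rewrite Nat.eqb_refl. unfold X. destruct (asb_spec (opt (i - r)%nat /\ opt (s - i)%nat /\ (i - r <> s - i)%nat)) as [_|Hn]; [simpl; lra|].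
    exfalso; auto.
  - rewrite <- gap2sum_scal. apply gap2sum_le. intros r t s. rewrite Sg_delta.
    assert (Hg := gap_penalty_nonneg p hp (s - t) (t - r)).
    destruct (t <? L)%nat; [|lra]. unfold X.
    destruct (asb_spec (opt (t - r)%nat /\ opt (s - t)%nat /\ (t - r <> s - t)%nat)) as [(H1 & H2 & H3)|_]; simpl ind; [|lra].
    rewrite Rmult_1_r. apply Hkappa; auto.
Qed.

Lemma row_family_ge c L :
  Sg L (fun j => Sg L (fun i => good_density c L j i)) - tau * (2 * INR (S D) * corner_count c L)
  + kappa * Sg L (fun j => Sg L (fun i => ind (asb (mismatch opt (row c j) L i)))) - INR L * tau
  <= Sg L (fun j => J * INR (length (breaks (row c j) L)) - row_interaction p (row c j) L).
Proof.
  assert (H : Sg L (fun j => (Sg L (fun i => good_density c L j i)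
       - tau * gapsum (fun t s => ind (asb (bad_run c L D j t s))) (breaks (row c j) L))
       + kappa * Sg L (fun i => ind (asb (mismatch opt (row c j) L i))) - tau)
     <= Sg L (fun j => J * INR (length (breaks (row c j) L)) - row_interaction p (row c j) L)).
  { apply Sg_le. intros j _.
    assert (H1 := row_phi_ge c L j). assert (H2 := mismatch_penalty (row c j) L).
    assert (H3 := row_energy_ge p hp J (row c j) L HJ). unfold tau in *; lra. }
  rewrite Sg_minus, Sg_plus, Sg_minus, !Sg_scal, Sg_const in H.
  assert (H1 := bad_run_count c L D). assert (H2 := tau_nonneg).
  assert (H3 := Rmult_le_compat_l tau _ _ H2 H1). lra.
Qed.

Definition total_mismatch (o : nat -> Prop) (c : nat -> nat -> bool) (L : nat) : R :=
  Sg L (fun j => Sg L (fun i => ind (asb (mismatch o (row c j) L i)))).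

(** Bad runs of rows and columns cost at most 4 tau (D+1) per corner, which is at most half of the
    corner energy; the other half remains as the weight of corners. The term 2 tau L is one wall for
    every row and column. *)
Lemma plane_energy_ge c L :
  estar * INR L ^ 2 - 2 * tau * INR L
  + eta * Sg L (fun i => Sg L (fun j => ind (asb (nonopt_at opt c L i j))))
  + KK p 1 1 / 2 * corner_count c L
  + kappa * (total_mismatch opt c L + total_mismatch opt (transpose c) L)
  <= J * (Sg L (fun j => INR (length (breaks (row c j) L))) + Sg L (fun i => INR (length (breaks (row (transpose c) i) L))))
     - / 2 * pair_interaction p c L.
Proof.
  assert (H1 := row_family_ge c L). assert (H2 := row_family_ge (transpose c) L).
  rewrite corner_count_transpose in H2. rewrite Sg_minus, Sg_scal in H1, H2.
  assert (H3 := pair_interaction_le p hp c L).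
  assert (H4 : estar * INR L ^ 2 + eta * Sg L (fun i => Sg L (fun j => ind (asb (nonopt_at opt c L i j))))
     <= Sg L (fun j => Sg L (fun i => good_density c L j i)) + Sg L (fun i => Sg L (fun j => good_density (transpose c) L i j))).
  { rewrite (Sg_swap L L (fun j i => good_density c L j i)), <- Sg_plus.
    apply Rle_trans with (Sg L (fun i => Sg L (fun j => estar + eta * ind (asb (nonopt_at opt c L i j))))).
    - right. rewrite <- Sg_scal.
      rewrite (Sg_ext L (fun i => Sg L (fun j => estar + eta * ind (asb (nonopt_at opt c L i j))))
        (fun i => INR L * estar + eta * Sg L (fun j => ind (asb (nonopt_at opt c L i j))))).
      + rewrite Sg_plus, Sg_const. ring.
      + intros i _. rewrite Sg_plus, Sg_const, Sg_scal. reflexivity.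
    - apply Sg_le; intros i _. rewrite <- Sg_plus. apply Sg_le; intros j _. apply site_density_ge. }
  assert (H5 : 0 <= corner_count c L) by (apply Sg_nonneg; intros; apply Sg_nonneg; intros; apply ind_nonneg).
  assert (H6 : 4 * tau * INR (S D) * corner_count c L <= KK p 1 1 / 2 * corner_count c L) by (apply Rmult_le_compat_r; lra).
  unfold total_mismatch. lra.
Qed.

End LowerBound.

(** * Energies of squares *)

Lemma spin_dif s s' x y : spin s x * spin s' y - 1 = - 2 * dif (s x) (s' y).
Proof. unfold spin, dif. destruct (s x), (s' y); simpl; lra. Qed.

Lemma distp_KK p x y : / distp p x y = KK p (fst x - fst y) (snd x - snd y).
Proof. reflexivity. Qed.

Lemma lsum_upairs {T} (g : T -> T -> R) (l : list T) : (forall x y, g x y = g y x) -> (forall x, g x x = 0) ->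
  2 * lsum (fun xy => g (fst xy) (snd xy)) (upairs l) = lsum (fun x => lsum (fun y => g x y) l) l.
Proof.
  intros Hs H0. induction l as [|a l IH]; [unfold lsum; simpl; lra|].
  simpl upairs. rewrite lsum_app, lsum_map, Rmult_plus_distr_l, IH. simpl fst; simpl snd.
  rewrite lsum_cons, (lsum_cons (fun y => g a y)), H0.
  rewrite (lsum_ext (fun x => lsum (fun y => g x y) (a :: l)) (fun x => g a x + lsum (fun y => g x y) l)).
  - rewrite lsum_plus. change (lsum (g a) l) with (lsum (fun x => g a x) l). simpl. ring.
  - intros x. rewrite lsum_cons, Hs. reflexivity.
Qed.

(** Half-open, hence of even length 2A: if A is a multiple of h, the square holds whole periods 2h
    of the stripes. *)
Definition win (A : nat) : list Z := map (fun k => (Z.of_nat k - Z.of_nat A)%Z) (seq 0 (2 * A)).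
Definition square (A : nat) : list site := list_prod (win A) (win A).
Definition cfg (s : config) (A : nat) : nat -> nat -> bool :=
  fun i j => s ((Z.of_nat i - Z.of_nat A)%Z, (Z.of_nat j - Z.of_nat A)%Z).

Lemma win_NoDup A : NoDup (win A).
Proof. apply NoDup_map_NoDup_ForallPairs; [|apply seq_NoDup]. intros a b _ _ H. lia. Qed.

Lemma in_win A z : In z (win A) <-> (- Z.of_nat A <= z < Z.of_nat A)%Z.
Proof.
  unfold win. rewrite in_map_iff. split.
  - intros [k [<- Hk]]. apply in_seq in Hk. lia.
  - intros H. exists (Z.to_nat (z + Z.of_nat A)). split; [lia|apply in_seq; lia].
Qed.

Lemma NoDup_list_prod {T U} (l : list T) (l' : list U) : NoDup l -> NoDup l' -> NoDup (list_prod l l').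
Proof.
  intros Hl Hl'. induction Hl as [|a l Ha Hl IH]; simpl; [constructor|].
  apply NoDup_app.
  - apply NoDup_map_NoDup_ForallPairs; auto. intros x y _ _ H. now injection H.
  - exact IH.
  - intros [x y] H1 H2. apply in_map_iff in H1. destruct H1 as [z [E _]]. injection E as -> ->.
    apply in_prod_iff in H2. tauto.
Qed.

Lemma square_NoDup A : NoDup (square A).
Proof. apply NoDup_list_prod; apply win_NoDup. Qed.

Definition in_square (A : nat) (y : site) : bool :=
  ((- Z.of_nat A <=? fst y) && (fst y <? Z.of_nat A) && (- Z.of_nat A <=? snd y) && (snd y <? Z.of_nat A))%Z.

Lemma in_square_iff A y : in_square A y = true <->
  (- Z.of_nat A <= fst y < Z.of_nat A /\ - Z.of_nat A <= snd y < Z.of_nat A)%Z.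
Proof.
  unfold in_square. rewrite !andb_true_iff, !Z.leb_le, !Z.ltb_lt. tauto.
Qed.

Lemma memb_In x l : memb x l = true <-> In x l.
Proof.
  unfold memb. rewrite existsb_exists. split.
  - intros [y [Hy E]]. unfold site_eqb in E. apply andb_true_iff in E. destruct E as [E1 E2].
    apply Z.eqb_eq in E1, E2. destruct x, y; simpl in *; subst; auto.
  - intros H. exists x. split; auto. unfold site_eqb. now rewrite !Z.eqb_refl.
Qed.

Lemma memb_square A y : memb y (square A) = in_square A y.
Proof.
  apply eq_true_iff_eq. rewrite memb_In, in_square_iff. destruct y as [a b].
  rewrite <- !in_win. exact (in_prod_iff (win A) (win A) a b).
Qed.

Lemma lsum_square f A : lsum f (square A) =
  Sg (2 * A) (fun i => Sg (2 * A) (fun j => f ((Z.of_nat i - Z.of_nat A)%Z, (Z.of_nat j - Z.of_nat A)%Z))).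
Proof.
  unfold square, win, site in *. rewrite lsum_list_prod, lsum_map. apply lsum_ext. intros i. now rewrite lsum_map.
Qed.

Definition wall_length (c : nat -> nat -> bool) (L : nat) : R :=
  Sg L (fun j => INR (length (breaks (row c j) L))) + Sg L (fun i => INR (length (breaks (row (transpose c) i) L))).

Lemma length_breaks u L : INR (length (breaks u L)) = shift_count u L 1.
Proof.
  induction L as [|[|m] IH]; [reflexivity|reflexivity|].
  unfold shift_count. replace (S (S m) - 1)%nat with (S m) by lia. rewrite Sg_S.
  unfold shift_count in IH. replace (S m - 1)%nat with m in IH by lia. rewrite <- IH, breaks_SS.
  rewrite Nat.add_1_r. unfold dif. destruct (xorb (u m) (u (S m))); simpl ind; [|lra].
  change (length (m :: breaks u (S m))) with (S (length (breaks u (S m)))). rewrite S_INR. lra.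
Qed.

Definition unit_dist (z : nat) : R := if Nat.eqb z 1 then 1 else 0.

Lemma length_breaks_pairs u L :
  Sg L (fun i => Sg L (fun i' => unit_dist (Z.abs_nat (Z.of_nat i - Z.of_nat i')) * dif (u i) (u i')))
  = 2 * INR (length (breaks u L)).
Proof.
  rewrite pair_sum_by_distance, length_breaks. f_equal.
  destruct L as [|L]; [reflexivity|]. rewrite Sg_head, Sg_zero; [unfold unit_dist; simpl; ring|].
  intros k _. unfold unit_dist. simpl. ring.
Qed.

Lemma dist2_unit x1 x2 y1 y2 : (if Z.eqb (dist2 (x1, x2) (y1, y2)) 1 then 1 else 0) =
  unit_dist (Z.abs_nat (x1 - y1)) * (if Z.eqb x2 y2 then 1 else 0) + unit_dist (Z.abs_nat (x2 - y2)) * (if Z.eqb x1 y1 then 1 else 0).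
Proof.
  unfold dist2, unit_dist; simpl fst; simpl snd.
  destruct (Z.eqb_spec ((x1 - y1) ^ 2 + (x2 - y2) ^ 2) 1); destruct (Z.eqb_spec x2 y2); destruct (Z.eqb_spec x1 y1);
    destruct (Nat.eqb_spec (Z.abs_nat (x1 - y1)) 1); destruct (Nat.eqb_spec (Z.abs_nat (x2 - y2)) 1); try lra; exfalso; try nia.
Qed.

Lemma Sg_select_Z L j A (f : nat -> R) : (j < L)%nat ->
  Sg L (fun j' => (if Z.eqb (Z.of_nat j - A) (Z.of_nat j' - A) then 1 else 0) * f j') = f j.
Proof.
  intros Hj. rewrite (Sg_ext L _ (fun j' => if Nat.eqb j' j then f j else 0)).
  - rewrite Sg_delta. apply Nat.ltb_lt in Hj. now rewrite Hj.
  - intros j' _. destruct (Z.eqb_spec (Z.of_nat j - A) (Z.of_nat j' - A)); destruct (Nat.eqb_spec j' j); try lia; [subst|]; ring.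
Qed.

Section Energies.
Context (p : R) (hp : 4 < p).

(* Half of the Hamiltonian of a square with free boundary conditions. *)
Definition half_energy (J : R) (c : nat -> nat -> bool) (L : nat) : R :=
  J * wall_length c L - / 2 * pair_interaction p c L.

Lemma nn_term (s : config) A :
  lsum (fun xy => if Z.eqb (dist2 (fst xy) (snd xy)) 1 then spin s (fst xy) * spin s (snd xy) - 1 else 0) (upairs (square A))
  = - 2 * wall_length (cfg s A) (2 * A).
Proof.
  set (L := (2 * A)%nat).
  assert (H := lsum_upairs (fun x y => if Z.eqb (dist2 x y) 1 then spin s x * spin s y - 1 else 0) (square A)).
  cut (lsum (fun x => lsum (fun y => if Z.eqb (dist2 x y) 1 then spin s x * spin s y - 1 else 0) (square A)) (square A)
       = - 4 * wall_length (cfg s A) L).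
  { intros E.
    assert (2 * lsum (fun xy => if Z.eqb (dist2 (fst xy) (snd xy)) 1 then spin s (fst xy) * spin s (snd xy) - 1 else 0) (upairs (square A))
      = -4 * wall_length (cfg s A) L); [|lra].
    rewrite <- E. apply H.
    - intros x y. unfold dist2. replace ((fst x - fst y) ^ 2 + (snd x - snd y) ^ 2)%Z with ((fst y - fst x) ^ 2 + (snd y - snd x) ^ 2)%Z by ring.
      now rewrite (Rmult_comm (spin s x)).
    - intros x. unfold dist2. now rewrite !Z.sub_diag. }
  clear H. rewrite lsum_square. fold L.
  set (c := cfg s A). set (a := Z.of_nat A).
  rewrite (Sg_ext L _ (fun i => Sg L (fun j =>
     - 2 * (Sg L (fun i' => unit_dist (Z.abs_nat (Z.of_nat i - Z.of_nat i')) * dif (row c j i) (row c j i'))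
      + Sg L (fun j' => unit_dist (Z.abs_nat (Z.of_nat j - Z.of_nat j')) * dif (row (transpose c) i j) (row (transpose c) i j')))))).
  - rewrite (Sg_ext L _ (fun i => - 2 * (Sg L (fun j => Sg L (fun i' => unit_dist (Z.abs_nat (Z.of_nat i - Z.of_nat i')) * dif (row c j i) (row c j i')))
      + Sg L (fun j => Sg L (fun j' => unit_dist (Z.abs_nat (Z.of_nat j - Z.of_nat j')) * dif (row (transpose c) i j) (row (transpose c) i j')))))).
    2:{ intros i _. now rewrite Sg_scal, Sg_plus. }
    rewrite Sg_scal, Sg_plus, (Sg_swap L L (fun i j => Sg L (fun i' => unit_dist (Z.abs_nat (Z.of_nat i - Z.of_nat i')) * dif (row c j i) (row c j i')))).
    rewrite (Sg_ext L _ (fun j => 2 * INR (length (breaks (row c j) L)))) by (intros; apply length_breaks_pairs).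
    rewrite (Sg_ext L (fun i => Sg L (fun j => Sg L (fun j' => unit_dist (Z.abs_nat (Z.of_nat j - Z.of_nat j')) * dif (row (transpose c) i j) (row (transpose c) i j'))))
       (fun i => 2 * INR (length (breaks (row (transpose c) i) L)))) by (intros; apply length_breaks_pairs).
    rewrite !Sg_scal. unfold wall_length. ring.
  - intros i Hi. apply Sg_ext. intros j Hj. rewrite lsum_square. fold L a.
    rewrite (Sg_ext L _ (fun i' => - 2 * (unit_dist (Z.abs_nat (Z.of_nat i - Z.of_nat i')) * dif (c i j) (c i' j))
        + (if Z.eqb (Z.of_nat i - a) (Z.of_nat i' - a) then 1 else 0) * (- 2 * Sg L (fun j' => unit_dist (Z.abs_nat (Z.of_nat j - Z.of_nat j')) * dif (c i j) (c i' j'))))).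
    + rewrite Sg_plus, Sg_select_Z, Sg_scal by auto. unfold row, transpose. ring.
    + intros i' Hi'.
      rewrite (Sg_ext L _ (fun j' =>
         (if Z.eqb (Z.of_nat j - a) (Z.of_nat j' - a) then 1 else 0) * (- 2 * (unit_dist (Z.abs_nat (Z.of_nat i - Z.of_nat i')) * dif (c i j) (c i' j')))
         + ((if Z.eqb (Z.of_nat i - a) (Z.of_nat i' - a) then 1 else 0) * - 2) * (unit_dist (Z.abs_nat (Z.of_nat j - Z.of_nat j')) * dif (c i j) (c i' j')))).
      * rewrite Sg_plus, Sg_select_Z, Sg_scal by auto. ring.
      * intros j' Hj'. rewrite spin_dif.
        change (s ((Z.of_nat i - a)%Z, (Z.of_nat j - a)%Z)) with (c i j).
        change (s ((Z.of_nat i' - a)%Z, (Z.of_nat j' - a)%Z)) with (c i' j').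
        set (d := dif (c i j) (c i' j')).
        replace (if Z.eqb (dist2 ((Z.of_nat i - a)%Z, (Z.of_nat j - a)%Z) ((Z.of_nat i' - a)%Z, (Z.of_nat j' - a)%Z)) 1 then -2 * d else 0)
          with ((if Z.eqb (dist2 ((Z.of_nat i - a)%Z, (Z.of_nat j - a)%Z) ((Z.of_nat i' - a)%Z, (Z.of_nat j' - a)%Z)) 1 then 1 else 0) * (-2 * d))
          by (destruct (Z.eqb _ 1); ring).
        rewrite dist2_unit.
        replace (Z.of_nat i - a - (Z.of_nat i' - a))%Z with (Z.of_nat i - Z.of_nat i')%Z by ring.
        replace (Z.of_nat j - a - (Z.of_nat j' - a))%Z with (Z.of_nat j - Z.of_nat j')%Z by ring.
        ring.
Qed.

Lemma lr_term (s : config) A :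
  lsum (fun xy => (spin s (fst xy) * spin s (snd xy) - 1) / distp p (fst xy) (snd xy)) (upairs (square A))
  = - pair_interaction p (cfg s A) (2 * A).
Proof.
  assert (H := lsum_upairs (fun x y => (spin s x * spin s y - 1) / distp p x y) (square A)).
  cut (lsum (fun x => lsum (fun y => (spin s x * spin s y - 1) / distp p x y) (square A)) (square A)
       = - 2 * pair_interaction p (cfg s A) (2 * A)).
  { intros E.
    assert (2 * lsum (fun xy => (spin s (fst xy) * spin s (snd xy) - 1) / distp p (fst xy) (snd xy)) (upairs (square A))
      = - 2 * pair_interaction p (cfg s A) (2 * A)); [|lra].
    rewrite <- E. apply H.
    - intros x y. unfold distp, dist2. replace ((fst x - fst y) ^ 2 + (snd x - snd y) ^ 2)%Z with ((fst y - fst x) ^ 2 + (snd y - snd x) ^ 2)%Z by ring.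
      now rewrite (Rmult_comm (spin s x)).
    - intros x. rewrite spin_dif, dif_diag. unfold Rdiv. ring. }
  clear H. rewrite lsum_square. unfold pair_interaction. rewrite <- Sg_scal. apply Sg_ext; intros i _.
  rewrite <- Sg_scal. apply Sg_ext; intros j _. rewrite lsum_square, <- Sg_scal. apply Sg_ext; intros i' _.
  rewrite <- Sg_scal. apply Sg_ext; intros j' _. unfold Rdiv. rewrite distp_KK, spin_dif. simpl fst; simpl snd.
  replace (Z.of_nat i - Z.of_nat A - (Z.of_nat i' - Z.of_nat A))%Z with (Z.of_nat i - Z.of_nat i')%Z by ring.
  replace (Z.of_nat j - Z.of_nat A - (Z.of_nat j' - Z.of_nat A))%Z with (Z.of_nat j - Z.of_nat j')%Z by ring.
  unfold cfg. ring.
Qed.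

Definition k1_tail (m : nat) : R := nsum (fun k => k1 p (S (m + k))).

Lemma k1_tail_lim m : is_lim_seq (fun N => Sg N (fun k => k1 p (S (m + k)))) (k1_tail m).
Proof.
  apply (nsum_lim _ (jc p)).
  - intros; left; now apply k1_pos.
  - intros n. apply Rle_trans with (Sg n (fun n => INR (S n) * k1 p (S n))).
    + apply Sg_le. intros k _. assert (H := k1_antitone p hp k m). rewrite Nat.add_comm.
      assert (H0 := k1_pos p hp k). assert (1 <= INR (S k)) by (rewrite S_INR; assert (0 <= INR k) by apply pos_INR; lra). nra.
    + apply Sg_le_lim; [apply moment1_nonneg; auto|now apply jc_lim].
Qed.

Lemma k1_tail_ge m N : Sg N (fun k => k1 p (S (m + k))) <= k1_tail m.
Proof. apply Sg_le_lim; [intros; left; now apply k1_pos|apply k1_tail_lim]. Qed.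

Lemma k1_tail_nonneg m : 0 <= k1_tail m.
Proof. exact (k1_tail_ge m 0). Qed.

(** k1(z+1) occurs only in the tails m = 0, ..., z, so the first moment bounds the sum. This keeps
    the interaction of a square with its outside of order L. *)
Lemma k1_tail_sum L : Sg L k1_tail <= jc p.
Proof.
  assert (Hl : is_lim_seq (fun N => Sg L (fun m => Sg N (fun k => k1 p (S (m + k))))) (Sg L k1_tail)).
  { apply (is_lim_seq_lsum (fun N m => Sg N (fun k => k1 p (S (m + k)))) k1_tail). intros; apply k1_tail_lim. }
  apply (lim_le_const _ _ _ Hl). intros N.
  apply Rle_trans with (Sg L (fun m => Sg (L + N) (fun z => ind ((0 <=? m) && (m <? S z))%nat * k1 p (S z)))).
  - apply Sg_le. intros m Hm. replace (L + N)%nat with (m + (N + (L - m)))%nat by lia. rewrite !Sg_add.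
    assert (Hp : forall z, 0 <= ind ((0 <=? m) && (m <? S z))%nat * k1 p (S z)).
    { intros z. apply Rmult_le_pos; [apply ind_nonneg|left; now apply k1_pos]. }
    assert (0 <= Sg m (fun z => ind ((0 <=? m) && (m <? S z))%nat * k1 p (S z))) by (apply Sg_nonneg; auto).
    assert (0 <= Sg (L - m) (fun k => ind ((0 <=? m) && (m <? S (m + (N + k))))%nat * k1 p (S (m + (N + k))))) by (apply Sg_nonneg; auto).
    rewrite (Sg_ext N (fun k => ind ((0 <=? m) && (m <? S (m + k)))%nat * k1 p (S (m + k))) (fun k => k1 p (S (m + k)))); [lra|].
    intros k _. destruct (Nat.leb_spec 0 m); destruct (Nat.ltb_spec m (S (m + k))); try lia. simpl. ring.
  - rewrite Sg_swap. apply Rle_trans with (Sg (L + N) (fun z => INR (S z) * k1 p (S z))).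
    + apply Sg_le. intros z _. rewrite Sg_scal_r, Sg_interval.
      apply Rmult_le_compat_r; [left; now apply k1_pos|]. apply le_INR. lia.
    + apply Sg_le_lim; [apply moment1_nonneg; auto|now apply jc_lim].
Qed.

Lemma half_line_sum (l : list Z) (x a : Z) : NoDup l -> (x < a)%Z ->
  lsum (fun y => if Z.leb a y then K1 p (x - y) else 0) l <= k1_tail (Z.to_nat (a - x - 1)).
Proof.
  intros Hl Hx. rewrite <- lsum_filter.
  set (m := Z.to_nat (a - x - 1)).
  rewrite (lsum_ext_in (fun y => K1 p (x - y)) (fun y => k1 p (S (m + Z.to_nat (y - a))))).
  2:{ intros y Hy. apply filter_In in Hy. destruct Hy as [_ Hy]. apply Z.leb_le in Hy.
      rewrite K1_abs. f_equal. lia. }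
  rewrite <- (lsum_map (fun y => Z.to_nat (y - a)) (fun k => k1 p (S (m + k)))).
  set (l' := map (fun y => Z.to_nat (y - a)) (filter (fun y => Z.leb a y) l)).
  apply Rle_trans with (Sg (S (list_max l')) (fun k => k1 p (S (m + k)))).
  - apply lsum_incl.
    + apply NoDup_map_NoDup_ForallPairs; [|now apply NoDup_filter].
      intros y y' Hy Hy' E. apply filter_In in Hy, Hy'. destruct Hy as [_ Hy]. destruct Hy' as [_ Hy'].
      apply Z.leb_le in Hy, Hy'. lia.
    + intros k Hk. apply in_seq. split; [lia|]. assert (H := proj1 (list_max_le l' (list_max l')) (le_n _)).
      rewrite Forall_forall in H. specialize (H k Hk). lia.
    + intros; left; now apply k1_pos.
  - apply k1_tail_ge.
Qed.

Lemma half_line_sum_left (l : list Z) (x a : Z) : NoDup l -> (a <= x)%Z ->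
  lsum (fun y => if Z.ltb y a then K1 p (x - y) else 0) l <= k1_tail (Z.to_nat (x - a)).
Proof.
  intros Hl Hx.
  assert (H := half_line_sum (map Z.opp l) (- x) (- a + 1)). rewrite lsum_map in H.
  replace (Z.to_nat (- a + 1 - - x - 1)) with (Z.to_nat (x - a)) in H by lia.
  rewrite (lsum_ext (fun y => if Z.ltb y a then K1 p (x - y) else 0) (fun y => if Z.leb (- a + 1) (- y) then K1 p (- x - - y) else 0)).
  - apply H; [|lia]. apply NoDup_map_NoDup_ForallPairs; auto. intros y y' _ _ E. lia.
  - intros y. replace (- x - - y)%Z with (- (x - y))%Z by ring. rewrite K1_even.
    destruct (Z.ltb_spec y a); destruct (Z.leb_spec (- a + 1) (- y)); auto; lia.
Qed.

Definition outer_bound (L i j : nat) : R :=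
  k1_tail (L - 1 - i) + k1_tail i + (k1_tail (L - 1 - j) + k1_tail j).

Lemma outer_bound_nonneg L i j : 0 <= outer_bound L i j.
Proof.
  unfold outer_bound. assert (H1 := k1_tail_nonneg (L - 1 - i)). assert (H2 := k1_tail_nonneg i).
  assert (H3 := k1_tail_nonneg (L - 1 - j)). assert (H4 := k1_tail_nonneg j). lra.
Qed.

Lemma outer_bound_sum L : Sg L (fun i => Sg L (fun j => outer_bound L i j)) <= 4 * INR L * jc p.
Proof.
  unfold outer_bound.
  rewrite (Sg_ext L _ (fun i => INR L * (k1_tail (L - 1 - i) + k1_tail i) + Sg L (fun j => k1_tail (L - 1 - j) + k1_tail j)))
    by (intros; now rewrite Sg_plus, Sg_const).
  rewrite Sg_plus, Sg_scal, Sg_const, Sg_plus, <- (Sg_rev L k1_tail).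
  assert (H := k1_tail_sum L). assert (0 <= INR L) by apply pos_INR. nra.
Qed.

(** The complement of the square is covered by four half-planes; summing along the lines parallel to
    a side reduces each of them to a tail of [k1]. *)
Lemma outer_sum_le A i j l1 l2 : (i < 2 * A)%nat -> (j < 2 * A)%nat -> NoDup l1 -> NoDup l2 ->
  lsum (fun y1 => lsum (fun y2 => if in_square A (y1, y2) then 0 else
    KK p (Z.of_nat i - Z.of_nat A - y1) (Z.of_nat j - Z.of_nat A - y2)) l2) l1 <= outer_bound (2 * A) i j.
Proof.
  intros Hi Hj H1 H2. set (a := Z.of_nat A).
  set (x1 := (Z.of_nat i - a)%Z). set (x2 := (Z.of_nat j - a)%Z).
  assert (Hline : forall (x y x' : Z) l, x <> y -> NoDup l -> lsum (fun y' => KK p (x - y) (x' - y')) l <= K1 p (x - y)).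
  { intros x y x' l Hne Hl. rewrite <- (lsum_map (fun y' => (x' - y')%Z) (KK p (x - y))). apply K1_ge; auto; [lia|].
    apply NoDup_map_NoDup_ForallPairs; auto. intros u v _ _ E. lia. }
  assert (Hside : forall x x' la lb, (- a <= x < a)%Z -> NoDup la -> NoDup lb ->
    lsum (fun y => lsum (fun y' => (if Z.leb a y then KK p (x - y) (x' - y') else 0) + (if Z.ltb y (- a) then KK p (x - y) (x' - y') else 0)) lb) la
    <= k1_tail (Z.to_nat (a - x - 1)) + k1_tail (Z.to_nat (x - - a))).
  { intros x x' la lb Hx Ha Hb.
    apply Rle_trans with (lsum (fun y => (if Z.leb a y then K1 p (x - y) else 0) + (if Z.ltb y (- a) then K1 p (x - y) else 0)) la).
    - apply lsum_le_in. intros y _. rewrite lsum_plus. apply Rplus_le_compat.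
      + destruct (Z.leb_spec a y); [apply Hline; auto; lia|rewrite lsum_zero; lra].
      + destruct (Z.ltb_spec y (- a)); [apply Hline; auto; lia|rewrite lsum_zero; lra].
    - rewrite lsum_plus. apply Rplus_le_compat; [apply half_line_sum; auto; lia|apply half_line_sum_left; auto; lia]. }
  apply Rle_trans with (lsum (fun y1 => lsum (fun y2 =>
     ((if Z.leb a y1 then KK p (x1 - y1) (x2 - y2) else 0) + (if Z.ltb y1 (- a) then KK p (x1 - y1) (x2 - y2) else 0))
     + ((if Z.leb a y2 then KK p (x2 - y2) (x1 - y1) else 0) + (if Z.ltb y2 (- a) then KK p (x2 - y2) (x1 - y1) else 0))) l2) l1).
  - apply lsum_le_in; intros y1 _. apply lsum_le_in; intros y2 _.
    assert (K0 := KK_pos p (x1 - y1) (x2 - y2)). rewrite (KK_sym p (x2 - y2)).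
    destruct (in_square A (y1, y2)) eqn:E.
    + destruct (Z.leb a y1), (Z.ltb y1 (- a)), (Z.leb a y2), (Z.ltb y2 (- a)); lra.
    + destruct (Z.leb_spec a y1); destruct (Z.ltb_spec y1 (- a)); destruct (Z.leb_spec a y2); destruct (Z.ltb_spec y2 (- a)); try lra.
      exfalso. assert (in_square A (y1, y2) = true); [|congruence]. apply in_square_iff. simpl. lia.
  - rewrite (lsum_ext _ (fun y1 => lsum (fun y2 => (if Z.leb a y1 then KK p (x1 - y1) (x2 - y2) else 0) + (if Z.ltb y1 (- a) then KK p (x1 - y1) (x2 - y2) else 0)) l2
       + lsum (fun y2 => (if Z.leb a y2 then KK p (x2 - y2) (x1 - y1) else 0) + (if Z.ltb y2 (- a) then KK p (x2 - y2) (x1 - y1) else 0)) l2))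
       by (intros; now rewrite <- lsum_plus).
    rewrite lsum_plus. unfold outer_bound. apply Rplus_le_compat.
    + apply Rle_trans with (1 := Hside x1 x2 l1 l2 ltac:(unfold x1, a; lia) H1 H2). right. f_equal; f_equal; unfold x1, a; lia.
    + rewrite lsum_swap. apply Rle_trans with (1 := Hside x2 x1 l2 l1 ltac:(unfold x2, a; lia) H2 H1). right. f_equal; f_equal; unfold x2, a; lia.
Qed.

(** [real] sends an infinite limit to 0, whence the condition M <= 0. *)
Lemma zsum2_ge g M : M <= 0 -> (forall N, M <= lsum g (box N)) -> M <= zsum2 g.
Proof.
  intros HM H. unfold zsum2.
  assert (HL : Rbar_le (Lim_seq (fun _ => M)) (Lim_seq (fun N => lsum g (box N)))).
  { apply Lim_seq_le_loc. exists O. auto. }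
  rewrite Lim_seq_const in HL. destruct (Lim_seq (fun N => lsum g (box N))); simpl in *; auto.
Qed.

Lemma zsum2_nonpos g : (forall N, lsum g (box N) <= 0) -> zsum2 g <= 0.
Proof.
  intros H. unfold zsum2.
  assert (HL : Rbar_le (Lim_seq (fun N => lsum g (box N))) (Lim_seq (fun _ => 0))).
  { apply Lim_seq_le_loc. exists O. auto. }
  rewrite Lim_seq_const in HL. destruct (Lim_seq (fun N => lsum g (box N))); simpl in *; auto; lra.
Qed.

Lemma outer_term_ge (s : config) A :
  - (8 * INR (2 * A) * jc p) <= lsum (fun x => zsum2 (fun y => if memb y (square A) then 0 else (spin s x * spin s y - 1) / distp p x y)) (square A).
Proof.
  rewrite lsum_square. assert (H := outer_bound_sum (2 * A)).
  apply Rle_trans with (Sg (2 * A) (fun i => Sg (2 * A) (fun j => (- 2) * outer_bound (2 * A) i j))).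
  - rewrite (Sg_ext _ _ (fun i => (- 2) * Sg (2 * A) (fun j => outer_bound (2 * A) i j))) by (intros; now rewrite Sg_scal).
    rewrite Sg_scal. lra.
  - apply Sg_le; intros i Hi. apply Sg_le; intros j Hj.
    assert (H0 := outer_bound_nonneg (2 * A) i j).
    apply zsum2_ge; [lra|]. intros N. unfold box, site in *. rewrite lsum_list_prod.
    assert (H1 := outer_sum_le A i j (zrange N) (zrange N) Hi Hj (zrange_NoDup N) (zrange_NoDup N)).
    apply Rle_trans with (lsum (fun y1 => (-2) * lsum (fun y2 => if in_square A (y1, y2) then 0 else
      KK p (Z.of_nat i - Z.of_nat A - y1) (Z.of_nat j - Z.of_nat A - y2)) (zrange N)) (zrange N)).
    + rewrite lsum_scal. lra.
    + apply lsum_le_in; intros y1 _. rewrite <- lsum_scal. apply lsum_le_in; intros y2 _. rewrite memb_square.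
      destruct (in_square A (y1, y2)); [lra|]. unfold Rdiv. rewrite distp_KK, spin_dif. simpl fst; simpl snd.
      assert (K0 := KK_pos p (Z.of_nat i - Z.of_nat A - y1) (Z.of_nat j - Z.of_nat A - y2)).
      set (d := dif _ _). assert (0 <= d <= 1) by (split; [apply dif_nonneg|apply ind_le1]). nra.
Qed.

Lemma outer_term_nonpos (sg s : config) A :
  lsum (fun x => zsum2 (fun y => if memb y (square A) then 0 else (spin sg x * spin s y - 1) / distp p x y)) (square A) <= 0.
Proof.
  apply lsum_nonpos. intros x _. apply zsum2_nonpos. intros N. apply lsum_nonpos. intros y _. destruct (memb y (square A)); [apply Rle_refl|].
  unfold Rdiv. rewrite distp_KK, spin_dif. assert (K0 := KK_pos p (fst x - fst y) (snd x - snd y)).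
  assert (H := dif_nonneg (sg x) (s y)). nra.
Qed.

Lemma nn_outer_nonpos (sg s : config) X :
  lsum (fun x => lsum (fun y => if memb y X then 0 else spin sg x * spin s y - 1) (neighbours x)) X <= 0.
Proof.
  apply lsum_nonpos. intros x _. apply lsum_nonpos. intros y _. destruct (memb y X); [apply Rle_refl|]. rewrite spin_dif. assert (H := dif_nonneg (sg x) (s y)). lra.
Qed.

Lemma nn_outer_ge (sg s : config) A :
  - (8 * INR (2 * A)) <= lsum (fun x => lsum (fun y => if memb y (square A) then 0 else spin sg x * spin s y - 1) (neighbours x)) (square A).
Proof.
  rewrite lsum_square. set (L := (2 * A)%nat).
  set (edge := fun i : nat => (if Nat.eqb i (L - 1) then 1 else 0) + (if Nat.eqb i 0 then 1 else 0)).
  assert (He : Sg L edge <= 2).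
  { unfold edge. rewrite Sg_plus, !Sg_delta. destruct (L - 1 <? L)%nat, (0 <? L)%nat; lra. }
  assert (He0 : forall i, 0 <= edge i).
  { intros i. unfold edge. destruct (Nat.eqb i (L - 1)), (Nat.eqb i 0); lra. }
  apply Rle_trans with (Sg L (fun i => Sg L (fun j => (-2) * (edge i + edge j)))).
  - rewrite (Sg_ext L _ (fun i => (-2) * (INR L * edge i + Sg L edge))).
    + rewrite Sg_scal, Sg_plus, Sg_scal, Sg_const. assert (0 <= INR L) by apply pos_INR. nra.
    + intros i _. now rewrite Sg_scal, Sg_plus, Sg_const.
  - apply Sg_le; intros i Hi. apply Sg_le; intros j Hj.
    unfold neighbours. simpl fst; simpl snd. unfold lsum, map, fold_right. rewrite !memb_square.
    set (a := Z.of_nat A).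
    assert (Hin : forall y1 y2, (- a <= y1 < a)%Z -> (- a <= y2 < a)%Z -> in_square A (y1, y2) = true).
    { intros. apply in_square_iff. simpl. fold a. lia. }
    assert (Hb : forall (b : bool) x y, -2 <= (if b then 0 else spin sg x * spin s y - 1)).
    { intros b x y. destruct b; [lra|]. rewrite spin_dif. assert (H := ind_le1 (xorb (sg x) (s y))). unfold dif. lra. }
    assert (Hc : forall (cnd : bool) (b : bool) x y, (cnd = false -> b = true) ->
        (-2) * (if cnd then 1 else 0) <= (if b then 0 else spin sg x * spin s y - 1)).
    { intros cnd b x y Hcb. destruct cnd; [specialize (Hb b x y); lra|]. rewrite Hcb by auto. lra. }
    unfold edge.
    assert (X1 := Hc (Nat.eqb i (L - 1)) (in_square A ((Z.of_nat i - a + 1)%Z, (Z.of_nat j - a)%Z)) ((Z.of_nat i - a)%Z, (Z.of_nat j - a)%Z) ((Z.of_nat i - a + 1)%Z, (Z.of_nat j - a)%Z)).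
    assert (X2 := Hc (Nat.eqb i 0) (in_square A ((Z.of_nat i - a - 1)%Z, (Z.of_nat j - a)%Z)) ((Z.of_nat i - a)%Z, (Z.of_nat j - a)%Z) ((Z.of_nat i - a - 1)%Z, (Z.of_nat j - a)%Z)).
    assert (X3 := Hc (Nat.eqb j (L - 1)) (in_square A ((Z.of_nat i - a)%Z, (Z.of_nat j - a + 1)%Z)) ((Z.of_nat i - a)%Z, (Z.of_nat j - a)%Z) ((Z.of_nat i - a)%Z, (Z.of_nat j - a + 1)%Z)).
    assert (X4 := Hc (Nat.eqb j 0) (in_square A ((Z.of_nat i - a)%Z, (Z.of_nat j - a - 1)%Z)) ((Z.of_nat i - a)%Z, (Z.of_nat j - a)%Z) ((Z.of_nat i - a)%Z, (Z.of_nat j - a - 1)%Z)).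
    assert (Y1 := X1 ltac:(intros E; apply Nat.eqb_neq in E; apply Hin; unfold a, L in *; lia)).
    assert (Y2 := X2 ltac:(intros E; apply Nat.eqb_neq in E; apply Hin; unfold a, L in *; lia)).
    assert (Y3 := X3 ltac:(intros E; apply Nat.eqb_neq in E; apply Hin; unfold a, L in *; lia)).
    assert (Y4 := X4 ltac:(intros E; apply Nat.eqb_neq in E; apply Hin; unfold a, L in *; lia)).
    lra.
Qed.

Lemma HX_self_ge J s A : 0 < J ->
  2 * half_energy J (cfg s A) (2 * A) - 8 * INR (2 * A) * jc p <= HX J p (square A) s s.
Proof.
  intros HJ. unfold HX. rewrite nn_term, lr_term.
  assert (H1 := outer_term_ge s A). assert (H2 := nn_outer_nonpos s s (square A)).
  set (T3 := lsum (fun x => lsum _ (neighbours x)) (square A)) in *.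
  set (T4 := lsum _ (square A)) in *. unfold half_energy. nra.
Qed.

Lemma HX_le J sg s A : 0 < J ->
  HX J p (square A) sg s <= 2 * half_energy J (cfg sg A) (2 * A) + 8 * INR (2 * A) * J.
Proof.
  intros HJ. unfold HX. rewrite nn_term, lr_term.
  assert (H1 := outer_term_nonpos sg s A). assert (H2 := nn_outer_ge sg s A).
  set (T3 := lsum (fun x => lsum _ (neighbours x)) (square A)) in *.
  set (T4 := lsum _ (square A)) in *. unfold half_energy. nra.
Qed.

(** The nearest-neighbour boundary energy is nonnegative and the long-range one nonpositive: the
    first is dropped for [s], the second for [sg], and each one kept is O(L). *)
Lemma ground_state_le J s sg A : 0 < J -> ground_state J p s ->
  half_energy J (cfg s A) (2 * A) <= half_energy J (cfg sg A) (2 * A) + 4 * INR (2 * A) * (J + jc p).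
Proof.
  intros HJ Hs. specialize (Hs (square A) (square_NoDup A) sg).
  assert (H1 := HX_self_ge J s A HJ). assert (H2 := HX_le J sg s A HJ). lra.
Qed.

End Energies.

(** * Periodic stripes as trial states *)

Definition stZ (h : nat) (z : Z) : bool := Z.ltb (z mod (2 * Z.of_nat h)) (Z.of_nat h).

Lemma stZ_nat h k : stZ h (Z.of_nat k) = st h k.
Proof.
  unfold stZ, st. replace (2 * Z.of_nat h)%Z with (Z.of_nat (2 * h)) by lia. rewrite <- Nat2Z.inj_mod.
  destruct (Z.ltb_spec (Z.of_nat (k mod (2 * h))) (Z.of_nat h)); destruct (Nat.ltb_spec (k mod (2 * h)) h); auto; lia.
Qed.

Lemma stZ_period h z q : stZ h (z + q * (2 * Z.of_nat h)) = stZ h z.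
Proof. unfold stZ. now rewrite Z_mod_plus_full. Qed.

Lemma sin_period_Z t (q : Z) : sin (t + 2 * IZR q * PI) = sin t.
Proof.
  destruct (Z.le_gt_cases 0 q) as [H|H].
  - rewrite <- (sin_period t (Z.to_nat q)), INR_IZR_INZ, Z2Nat.id by lia. reflexivity.
  - rewrite <- (sin_period (t + 2 * IZR q * PI) (Z.to_nat (- q))), INR_IZR_INZ, Z2Nat.id by lia.
    f_equal. rewrite opp_IZR. ring.
Qed.

(** Reduction modulo 2h puts the angle in (0, 2 pi), and the shift by 1/2 keeps it off pi. *)
Lemma stripe_stZ h x : (1 <= h)%nat -> stripe h x = stZ h (fst x).
Proof.
  intros Hh. unfold stripe, stZ. set (z := fst x). set (P := (2 * Z.of_nat h)%Z).
  assert (HP : (0 < P)%Z) by (unfold P; lia).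
  assert (Hd := Z_div_mod_eq_full z P). assert (Hr := Z.mod_pos_bound z P HP).
  set (q := (z / P)%Z) in *. set (r := (z mod P)%Z) in *.
  assert (Hh0 : 0 < INR h) by (apply lt_0_INR; lia).
  assert (Pi := PI_RGT_0).
  replace (PI * (IZR z + / 2) / INR h) with (PI * (IZR r + / 2) / INR h + 2 * IZR q * PI).
  2:{ rewrite Hd. unfold P. rewrite plus_IZR, !mult_IZR, <- INR_IZR_INZ. simpl. field. lra. }
  rewrite sin_period_Z.
  assert (Hr0 : 0 <= IZR r) by (apply IZR_le; lia).
  destruct (Z.ltb_spec r (Z.of_nat h)) as [H|H].
  - assert (IZR r + 1 <= INR h) by (rewrite INR_IZR_INZ, <- plus_IZR; apply IZR_le; lia).
    destruct (Rlt_dec 0 (sin (PI * (IZR r + / 2) / INR h))) as [|Hn]; auto. exfalso; apply Hn.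
    apply sin_gt_0.
    + apply Rdiv_lt_0_compat; auto. apply Rmult_lt_0_compat; lra.
    + apply Rmult_lt_reg_r with (INR h); auto. unfold Rdiv. rewrite Rmult_assoc, Rinv_l by lra. nra.
  - assert (INR h <= IZR r) by (rewrite INR_IZR_INZ; apply IZR_le; lia).
    assert (IZR r + 1 <= 2 * INR h) by (rewrite INR_IZR_INZ, <- mult_IZR, <- plus_IZR; apply IZR_le; unfold P in Hr; lia).
    destruct (Rlt_dec 0 (sin (PI * (IZR r + / 2) / INR h))) as [Hn|]; auto. exfalso.
    assert (sin (PI * (IZR r + / 2) / INR h) < 0); [|lra].
    apply sin_lt_0.
    + apply Rmult_lt_reg_r with (INR h); auto. unfold Rdiv. rewrite Rmult_assoc, Rmult_assoc, Rinv_l by lra. nra.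
    + apply Rmult_lt_reg_r with (INR h); auto. unfold Rdiv. rewrite Rmult_assoc, Rmult_assoc, Rinv_l by lra. nra.
Qed.

Lemma is_lim_unique_R (u : nat -> R) (a b : R) : is_lim_seq u a -> is_lim_seq u b -> a = b.
Proof.
  intros Ha Hb. apply is_lim_seq_unique in Ha, Hb. rewrite Ha in Hb. now injection Hb.
Qed.

Section Stripes.
Context (p : R) (hp : 4 < p).

(** The boxes grow in both coordinates at once; [diag_limit] replaces their limit by first summing
    along lines. *)
Lemma Jc_eq_jc : Jc p = jc p.
Proof.
  unfold Jc, zsum2.
  rewrite (is_lim_seq_unique _ (jc p)); [reflexivity|].
  apply (is_lim_seq_ext (fun N => Sg N (fun k => INR (S k) * lsum (KK p (Z.of_nat (S k))) (zrange N)))).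
  - intros N. unfold box, site in *. rewrite lsum_list_prod, lsum_zrange.
    rewrite (lsum_zero_in _ (zrange N)) by reflexivity. rewrite Rplus_0_l. apply Sg_ext. intros k _.
    rewrite (lsum_zero_in (fun y => if (0 <? fst ((- Z.of_nat (S k))%Z, y))%Z then _ else 0)).
    + rewrite Rplus_0_r, <- lsum_scal. apply lsum_ext. intros y. simpl fst; simpl snd.
      destruct (Z.ltb_spec 0 (Z.of_nat (S k))); [|lia]. unfold KK, Rdiv. now rewrite INR_IZR_INZ.
    + intros y _. simpl fst. destruct (Z.ltb_spec 0 (- Z.of_nat (S k))); [lia|reflexivity].
  - apply (diag_limit (fun N z => INR (S z) * lsum (KK p (Z.of_nat (S z))) (zrange N)) (fun z => INR (S z) * k1 p (S z)) (fun N => N)).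
    + intros N z. assert (Hz := INR_S_pos z). split.
      * apply Rmult_le_pos; [lra|]. apply lsum_nonneg. intros; left; apply KK_pos.
      * apply Rmult_le_compat_l; [lra|]. apply K1_ge; auto; [lia|apply zrange_NoDup].
    + intros z. apply (is_lim_seq_mult' (fun _ => INR (S z))); [apply is_lim_seq_const|]. apply K1_lim; auto. lia.
    + now apply jc_lim.
    + intros M. exists M. auto.
Qed.

Definition site_terms (h k z : nat) : R :=
  k1 p (S z) * (dif (stZ h (Z.of_nat k)) (stZ h (Z.of_nat k + Z.of_nat (S z)))
              + dif (stZ h (Z.of_nat k)) (stZ h (Z.of_nat k - Z.of_nat (S z)))).

Lemma site_terms_nonneg h k z : 0 <= site_terms h k z.
Proof.
  apply Rmult_le_pos; [left; now apply k1_pos|]. apply Rplus_le_le_0_compat; apply dif_nonneg.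
Qed.

Lemma site_terms_lim h k : is_lim_seq (fun n => Sg n (site_terms h k)) (nsum (site_terms h k)).
Proof.
  apply (nsum_lim _ (2 * jc p)); [apply site_terms_nonneg|].
  intros n. apply Rle_trans with (2 * Sg n (fun n => INR (S n) * k1 p (S n))).
  - rewrite <- Sg_scal. apply Sg_le. intros z _. unfold site_terms.
    assert (H := k1_pos p hp z). assert (1 <= INR (S z)) by (rewrite S_INR; assert (0 <= INR z) by apply pos_INR; lra).
    assert (H1 : forall a b, dif a b <= 1) by (intros; apply ind_le1).
    assert (X := H1 (stZ h (Z.of_nat k)) (stZ h (Z.of_nat k + Z.of_nat (S z)))).
    assert (Y := H1 (stZ h (Z.of_nat k)) (stZ h (Z.of_nat k - Z.of_nat (S z)))). nra.
  - apply Rmult_le_compat_l; [lra|]. apply Sg_le_lim; [apply moment1_nonneg; auto|now apply jc_lim].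
Qed.

Lemma zsum2_stripe h k : (1 <= h)%nat ->
  zsum2 (fun y => if site_eqb y (Z.of_nat k, 0%Z) then 0 else
    (spin (stripe h) (Z.of_nat k, 0%Z) * spin (stripe h) y - 1) / distp p (Z.of_nat k, 0%Z) y)
  = - 2 * nsum (site_terms h k).
Proof.
  intros Hh. unfold zsum2. rewrite (is_lim_seq_unique _ (- 2 * nsum (site_terms h k))); [reflexivity|].
  set (kz := Z.of_nat k).
  set (T := fun N y1 => dif (stZ h kz) (stZ h y1) * lsum (KK p (kz - y1)) (zrange N)).
  assert (HT : forall N y1, 0 <= T N y1).
  { intros. apply Rmult_le_pos; [apply dif_nonneg|]. apply lsum_nonneg. intros; left; apply KK_pos. }
  apply (is_lim_seq_ext (fun N => - 2 * lsum (T N) (zrange N))).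
  { intros N. unfold box, site in *. rewrite lsum_list_prod, <- lsum_scal. apply lsum_ext. intros y1.
    unfold T. rewrite <- Rmult_assoc, <- lsum_scal. apply lsum_ext. intros y2.
    unfold Rdiv. rewrite distp_KK, spin_dif, !stripe_stZ by auto. simpl fst; simpl snd. fold kz.
    rewrite Z.sub_0_l, KK_opp_r. unfold site_eqb. simpl fst; simpl snd.
    destruct (Z.eqb_spec y1 kz); destruct (Z.eqb_spec y2 0); simpl; try ring. subst. rewrite dif_diag. ring. }
  apply (is_lim_seq_mult' (fun _ => - 2)); [apply is_lim_seq_const|].
  assert (Hcen : forall N M, lsum (T N) (map (fun m => (kz + m)%Z) (zrange M)) =
     Sg M (fun z => dif (stZ h kz) (stZ h (kz + Z.of_nat (S z))) * lsum (KK p (Z.of_nat (S z))) (zrange N)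
       + dif (stZ h kz) (stZ h (kz - Z.of_nat (S z))) * lsum (KK p (Z.of_nat (S z))) (zrange N))).
  { intros N M. rewrite lsum_map, lsum_zrange. unfold T at 1. rewrite Z.add_0_r, dif_diag, Rmult_0_l, Rplus_0_l.
    apply Sg_ext. intros z _. unfold T. f_equal.
    - f_equal. apply lsum_ext. intros b. replace (kz - (kz + Z.of_nat (S z)))%Z with (- Z.of_nat (S z))%Z by ring. apply KK_opp_l.
    - f_equal. apply lsum_ext. intros b. f_equal. ring. }
  assert (Hlim : forall m : nat -> nat, (forall M, exists N0, forall N, (N0 <= N)%nat -> (M <= m N)%nat) ->
     is_lim_seq (fun N => lsum (T N) (map (fun m => (kz + m)%Z) (zrange (m N)))) (nsum (site_terms h k))).
  { intros m Hm. eapply is_lim_seq_ext; [intros N; symmetry; apply Hcen|].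
    apply (diag_limit (fun N z => dif (stZ h kz) (stZ h (kz + Z.of_nat (S z))) * lsum (KK p (Z.of_nat (S z))) (zrange N)
       + dif (stZ h kz) (stZ h (kz - Z.of_nat (S z))) * lsum (KK p (Z.of_nat (S z))) (zrange N)) (site_terms h k) m); auto.
    - intros N z. unfold site_terms. fold kz.
      assert (H1 : 0 <= lsum (KK p (Z.of_nat (S z))) (zrange N)) by (apply lsum_nonneg; intros; left; apply KK_pos).
      assert (H2 : lsum (KK p (Z.of_nat (S z))) (zrange N) <= k1 p (S z)) by (apply K1_ge; auto; [lia|apply zrange_NoDup]).
      assert (H3 := dif_nonneg (stZ h kz) (stZ h (kz + Z.of_nat (S z)))).
      assert (H4 := dif_nonneg (stZ h kz) (stZ h (kz - Z.of_nat (S z)))). nra.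
    - intros z. unfold site_terms. fold kz. rewrite Rmult_plus_distr_l, !(Rmult_comm (k1 p (S z))).
      apply is_lim_seq_plus'; (apply is_lim_seq_mult'; [apply is_lim_seq_const|apply K1_lim; auto; lia]).
    - apply site_terms_lim. }
  assert (Hnd : forall M, NoDup (map (fun m => (kz + m)%Z) (zrange M))).
  { intros M. apply NoDup_map_NoDup_ForallPairs; [|apply zrange_NoDup]. intros a b _ _ E. lia. }
  (* The boxes are centred at 0 rather than at the site k, so they are squeezed between the
     intervals of radius N - k and N + k around k. *)
  apply (is_lim_seq_le_le_loc (fun N => lsum (T N) (map (fun m => (kz + m)%Z) (zrange (N - k)))) _
     (fun N => lsum (T N) (map (fun m => (kz + m)%Z) (zrange (N + k))))).
  - exists k. intros N HN. split.
    + apply lsum_incl; auto. intros y Hy. apply in_map_iff in Hy. destruct Hy as [m [<- Hm]].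
      apply in_zrange in Hm. apply in_zrange. unfold kz. lia.
    + apply lsum_incl; auto using zrange_NoDup. intros y Hy. apply in_zrange in Hy. apply in_map_iff.
      exists (y - kz)%Z. split; [ring|]. apply in_zrange. unfold kz. lia.
  - apply Hlim. intros M. exists (M + k)%nat. intros; lia.
  - apply Hlim. intros M. exists M. intros; lia.
Qed.

Lemma stripe_pair_count_right h z : Sg (2 * h) (fun k => dif (stZ h (Z.of_nat k)) (stZ h (Z.of_nat k + Z.of_nat z))) = 2 * tri h z.
Proof.
  unfold tri. rewrite <- Rmult_assoc, Rinv_r, Rmult_1_l by lra. apply Sg_ext. intros k _.
  rewrite <- Nat2Z.inj_add, !stZ_nat. reflexivity.
Qed.

Lemma stripe_pair_count_left h z : Sg (2 * h) (fun k => dif (stZ h (Z.of_nat k)) (stZ h (Z.of_nat k - Z.of_nat z))) = 2 * tri h z.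
Proof.
  rewrite <- stripe_pair_count_right.
  rewrite <- (Sg_periodic (2 * h) (fun k => dif (stZ h (Z.of_nat k)) (stZ h (Z.of_nat k - Z.of_nat z))) z).
  - apply Sg_ext. intros k _. rewrite dif_sym. f_equal; f_equal; lia.
  - intros k. replace (Z.of_nat (k + 2 * h)) with (Z.of_nat k + 1 * (2 * Z.of_nat h))%Z by lia.
    rewrite stZ_period. f_equal.
    replace (Z.of_nat k + 1 * (2 * Z.of_nat h) - Z.of_nat z)%Z with (Z.of_nat k - Z.of_nat z + 1 * (2 * Z.of_nat h))%Z by ring.
    apply stZ_period.
Qed.

Lemma site_terms_sum h : (1 <= h)%nat -> Sg (2 * h) (fun k => nsum (site_terms h k)) = 4 * tri_energy p h.
Proof.
  intros Hh.
  apply (is_lim_unique_R (fun N => Sg (2 * h) (fun k => Sg N (site_terms h k)))).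
  - apply (is_lim_seq_lsum (fun N k => Sg N (site_terms h k)) (fun k => nsum (site_terms h k))).
    intros; apply site_terms_lim.
  - apply (is_lim_seq_ext (fun N => 4 * Sg N (fun z => k1 p (S z) * tri h (S z)))).
    + intros N. rewrite Sg_swap, <- Sg_scal. apply Sg_ext. intros z _. unfold site_terms.
      rewrite Sg_scal, Sg_plus, stripe_pair_count_right, stripe_pair_count_left. ring.
    + apply (is_lim_seq_mult' (fun _ => 4)); [apply is_lim_seq_const|now apply tri_energy_lim].
Qed.

(** The factor 2 appears because [density] is normalised by half of the Hamiltonian; both functions
    have the same minimisers. *)
Lemma e_s_density J h : (1 <= h)%nat -> e_s J p h = 2 * density p J h.
Proof.
  intros Hh. unfold e_s.
  assert (Hh0 : 0 < INR h) by (apply lt_0_INR; lia).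
  assert (T1 : tri h 1 = 1).
  { assert (X := tri_ge_low h 1 Hh). assert (Y := tri_le h 1 Hh). simpl (INR 1) in *. lra. }
  rewrite (lsum_ext _ (fun k => J * (dif (stZ h (Z.of_nat k)) (stZ h (Z.of_nat k + Z.of_nat 1)) + dif (stZ h (Z.of_nat k)) (stZ h (Z.of_nat k - Z.of_nat 1)))
      - nsum (site_terms h k))).
  - fold (Sg (2 * h) (fun k => J * (dif (stZ h (Z.of_nat k)) (stZ h (Z.of_nat k + Z.of_nat 1)) + dif (stZ h (Z.of_nat k)) (stZ h (Z.of_nat k - Z.of_nat 1)))
      - nsum (site_terms h k))).
    rewrite Sg_minus, Sg_scal, Sg_plus, stripe_pair_count_right, stripe_pair_count_left, site_terms_sum, T1 by auto.
    unfold density, phi. field. lra.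
  - intros k. rewrite zsum2_stripe by auto. unfold neighbours, lsum, map, fold_right. simpl fst; simpl snd.
    rewrite !spin_dif, !stripe_stZ by auto. simpl fst. rewrite dif_diag. simpl (Z.of_nat 1). field.
Qed.

(** In the vertical direction the square sees only a part of each line. What is missing are
    interactions with the outside, bounded by [outer_bound]. *)
Lemma striped_pairs_partial_le u A N :
  INR (2 * A) * Sg (2 * A) (fun i => Sg (2 * A) (fun i' => dif (u i) (u i') * lsum (KK p (Z.of_nat i - Z.of_nat i')) (zrange N)))
  <= pair_interaction p (fun i _ => u i) (2 * A) + 4 * INR (2 * A) * jc p.
Proof.
  set (L := (2 * A)%nat).
  apply Rle_trans with (Sg L (fun i => Sg L (fun j =>
     Sg L (fun i' => Sg L (fun j' => KK p (Z.of_nat i - Z.of_nat i') (Z.of_nat j - Z.of_nat j') * dif (u i) (u i')))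
     + outer_bound p L i j))).
  - rewrite <- Sg_scal. apply Sg_le. intros i Hi. rewrite <- Sg_const. apply Sg_le. intros j Hj.
    set (a := Z.of_nat A). set (x2 := (Z.of_nat j - a)%Z).
    set (l2 := map (fun m => (x2 - m)%Z) (zrange N)).
    assert (Hl2 : NoDup l2).
    { apply NoDup_map_NoDup_ForallPairs; [|apply zrange_NoDup]. intros x y _ _ E. lia. }
    assert (Ho := outer_sum_le p hp A i j (win A) l2 Hi Hj (win_NoDup A) Hl2). fold L a in Ho. fold x2 in Ho.
    apply Rle_trans with (2 := Rplus_le_compat_l _ _ _ Ho). unfold win at 1. rewrite lsum_map. fold L. fold (Sg L).
    fold (Sg L (fun x => lsum (fun y2 => if in_square A ((Z.of_nat x - Z.of_nat A)%Z, y2) then 0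
        else KK p (Z.of_nat i - a - (Z.of_nat x - Z.of_nat A)) (x2 - y2)) l2)).
    rewrite <- Sg_plus. apply Sg_le. intros i' Hi'. fold a.
    assert (Hd : 0 <= dif (u i) (u i') <= 1) by (split; [apply dif_nonneg|apply ind_le1]).
    set (f := fun y2 => KK p (Z.of_nat i - Z.of_nat i') (x2 - y2)).
    assert (Hf : forall y, 0 <= f y) by (intros; left; apply KK_pos).
    rewrite (lsum_ext (fun y2 => if in_square A ((Z.of_nat i' - a)%Z, y2) then 0 else KK p (Z.of_nat i - a - (Z.of_nat i' - a)) (x2 - y2))
      (fun y2 => if in_square A ((Z.of_nat i' - a)%Z, y2) then 0 else f y2)).
    2:{ intros y2. unfold f. now replace (Z.of_nat i - a - (Z.of_nat i' - a))%Z with (Z.of_nat i - Z.of_nat i')%Z by ring. }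
    rewrite Sg_scal_r, (Rmult_comm (Sg L _)).
    replace (lsum (KK p (Z.of_nat i - Z.of_nat i')) (zrange N)) with (lsum f l2).
    2:{ unfold l2, f. rewrite lsum_map. apply lsum_ext. intros m. f_equal. ring. }
    rewrite (lsum_ext f (fun y2 => (if in_square A ((Z.of_nat i' - a)%Z, y2) then f y2 else 0) + (if in_square A ((Z.of_nat i' - a)%Z, y2) then 0 else f y2)))
      by (intros y2; destruct (in_square A _); ring).
    rewrite lsum_plus, Rmult_plus_distr_l. apply Rplus_le_compat.
    + apply Rmult_le_compat_l; [lra|]. rewrite <- lsum_filter.
      replace (Sg L (fun j' => KK p (Z.of_nat i - Z.of_nat i') (Z.of_nat j - Z.of_nat j'))) with (lsum f (win A)).
      2:{ unfold win, f. rewrite lsum_map. fold L. apply Sg_ext. intros j' _. f_equal. unfold x2, a. ring. }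
      apply lsum_incl; [now apply NoDup_filter| |auto].
      intros y Hy. apply filter_In in Hy. destruct Hy as [_ Hy]. apply in_square_iff in Hy. apply in_win. apply Hy.
    + set (o := lsum _ l2). assert (0 <= o); [|nra].
      apply lsum_nonneg. intros y _. destruct (in_square A _); auto. lra.
  - rewrite (Sg_ext L _ (fun i => Sg L (fun j => Sg L (fun i' => Sg L (fun j' => KK p (Z.of_nat i - Z.of_nat i') (Z.of_nat j - Z.of_nat j') * dif (u i) (u i'))))
       + Sg L (fun j => outer_bound p L i j))) by (intros; apply Sg_plus).
    rewrite Sg_plus. apply Rplus_le_compat; [apply Rle_refl|now apply outer_bound_sum].
Qed.

Lemma striped_pair_ge u A :
  2 * INR (2 * A) * row_interaction p u (2 * A) - 4 * INR (2 * A) * jc p <= pair_interaction p (fun i _ => u i) (2 * A).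
Proof.
  set (L := (2 * A)%nat).
  assert (Hl : is_lim_seq (fun N => INR L * Sg L (fun i => Sg L (fun i' => dif (u i) (u i') * lsum (KK p (Z.of_nat i - Z.of_nat i')) (zrange N))))
     (INR L * Sg L (fun i => Sg L (fun i' => k1 p (Z.abs_nat (Z.of_nat i - Z.of_nat i')) * dif (u i) (u i'))))).
  { apply (is_lim_seq_mult' (fun _ => INR L)); [apply is_lim_seq_const|].
    apply (is_lim_seq_lsum (fun N i => Sg L (fun i' => dif (u i) (u i') * lsum (KK p (Z.of_nat i - Z.of_nat i')) (zrange N)))
      (fun i => Sg L (fun i' => k1 p (Z.abs_nat (Z.of_nat i - Z.of_nat i')) * dif (u i) (u i')))). intros i _.
    apply (is_lim_seq_lsum (fun N i' => dif (u i) (u i') * lsum (KK p (Z.of_nat i - Z.of_nat i')) (zrange N))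
      (fun i' => k1 p (Z.abs_nat (Z.of_nat i - Z.of_nat i')) * dif (u i) (u i'))). intros i' _.
    rewrite Rmult_comm. destruct (Nat.eq_dec i i') as [<-|Hne].
    - rewrite dif_diag, Rmult_0_l. eapply is_lim_seq_ext; [|apply is_lim_seq_const]. intros; simpl; ring.
    - apply (is_lim_seq_mult' (fun _ => dif (u i) (u i'))); [apply is_lim_seq_const|]. rewrite <- K1_abs. apply K1_lim; auto. lia. }
  assert (H := lim_le_const _ _ _ Hl (striped_pairs_partial_le u A)). fold L in H.
  rewrite pair_sum_by_distance in H. unfold row_interaction. lra.
Qed.

Lemma Sg_periods P f M : (forall k, f (k + P)%nat = f k) -> Sg (M * P) f = INR M * Sg P f.
Proof.
  intros H. induction M as [|M IH]; [simpl; rewrite Sg_0; ring|].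
  replace (S M * P)%nat with (P + M * P)%nat by lia. rewrite Sg_add, S_INR.
  rewrite (Sg_ext (M * P) (fun k => f (P + k)%nat) f) by (intros; rewrite Nat.add_comm; apply H).
  rewrite IH. ring.
Qed.

Lemma tri_le_half h z : tri h z <= INR h.
Proof.
  unfold tri. assert (H : Sg (2 * h) (fun k => dif (st h k) (st h (k + z)%nat)) <= Sg (2 * h) (fun _ => 1)).
  { apply Sg_le. intros; apply ind_le1. }
  rewrite Sg_const, mult_INR in H. simpl (INR 2) in H. lra.
Qed.

Lemma stripe_shift_count h M z : (1 <= h)%nat ->
  2 * INR M * tri h z - INR z <= shift_count (st h) (M * (2 * h)) z.
Proof.
  intros Hh. set (L := (M * (2 * h))%nat).
  assert (E : Sg L (fun k => dif (st h k) (st h (k + z)%nat)) = 2 * INR M * tri h z).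
  { unfold L. rewrite Sg_periods.
    - unfold tri. field.
    - intros k. replace (k + 2 * h + z)%nat with (k + z + 2 * h)%nat by lia. now rewrite !st_period. }
  destruct (Nat.le_gt_cases z L) as [Hz|Hz].
  - rewrite <- E. replace L with ((L - z) + z)%nat at 1 by lia. rewrite Sg_add. fold (shift_count (st h) L z).
    assert (Sg z (fun k => dif (st h (L - z + k)%nat) (st h (L - z + k + z)%nat)) <= Sg z (fun _ => 1)) by (apply Sg_le; intros; apply ind_le1).
    rewrite Sg_const in H. unfold shift_count in *. lra.
  - assert (H := shift_count_nonneg (st h) L z). assert (T := tri_le_half h z).
    assert (INR L <= INR z) by (apply le_INR; lia). unfold L in H0. rewrite !mult_INR in H0. simpl (INR 2) in H0.
    assert (0 <= INR M) by apply pos_INR. nra.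
Qed.

(** For distances z up to L this is [stripe_shift_count]. Beyond L, tri <= h gives 2 M tri <= L <=
    z, so the terms left out are nonpositive. *)
Lemma stripe_row_interaction h M : (1 <= h)%nat ->
  2 * INR M * tri_energy p h - jc p <= row_interaction p (st h) (M * (2 * h)).
Proof.
  intros Hh. set (L := (M * (2 * h))%nat).
  assert (Hl : is_lim_seq (fun Z => 2 * INR M * Sg Z (fun z => k1 p (S z) * tri h (S z)) - Sg Z (fun n => INR (S n) * k1 p (S n)))
     (2 * INR M * tri_energy p h - jc p)).
  { apply is_lim_seq_minus'; [|now apply jc_lim].
    apply (is_lim_seq_mult' (fun _ => 2 * INR M)); [apply is_lim_seq_const|now apply tri_energy_lim]. }
  assert (Hl' := proj1 (is_lim_seq_incr_n _ L _) Hl). apply (lim_le_const _ _ _ Hl'). intros n.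
  rewrite <- Sg_scal, <- Sg_minus, Nat.add_comm, Sg_add.
  assert (H1 : Sg L (fun i => 2 * INR M * (k1 p (S i) * tri h (S i)) - INR (S i) * k1 p (S i)) <= row_interaction p (st h) L).
  { unfold row_interaction. apply Sg_le. intros z _. assert (H := stripe_shift_count h M (S z) Hh). fold L in H.
    assert (K := k1_pos p hp z). nra. }
  assert (H2 : Sg n (fun k => 2 * INR M * (k1 p (S (L + k)) * tri h (S (L + k))) - INR (S (L + k)) * k1 p (S (L + k))) <= Sg n (fun _ => 0)).
  { apply Sg_le. intros k _. assert (T := tri_le_half h (S (L + k))). assert (K := k1_pos p hp (L + k)).
    assert (INR L <= INR (S (L + k))) by (apply le_INR; lia). unfold L in H at 1. rewrite !mult_INR in H. simpl (INR 2) in H.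
    assert (0 <= INR M) by apply pos_INR.
    assert (2 * INR M * tri h (S (L + k)) <= INR (S (L + k))) by nra. nra. }
  rewrite Sg_const in H2. lra.
Qed.

Lemma stripe_half_energy J h M : 0 < J -> (1 <= h)%nat ->
  half_energy p J (fun i _ => st h i) (2 * (M * h)) <= density p J h * INR (2 * (M * h)) ^ 2 + 3 * INR (2 * (M * h)) * jc p.
Proof.
  intros HJ Hh. set (L := (2 * (M * h))%nat). set (c := fun i _ : nat => st h i).
  assert (EL : L = (M * (2 * h))%nat) by (unfold L; lia).
  assert (Hw : wall_length c L <= INR L * (2 * INR M)).
  { unfold wall_length. rewrite (Sg_zero L (fun i => INR (length (breaks (row (transpose c) i) L)))).
    - rewrite Rplus_0_r, <- Sg_const. apply Sg_le. intros j _. change (row c j) with (st h). rewrite length_breaks.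
      unfold shift_count. apply Rle_trans with (Sg L (fun i => dif (st h i) (st h (i + 1)%nat))).
      + apply Sg_mono; [lia|]. intros; apply dif_nonneg.
      + rewrite EL, (Sg_periods (2 * h) (fun i => dif (st h i) (st h (i + 1)%nat))).
        * assert (T := tri_le h 1 Hh). unfold tri in T. simpl (INR 1) in T.
          assert (0 <= INR M) by apply pos_INR. nra.
        * intros k. replace (k + 2 * h + 1)%nat with (k + 1 + 2 * h)%nat by lia. now rewrite !st_period.
    - intros i _. rewrite length_breaks. unfold shift_count. apply Sg_zero. intros. unfold row, transpose, c. apply dif_diag. }
  assert (Hp := striped_pair_ge (st h) (M * h)). fold L in Hp. change (fun i _ => st h i) with c in Hp.
  assert (Hr := stripe_row_interaction h M Hh). rewrite <- EL in Hr.
  assert (H0 : 0 <= INR L) by apply pos_INR.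
  assert (Hh0 : 0 < INR h) by (apply lt_0_INR; lia).
  assert (HL : INR L = 2 * INR M * INR h) by (rewrite EL, !mult_INR; simpl (INR 2); ring).
  assert (Hd : density p J h * INR L ^ 2 = INR L * (2 * INR M) * (J - tri_energy p h)).
  { unfold density, phi. replace (INR L ^ 2) with (INR L * (2 * INR M * INR h)) by (rewrite <- HL; ring). field. lra. }
  rewrite Hd. unfold half_energy.
  assert (X : J * wall_length c L <= J * (INR L * (2 * INR M))) by (apply Rmult_le_compat_l; lra).
  assert (Y : INR L * (2 * INR M * tri_energy p h - jc p) <= INR L * row_interaction p (st h) L) by (apply Rmult_le_compat_l; auto).
  lra.
Qed.

Lemma ground_state_energy_le J s h M : 0 < J -> ground_state J p s -> (1 <= h)%nat ->
  half_energy p J (cfg s (M * h)) (2 * (M * h))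
  <= density p J h * INR (2 * (M * h)) ^ 2 + INR (2 * (M * h)) * (4 * J + 7 * jc p).
Proof.
  intros HJ Hs Hh. set (A := (M * h)%nat).
  (* The trial state is read only on the square, where the shifted coordinate is nonnegative and
     [Z.to_nat] exact. *)
  assert (H1 := ground_state_le p hp J s (fun x => st h (Z.to_nat (fst x + Z.of_nat A))) A HJ Hs).
  assert (H2 := stripe_half_energy J h M HJ Hh). fold A in H2.
  replace (half_energy p J (cfg (fun x => st h (Z.to_nat (fst x + Z.of_nat A))) A) (2 * A))
    with (half_energy p J (fun i _ => st h i) (2 * A)) in H1.
  - lra.
  - f_equal. unfold cfg. apply functional_extensionality; intros i.
    apply functional_extensionality; intros j. f_equal. simpl fst. lia.
Qed.

End Stripes.

(** * The optimal width *)

Lemma finite_lower_bound (g : nat -> R) (P : nat -> Prop) M : (forall d, (d <= M)%nat -> P d -> 0 < g d) ->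
  exists k, 0 < k /\ forall d, (d <= M)%nat -> P d -> k <= g d.
Proof.
  induction M as [|M IH]; intros H.
  - destruct (classic (P 0%nat)) as [HP|HP].
    + exists (g 0%nat). split; [apply H; auto|]. intros d Hd _. replace d with 0%nat by lia. lra.
    + exists 1. split; [lra|]. intros d Hd HP'. replace d with 0%nat in HP' by lia. contradiction.
  - destruct IH as [k [Hk1 Hk2]]; [intros; apply H; auto|].
    destruct (classic (P (S M))) as [HP|HP].
    + exists (Rmin k (g (S M))). split; [apply Rmin_pos; auto|]. intros d Hd HP'.
      destruct (Nat.eq_dec d (S M)) as [->|]; [apply Rmin_r|].
      apply Rle_trans with k; [apply Rmin_l|apply Hk2; auto; lia].
    + exists k. split; auto. intros d Hd HP'. destruct (Nat.eq_dec d (S M)) as [->|]; [contradiction|apply Hk2; auto; lia].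
Qed.

Lemma finite_argmin (f : nat -> R) M : (1 <= M)%nat ->
  exists h, (1 <= h <= M)%nat /\ forall d, (1 <= d <= M)%nat -> f h <= f d.
Proof.
  induction M as [|M IH]; intros HM; [lia|]. destruct M as [|M].
  - exists 1%nat. split; [lia|]. intros d Hd. replace d with 1%nat by lia. lra.
  - destruct IH as [h [Hh1 Hh2]]; [lia|].
    destruct (Rle_lt_dec (f h) (f (S (S M)))) as [H|H].
    + exists h. split; [lia|]. intros d Hd. destruct (Nat.eq_dec d (S (S M))) as [->|]; auto. apply Hh2; lia.
    + exists (S (S M)). split; [lia|]. intros d Hd. destruct (Nat.eq_dec d (S (S M))) as [->|]; [lra|].
      specialize (Hh2 d ltac:(lia)). lra.
Qed.

Lemma nat_above (x : R) : exists n, x < INR n.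
Proof. destruct (INR_archimed 1 x Rlt_0_1) as [n Hn]. exists n. lra. Qed.

Section Constants.
Context (p : R) (hp : 4 < p).

(** In jc - tri_energy, the sum of k1(z) (z - tri), the terms with z <= d are nonpositive, and
    beyond d the bound d z <= z^2 turns the first moment into the second. *)
Lemma psi_tail d : (1 <= d)%nat ->
  INR d * (jc p - tri_energy p d) <= k1_second_moment p - Sg d (fun n => INR (S n) ^ 2 * k1 p (S n)).
Proof.
  intros Hd.
  assert (Hl : is_lim_seq (fun N => INR d * (Sg N (fun n => INR (S n) * k1 p (S n)) - Sg N (fun z => k1 p (S z) * tri d (S z))))
      (INR d * (jc p - tri_energy p d))).
  { apply (is_lim_seq_mult' (fun _ => INR d)); [apply is_lim_seq_const|].
    apply is_lim_seq_minus'; [now apply jc_lim|now apply tri_energy_lim]. }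
  assert (Hl' := proj1 (is_lim_seq_incr_n _ d _) Hl). apply (lim_le_const _ _ _ Hl'). intros n.
  rewrite <- Sg_minus, Nat.add_comm, Sg_add.
  assert (Hup : forall N, Sg N (fun n => INR (S n) ^ 2 * k1 p (S n)) <= k1_second_moment p).
  { apply Sg_le_lim; [|now apply k1_second_moment_lim]. intros k. apply Rmult_le_pos; [apply pow2_ge_0|left; now apply k1_pos]. }
  specialize (Hup (d + n)%nat). rewrite Sg_add in Hup.
  assert (H0 : 0 <= INR d) by apply pos_INR.
  assert (H1 : Sg d (fun i => INR (S i) * k1 p (S i) - k1 p (S i) * tri d (S i)) <= Sg d (fun _ => 0)).
  { apply Sg_le. intros i Hi. assert (T := tri_ge_low d (S i) ltac:(lia)). assert (K := k1_pos p hp i). nra. }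
  rewrite Sg_const in H1.
  assert (H2 : INR d * Sg n (fun k => INR (S (d + k)) * k1 p (S (d + k)) - k1 p (S (d + k)) * tri d (S (d + k)))
     <= Sg n (fun k => INR (S (d + k)) ^ 2 * k1 p (S (d + k)))).
  { rewrite <- Sg_scal. apply Sg_le. intros k _. assert (T := tri_nonneg d (S (d + k))). assert (K := k1_pos p hp (d + k)).
    assert (INR d <= INR (S (d + k))) by (apply le_INR; lia).
    set (x := INR (S (d + k))) in *. set (y := k1 p (S (d + k))) in *. set (w := tri d (S (d + k))) in *.
    assert (0 <= y * w) by nra. assert (0 <= INR d * (y * w)) by nra.
    assert (INR d * (x * y) <= x * (x * y)) by (apply Rmult_le_compat_r; nra). simpl. nra. }
  nra.
Qed.

(** The trial width is d = floor(c0 / (96 tau)) with c0 = 2^(-p/2). For small tau the second-moment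
    tail at d is below c0/384, hence below d tau/2. So phi <= -tau/2 and density <= -tau/(2d) <= -48
    tau^2 / c0, where 48 is the factor required in [stripe_constants]. *)
Lemma small_tau : exists eps, 0 < eps /\ forall J, jc p - eps < J -> J < jc p ->
  8 * (jc p - J) <= KK p 1 1 / 2 /\
  exists d, (1 <= d)%nat /\ density p J d <= - (48 * (jc p - J) ^ 2 / KK p 1 1).
Proof.
  set (c0 := KK p 1 1). assert (Hc : 0 < c0) by apply KK_pos.
  destruct (proj1 (lim_eps _ _) (k1_second_moment_lim p hp) (c0 / 384) ltac:(lra)) as [N0 HN0].
  assert (HN : 0 < INR (N0 + 2)) by (apply lt_0_INR; lia).
  (* Below this eps the trial width is at least N0 + 2, where the tail is small. *)
  exists (c0 / (96 * INR (N0 + 2))). split; [apply Rdiv_lt_0_compat; lra|].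
  intros J HJ1 HJ2. set (tau := jc p - J). assert (Ht : 0 < tau) by (unfold tau; lra).
  assert (Ht2 : tau * (96 * INR (N0 + 2)) < c0).
  { assert (tau < c0 / (96 * INR (N0 + 2))) by (unfold tau; lra).
    apply (Rmult_lt_compat_r (96 * INR (N0 + 2))) in H; [|lra].
    replace (c0 / (96 * INR (N0 + 2)) * (96 * INR (N0 + 2))) with c0 in H by (field; lra). exact H. }
  assert (H1 : 1 <= INR (N0 + 2)) by (rewrite plus_INR; simpl; assert (0 <= INR N0) by apply pos_INR; lra).
  split; [nra|].
  assert (Hx : INR (N0 + 2) < c0 / (96 * tau)).
  { apply Rmult_lt_reg_r with (96 * tau); [lra|]. replace (c0 / (96 * tau) * (96 * tau)) with c0 by (field; lra). lra. }
  destruct (nat_above (c0 / (96 * tau))) as [n0 Hn0].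
  assert (Hfl : exists d, INR d <= c0 / (96 * tau) /\ c0 / (96 * tau) < INR (S d)).
  { clear -Hn0 Hx HN. induction n0 as [|n IH]; [simpl in Hn0; lra|].
    destruct (Rlt_le_dec (c0 / (96 * tau)) (INR n)) as [H|H]; auto. exists n. auto. }
  destruct Hfl as [d [Hd1 Hd2]].
  assert (HdN : (N0 + 2 <= d)%nat).
  { assert (INR (N0 + 2) < INR (S d)) by lra. apply INR_lt in H. lia. }
  exists d. split; [lia|].
  assert (Hpsi := psi_tail d ltac:(lia)). specialize (HN0 d ltac:(lia)). apply Rabs_def2 in HN0.
  assert (Hd0 : 2 <= INR d) by (replace 2 with (INR 2) by reflexivity; apply le_INR; lia).
  rewrite S_INR in Hd2.
  assert (A1 : INR d * (96 * tau) <= c0).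
  { apply (Rmult_le_compat_r (96 * tau)) in Hd1; [|lra]. replace (c0 / (96 * tau) * (96 * tau)) with c0 in Hd1 by (field; lra). exact Hd1. }
  assert (A2 : c0 < (INR d + 1) * (96 * tau)).
  { apply (Rmult_lt_compat_r (96 * tau)) in Hd2; [|lra]. replace (c0 / (96 * tau) * (96 * tau)) with c0 in Hd2 by (field; lra). exact Hd2. }
  assert (A3 : INR d * (jc p - tri_energy p d) <= INR d * (tau / 2)) by nra.
  assert (A4 : jc p - tri_energy p d <= tau / 2) by (apply Rmult_le_reg_l with (INR d); lra).
  unfold density. assert (Hphi : phi p J d <= - (tau / 2)) by (unfold phi, tau in *; lra).
  apply Rdiv_le; [lra|].
  apply Rle_trans with (1 := Hphi).
  replace (- (48 * tau ^ 2 / c0) * INR d) with (- (tau / 2 * (INR d * (96 * tau) / c0))) by (field; lra).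
  assert (INR d * (96 * tau) / c0 <= 1) by (apply Rdiv_le; lra). nra.
Qed.

Definition optimal_width (J : R) (d : nat) : Prop :=
  (1 <= d)%nat /\ forall d', (1 <= d')%nat -> density p J d <= density p J d'.

Lemma optimal_width_minimizer J d : optimal_width J d -> es_minimizer J p d.
Proof.
  intros [H1 H2]. split; auto. intros h Hh. rewrite !e_s_density by auto. specialize (H2 h Hh). lra.
Qed.

Lemma density_ge J d : J <= jc p -> (1 <= d)%nat -> - (jc p - J) / INR d <= density p J d.
Proof.
  intros HJ Hd. unfold density. assert (0 < INR d) by (apply lt_0_INR; lia).
  apply Rmult_le_compat_r; [left; now apply Rinv_0_lt_compat|].
  assert (H1 := phi_lower p hp J d Hd). lra.
Qed.

(* The optimal width exists because density d >= -tau/d tends to 0 while its infimum is negative. *)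
Lemma stripe_constants J d0 : J < jc p -> 8 * (jc p - J) <= KK p 1 1 / 2 ->
  (1 <= d0)%nat -> density p J d0 <= - (48 * (jc p - J) ^ 2 / KK p 1 1) ->
  exists hs estar eta kappa D W,
    optimal_width J hs /\ density p J hs = estar /\ estar < 0 /\ 0 < eta /\ 0 < kappa /\
    (forall d, (1 <= d)%nat -> estar <= density p J d) /\
    (forall d, (1 <= d)%nat -> ~ ((1 <= d)%nat /\ density p J d = estar) -> estar + eta <= density p J d) /\
    3 * eta <= - estar /\ 3 * (jc p - J) <= - estar * INR (S D) /\
    8 * (jc p - J) * INR (S D) <= KK p 1 1 /\
    (forall d, optimal_width J d -> (d <= W)%nat) /\
    (forall d d', optimal_width J d -> optimal_width J d' -> d <> d' -> kappa <= gap_penalty (wall_potential p) d d').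
Proof.
  intros HJ Hsm Hd0 Hdens. set (tau := jc p - J) in *. assert (Ht : 0 < tau) by (unfold tau; lra).
  set (c0 := KK p 1 1) in *. assert (Hc : 0 < c0) by apply KK_pos.
  assert (Hneg : density p J d0 < 0).
  { assert (0 < 48 * tau ^ 2 / c0) by (apply Rdiv_lt_0_compat; nra). lra. }
  assert (Hfar : forall a d, a < 0 -> (1 <= d)%nat -> tau / (- a) < INR d -> a < density p J d).
  { intros a d Ha Hd H. assert (H1 := density_ge J d ltac:(lra) Hd). fold tau in H1.
    assert (0 < INR d) by (apply lt_0_INR; lia).
    apply Rlt_le_trans with (2 := H1). apply Rmult_lt_reg_r with (INR d); auto.
    replace (- tau / INR d * INR d) with (- tau) by (field; lra).
    apply (Rmult_lt_compat_r (- a)) in H; [|lra]. replace (tau / - a * - a) with tau in H by (field; lra). lra. }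
  destruct (nat_above (tau / (- density p J d0))) as [M1 HM1].
  destruct (finite_argmin (density p J) (M1 + d0) ltac:(lia)) as [hs [Hhs1 Hhs2]].
  assert (Hmin : forall d, (1 <= d)%nat -> density p J hs <= density p J d).
  { intros d Hd. destruct (Nat.le_gt_cases d (M1 + d0)) as [H|H]; [apply Hhs2; lia|].
    assert (density p J hs <= density p J d0) by (apply Hhs2; lia).
    assert (density p J d0 < density p J d); [|lra].
    apply Hfar; auto. apply Rlt_trans with (1 := HM1). apply lt_INR; lia. }
  set (estar := density p J hs) in *.
  assert (He0 : estar <= density p J d0) by (apply Hmin; auto).
  assert (He : estar < 0) by lra.
  destruct (nat_above (tau / (- (estar / 2)))) as [W HW].
  assert (Hopt : forall d, optimal_width J d -> (d <= W)%nat).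
  { intros d [Hd1 Hd2]. apply Nat.nlt_ge. intros H.
    assert (density p J d <= estar) by (apply Hd2; lia).
    assert (estar / 2 < density p J d); [|lra]. apply Hfar; auto; [lra|].
    apply Rlt_trans with (1 := HW). apply lt_INR; lia. }
  destruct (finite_lower_bound (fun d => density p J d - estar) (fun d => (1 <= d)%nat /\ estar < density p J d) W) as [eta0 [Heta1 Heta2]].
  { intros d _ [_ H]. lra. }
  assert (Hk : forall d, (d <= W)%nat -> exists k, 0 < k /\ forall d', (d' <= W)%nat -> d <> d' -> k <= gap_penalty (wall_potential p) d d').
  { intros d _. destruct (finite_lower_bound (gap_penalty (wall_potential p) d) (fun d' => d <> d') W) as [k [Hk1 Hk2]]; eauto.
    intros d' _ Hne. now apply gap_penalty_pos. }
  assert (Hk2 : forall M, (M <= W)%nat -> exists k, 0 < k /\ forall d d', (d <= M)%nat -> (d' <= W)%nat -> d <> d' -> k <= gap_penalty (wall_potential p) d d').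
  { induction M as [|M IH]; intros HM.
    - destruct (Hk 0%nat HM) as [k [K1 K2]]. exists k. split; auto. intros d d' Hd. replace d with 0%nat by lia. auto.
    - destruct IH as [k [K1 K2]]; [lia|]. destruct (Hk (S M) HM) as [k' [K1' K2']].
      exists (Rmin k k'). split; [apply Rmin_pos; auto|]. intros d d' Hd Hd' Hne.
      destruct (Nat.eq_dec d (S M)) as [->|].
      + apply Rle_trans with k'; [apply Rmin_r|auto].
      + apply Rle_trans with k; [apply Rmin_l|apply K2; auto; lia]. }
  destruct (Hk2 W ltac:(lia)) as [kappa [Hka1 Hka2]].
  (* D + 1 lies between 3 tau / |estar| and 3 tau / |estar| + 1: large enough for the density of
     long runs, small enough for the corners to pay. *)
  assert (Hq : exists D, 3 * tau <= - estar * INR (S D) /\ INR (S D) <= 3 * tau / (- estar) + 1).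
  { destruct (nat_above (3 * tau / (- estar))) as [n Hn].
    assert (0 < 3 * tau / (- estar)) by (apply Rdiv_lt_0_compat; lra).
    assert (Hfl : exists D, 3 * tau / (- estar) <= INR (S D) /\ INR D <= 3 * tau / (- estar)).
    { clear -Hn H. induction n as [|n IH]; [simpl in Hn; lra|].
      destruct (Rlt_le_dec (3 * tau / (- estar)) (INR n)) as [H1|H1]; auto. exists n. split; lra. }
    destruct Hfl as [D [HD1 HD2]]. exists D. split.
    - apply (Rmult_le_compat_r (- estar)) in HD1; [|lra]. replace (3 * tau / - estar * - estar) with (3 * tau) in HD1 by (field; lra). lra.
    - rewrite S_INR. lra. }
  destruct Hq as [D [HD1 HD2]].
  (* The cap -estar/3 yields 3 eta <= -estar; widths beyond W have density above estar/2 and clear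
     the gap as well. *)
  exists hs, estar, (Rmin eta0 (- estar / 3)), kappa, D, W.
  repeat split; auto.
  - lia.
  - apply Rmin_pos; lra.
  - intros d Hd Hn. assert (Hlt : estar < density p J d).
    { destruct (Hmin d Hd) as [H|H]; auto. exfalso; apply Hn; auto. }
    destruct (Nat.le_gt_cases d W) as [H|H].
    + assert (X := Heta2 d H (conj Hd Hlt)). simpl in X. assert (Y := Rmin_l eta0 (- estar / 3)). lra.
    + assert (X : estar / 2 < density p J d).
      { apply Hfar; auto; [lra|]. apply Rlt_trans with (1 := HW). apply lt_INR; lia. }
      assert (Y := Rmin_r eta0 (- estar / 3)). lra.
  - assert (Y := Rmin_r eta0 (- estar / 3)). lra.
  (* Half of c0 covers 24 tau^2 / |estar|; the other half covers the rounding of D, since 8 tau <=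
     c0/2. *)
  - assert (X : 8 * tau * (3 * tau / (- estar)) <= c0 / 2).
    { replace (8 * tau * (3 * tau / - estar)) with (24 * tau ^ 2 / (- estar)) by (field; lra).
      apply Rdiv_le; [lra|].
      assert (48 * tau ^ 2 / c0 <= - estar) by lra.
      apply (Rmult_le_compat_l (c0 / 2)) in H; [|lra].
      replace (c0 / 2 * (48 * tau ^ 2 / c0)) with (24 * tau ^ 2) in H by (field; lra). exact H. }
    assert (8 * tau * INR (S D) <= 8 * tau * (3 * tau / (- estar) + 1)) by (apply Rmult_le_compat_l; lra). lra.
Qed.

End Constants.

(** * Defects *)

(* The run (t, b] of the bi-infinite sequence f. *)
Definition zrun (f : Z -> bool) (t b : Z) : Prop :=
  (t < b)%Z /\ f t <> f (t + 1)%Z /\ f b <> f (b + 1)%Z /\ forall k, (t < k < b)%Z -> f k = f (k + 1)%Z.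

Definition in_opt_zrun (opt : nat -> Prop) (f : Z -> bool) (i : Z) : Prop :=
  exists t b, zrun f t b /\ (t < i <= b)%Z /\ opt (Z.to_nat (b - t)).

Definition zmismatch (opt : nat -> Prop) (f : Z -> bool) (i : Z) : Prop :=
  exists r b, zrun f r i /\ zrun f i b /\ opt (Z.to_nat (i - r)) /\ opt (Z.to_nat (b - i)) /\ (i - r <> b - i)%Z.

Definition hline (s : config) (x2 : Z) : Z -> bool := fun k => s (k, x2).
Definition vline (s : config) (x1 : Z) : Z -> bool := fun k => s (x1, k).

Definition corner_site (s : config) (x1 x2 : Z) : Prop :=
  (s ((x1 + 1)%Z, x2) <> s (x1, x2) \/ s ((x1 - 1)%Z, x2) <> s (x1, x2)) /\
  (s (x1, (x2 + 1)%Z) <> s (x1, x2) \/ s (x1, (x2 - 1)%Z) <> s (x1, x2)).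

Definition defect (opt : nat -> Prop) (s : config) (x1 x2 : Z) : Prop :=
  corner_site s x1 x2 \/
  (~ in_opt_zrun opt (hline s x2) x1 /\ ~ in_opt_zrun opt (vline s x1) x2) \/
  zmismatch opt (hline s x2) x1 \/ zmismatch opt (vline s x1) x2.

Lemma neq_xorb (a b : bool) : a <> b <-> xorb a b = true.
Proof. destruct a, b; simpl; split; intros; congruence. Qed.

Lemma zrun_consec f A L t s : consec (breaks (fun i => f (Z.of_nat i - Z.of_nat A)%Z) L) t s ->
  zrun f (Z.of_nat t - Z.of_nat A) (Z.of_nat s - Z.of_nat A).
Proof.
  intros H. apply consec_breaks in H. destruct H as (H1 & H2 & H3 & H4 & H5).
  apply neq_xorb in H3, H4.
  replace (Z.of_nat (S t) - Z.of_nat A)%Z with (Z.of_nat t - Z.of_nat A + 1)%Z in H3 by lia.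
  replace (Z.of_nat (S s) - Z.of_nat A)%Z with (Z.of_nat s - Z.of_nat A + 1)%Z in H4 by lia.
  repeat split; auto; [lia|]. intros k Hk. specialize (H5 (Z.to_nat (k + Z.of_nat A)) ltac:(lia)).
  replace (Z.of_nat (Z.to_nat (k + Z.of_nat A)) - Z.of_nat A)%Z with k in H5 by lia.
  replace (Z.of_nat (S (Z.to_nat (k + Z.of_nat A))) - Z.of_nat A)%Z with (k + 1)%Z in H5 by lia. exact H5.
Qed.

Lemma consec_zrun f A L t b : zrun f t b -> (- Z.of_nat A <= t)%Z -> (b + 1 + Z.of_nat A < Z.of_nat L)%Z ->
  consec (breaks (fun i => f (Z.of_nat i - Z.of_nat A)%Z) L) (Z.to_nat (t + Z.of_nat A)) (Z.to_nat (b + Z.of_nat A)).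
Proof.
  intros (H1 & H2 & H3 & H4) Ht Hb. apply consec_breaks. repeat split; try lia.
  - apply neq_xorb. replace (Z.of_nat (Z.to_nat (t + Z.of_nat A)) - Z.of_nat A)%Z with t by lia.
    replace (Z.of_nat (S (Z.to_nat (t + Z.of_nat A))) - Z.of_nat A)%Z with (t + 1)%Z by lia. exact H2.
  - apply neq_xorb. replace (Z.of_nat (Z.to_nat (b + Z.of_nat A)) - Z.of_nat A)%Z with b by lia.
    replace (Z.of_nat (S (Z.to_nat (b + Z.of_nat A))) - Z.of_nat A)%Z with (b + 1)%Z by lia. exact H3.
  - intros k Hk. specialize (H4 (Z.of_nat k - Z.of_nat A)%Z ltac:(lia)).
    replace (Z.of_nat (S k) - Z.of_nat A)%Z with (Z.of_nat k - Z.of_nat A + 1)%Z by lia. exact H4.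
Qed.

Lemma in_opt_run_zrun opt f A L i : in_opt_run opt (fun i => f (Z.of_nat i - Z.of_nat A)%Z) L i ->
  in_opt_zrun opt f (Z.of_nat i - Z.of_nat A).
Proof.
  intros (t & s & H1 & H2 & H3). exists (Z.of_nat t - Z.of_nat A)%Z, (Z.of_nat s - Z.of_nat A)%Z.
  split; [now apply zrun_consec in H1|]. split; [lia|].
  replace (Z.to_nat (Z.of_nat s - Z.of_nat A - (Z.of_nat t - Z.of_nat A))) with (s - t)%nat by lia. exact H3.
Qed.

Lemma zmismatch_window opt W f A x : (forall d, opt d -> (1 <= d <= W)%nat) -> zmismatch opt f x ->
  (Z.abs x + Z.of_nat W + 2 <= Z.of_nat A)%Z ->
  mismatch opt (fun i => f (Z.of_nat i - Z.of_nat A)%Z) (2 * A) (Z.to_nat (x + Z.of_nat A)).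
Proof.
  intros HW (r & b & H1 & H2 & H3 & H4 & H5) Hx.
  assert (B1 := HW _ H3). assert (B2 := HW _ H4).
  assert (R1 := proj1 H1). assert (R2 := proj1 H2).
  exists (Z.to_nat (r + Z.of_nat A)), (Z.to_nat (b + Z.of_nat A)).
  split; [apply consec_zrun; auto; lia|]. split; [apply consec_zrun; auto; lia|].
  replace (Z.to_nat (x + Z.of_nat A) - Z.to_nat (r + Z.of_nat A))%nat with (Z.to_nat (x - r)) by lia.
  replace (Z.to_nat (b + Z.of_nat A) - Z.to_nat (x + Z.of_nat A))%nat with (Z.to_nat (b - x)) by lia.
  repeat split; auto. lia.
Qed.

Lemma side_diff_window f A x : (Z.abs x + 2 <= Z.of_nat A)%Z -> (f (x + 1)%Z <> f x \/ f (x - 1)%Z <> f x) ->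
  side_diff (fun i => f (Z.of_nat i - Z.of_nat A)%Z) (2 * A) (Z.to_nat (x + Z.of_nat A)) = true.
Proof.
  intros Hx H. set (i := Z.to_nat (x + Z.of_nat A)). destruct H as [H|H].
  - apply side_diff_right; [unfold i; lia|]. apply neq_xorb.
    replace (Z.of_nat (S i) - Z.of_nat A)%Z with (x + 1)%Z by lia. replace (Z.of_nat i - Z.of_nat A)%Z with x by lia. auto.
  - replace i with (S (i - 1)) by lia. apply side_diff_left. apply neq_xorb.
    replace (Z.of_nat (S (i - 1)) - Z.of_nat A)%Z with x by lia. replace (Z.of_nat (i - 1) - Z.of_nat A)%Z with (x - 1)%Z by lia. auto.
Qed.

Definition defect_weight (opt : nat -> Prop) (c : nat -> nat -> bool) (L i j : nat) : R :=
  ind (corner_at c L i j) + ind (asb (nonopt_at opt c L i j))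
  + (ind (asb (mismatch opt (row c j) L i)) + ind (asb (mismatch opt (row (transpose c) i) L j))).

Lemma defect_weight_nonneg opt c L i j : 0 <= defect_weight opt c L i j.
Proof. unfold defect_weight. repeat apply Rplus_le_le_0_compat; apply ind_nonneg. Qed.

(** The margin W + 2 keeps both runs of a mismatch and the neighbours of a corner inside the window.
    A run of the window is a run of the plane, so a site outside the optimal runs of the plane is
    outside those of the window. *)
Lemma defect_weight_ge opt W s A x1 x2 : (forall d, opt d -> (1 <= d <= W)%nat) -> defect opt s x1 x2 ->
  (Z.abs x1 + Z.of_nat W + 2 <= Z.of_nat A)%Z -> (Z.abs x2 + Z.of_nat W + 2 <= Z.of_nat A)%Z ->
  1 <= defect_weight opt (cfg s A) (2 * A) (Z.to_nat (x1 + Z.of_nat A)) (Z.to_nat (x2 + Z.of_nat A)).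
Proof.
  intros HW Hdef H1 H2. set (i := Z.to_nat (x1 + Z.of_nat A)). set (j := Z.to_nat (x2 + Z.of_nat A)).
  assert (Ei : (Z.of_nat i - Z.of_nat A)%Z = x1) by lia. assert (Ej : (Z.of_nat j - Z.of_nat A)%Z = x2) by lia.
  unfold defect_weight.
  assert (N1 := ind_nonneg (corner_at (cfg s A) (2 * A) i j)).
  assert (N2 := ind_nonneg (asb (nonopt_at opt (cfg s A) (2 * A) i j))).
  assert (N3 := ind_nonneg (asb (mismatch opt (row (cfg s A) j) (2 * A) i))).
  assert (N4 := ind_nonneg (asb (mismatch opt (row (transpose (cfg s A)) i) (2 * A) j))).
  assert (Hrow : row (cfg s A) j = (fun k => hline s x2 (Z.of_nat k - Z.of_nat A)%Z)) by (unfold row, cfg, hline; now rewrite Ej).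
  assert (Hcol : row (transpose (cfg s A)) i = (fun k => vline s x1 (Z.of_nat k - Z.of_nat A)%Z)) by (unfold row, transpose, cfg, vline; now rewrite Ei).
  destruct Hdef as [[Hc1 Hc2]|[[Hn1 Hn2]|[Hm|Hm]]].
  - assert (E : corner_at (cfg s A) (2 * A) i j = true).
    { unfold corner_at. change (fun a => cfg s A a j) with (row (cfg s A) j). change (fun b => cfg s A i b) with (row (transpose (cfg s A)) i).
      rewrite Hrow, Hcol. unfold i at 2, j at 2.
      rewrite (side_diff_window (hline s x2) A x1), (side_diff_window (vline s x1) A x2); auto; try lia.
      destruct (Nat.ltb_spec i (2 * A)); destruct (Nat.ltb_spec j (2 * A)); auto; lia. }
    rewrite E. simpl (ind true). lra.
  - assert (E : asb (nonopt_at opt (cfg s A) (2 * A) i j) = true).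
    { apply asb_true. unfold nonopt_at. rewrite Hrow, Hcol. split; intros H; apply in_opt_run_zrun in H; rewrite ?Ei, ?Ej in H; contradiction. }
    rewrite E. simpl (ind true). lra.
  - assert (E : asb (mismatch opt (row (cfg s A) j) (2 * A) i) = true).
    { apply asb_true. rewrite Hrow. apply (zmismatch_window opt W); auto. }
    rewrite E. simpl (ind true). lra.
  - assert (E : asb (mismatch opt (row (transpose (cfg s A)) i) (2 * A) j) = true).
    { apply asb_true. rewrite Hcol. apply (zmismatch_window opt W); auto. }
    rewrite E. simpl (ind true). lra.
Qed.

Lemma defects_le_weight opt W s A (l : list site) : (forall d, opt d -> (1 <= d <= W)%nat) -> NoDup l ->
  (forall x, In x l -> defect opt s (fst x) (snd x) /\
     (Z.abs (fst x) + Z.of_nat W + 2 <= Z.of_nat A)%Z /\ (Z.abs (snd x) + Z.of_nat W + 2 <= Z.of_nat A)%Z) ->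
  INR (length l) <= Sg (2 * A) (fun i => Sg (2 * A) (fun j => defect_weight opt (cfg s A) (2 * A) i j)).
Proof.
  intros HW Hl H.
  set (G := fun x : site => defect_weight opt (cfg s A) (2 * A) (Z.to_nat (fst x + Z.of_nat A)) (Z.to_nat (snd x + Z.of_nat A))).
  assert (E : Sg (2 * A) (fun i => Sg (2 * A) (fun j => defect_weight opt (cfg s A) (2 * A) i j)) = lsum G (square A)).
  { rewrite lsum_square. apply Sg_ext; intros i _. apply Sg_ext; intros j _. unfold G. simpl fst; simpl snd. f_equal; lia. }
  rewrite E. apply Rle_trans with (lsum G l).
  - rewrite <- (Rmult_1_r (INR (length l))), <- lsum_const. apply lsum_le_in. intros x Hx. destruct (H x Hx) as (H1 & H2 & H3).
    apply (defect_weight_ge opt W); auto.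
  - apply lsum_incl; auto.
    + intros x Hx. destruct (H x Hx) as (H1 & H2 & H3). apply memb_In. rewrite memb_square. apply in_square_iff. lia.
    + intros; apply defect_weight_nonneg.
Qed.

Section Counting.
Context (p : R) (hp : 4 < p).

(** The volume terms estar L^2 of the lower bound and of the trial stripes cancel. The O(L) boundary
    terms divided by the smallest defect energy [w] give C, the same for all ground states and
    squares. *)
Lemma defect_weight_bound J hs eta kappa D : 0 < J -> J <= jc p -> (1 <= hs)%nat ->
  let estar := density p J hs in
  let opt := fun d => (1 <= d)%nat /\ density p J d = estar in
  estar < 0 -> (forall d, (1 <= d)%nat -> estar <= density p J d) -> 0 < eta -> 0 < kappa ->
  (forall d, (1 <= d)%nat -> ~ opt d -> estar + eta <= density p J d) ->
  3 * eta <= - estar -> 3 * (jc p - J) <= - estar * INR (S D) -> 8 * (jc p - J) * INR (S D) <= KK p 1 1 ->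
  (forall d d', opt d -> opt d' -> d <> d' -> kappa <= gap_penalty (wall_potential p) d d') ->
  exists C, 0 < C /\ forall s M, ground_state J p s ->
    Sg (2 * (M * hs)) (fun i => Sg (2 * (M * hs)) (fun j => defect_weight opt (cfg s (M * hs)) (2 * (M * hs)) i j))
    <= C * INR (2 * (M * hs)).
Proof.
  intros HJ HJc Hhs estar opt He Hmin Heta Hkap Hgap H3 HD1 HD2 Hpen.
  assert (Hc0 : 0 < KK p 1 1) by apply KK_pos.
  set (w := Rmin (Rmin eta (KK p 1 1 / 2)) kappa).
  assert (Hw : 0 < w) by (unfold w; repeat apply Rmin_pos; lra).
  assert (Hw1 : w <= eta) by (unfold w; eapply Rle_trans; [apply Rmin_l|apply Rmin_l]).
  assert (Hw2 : w <= KK p 1 1 / 2) by (unfold w; eapply Rle_trans; [apply Rmin_l|apply Rmin_r]).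
  assert (Hw3 : w <= kappa) by (unfold w; apply Rmin_r).
  exists ((4 * J + 7 * jc p + 2 * (jc p - J)) / w).
  split; [apply Rdiv_lt_0_compat; lra|]. intros s M Hs.
  set (L := (2 * (M * hs))%nat). set (c := cfg s (M * hs)).
  assert (E1 := ground_state_energy_le p hp J s hs M HJ Hs Hhs). fold L c estar in E1.
  assert (E2 := plane_energy_ge p hp J HJc estar eta kappa D He Hmin (Rlt_le _ _ Heta) Hgap H3 HD1 HD2 (Rlt_le _ _ Hkap) Hpen c L).
  fold opt in E2. fold (wall_length c L) in E2. fold (half_energy p J c L) in E2.
  set (N1 := corner_count c L) in *. set (N2 := Sg L (fun i => Sg L (fun j => ind (asb (nonopt_at opt c L i j))))) in *.
  set (N3 := total_mismatch opt c L) in *. set (N4 := total_mismatch opt (transpose c) L) in *.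
  assert (Hnn : forall f : nat -> nat -> R, (forall i j, 0 <= f i j) -> 0 <= Sg L (fun i => Sg L (fun j => f i j))).
  { intros f Hf. apply Sg_nonneg; intros; apply Sg_nonneg; intros; auto. }
  assert (P1 : 0 <= N1) by (apply Hnn; intros; apply ind_nonneg).
  assert (P2 : 0 <= N2) by (apply Hnn; intros; apply ind_nonneg).
  assert (P3 : 0 <= N3) by (apply Hnn; intros; apply ind_nonneg).
  assert (P4 : 0 <= N4) by (apply Hnn; intros; apply ind_nonneg).
  assert (ES : Sg L (fun i => Sg L (fun j => defect_weight opt c L i j)) = N1 + N2 + (N3 + N4)).
  { unfold defect_weight, N1, N2, N3, N4, corner_count, total_mismatch.
    rewrite (Sg_swap L L (fun j i => ind (asb (mismatch opt (row c j) L i)))).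
    rewrite <- !Sg_plus. apply Sg_ext; intros i _. rewrite <- !Sg_plus. reflexivity. }
  rewrite ES.
  assert (HL : 0 <= INR L) by apply pos_INR.
  assert (F : w * (N1 + N2 + (N3 + N4)) <= (4 * J + 7 * jc p + 2 * (jc p - J)) * INR L).
  { assert (w * N1 <= KK p 1 1 / 2 * N1) by (apply Rmult_le_compat_r; auto).
    assert (w * N2 <= eta * N2) by (apply Rmult_le_compat_r; auto).
    assert (w * (N3 + N4) <= kappa * (N3 + N4)) by (apply Rmult_le_compat_r; lra). lra. }
  apply Rmult_le_reg_l with w; auto.
  replace (w * ((4 * J + 7 * jc p + 2 * (jc p - J)) / w * INR L)) with ((4 * J + 7 * jc p + 2 * (jc p - J)) * INR L) by (field; lra).
  exact F.
Qed.

End Counting.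

(** * Translation invariance and the strip containing the defects *)

Lemma zrun_shift f g v t b : (forall k, g k = f (k + v)%Z) -> zrun g t b <-> zrun f (t + v) (b + v).
Proof.
  intros H. unfold zrun. rewrite !H.
  replace (t + v + 1)%Z with (t + 1 + v)%Z by ring. replace (b + v + 1)%Z with (b + 1 + v)%Z by ring.
  split; intros (H1 & H2 & H3 & H4); repeat split; auto; try lia.
  - intros k Hk. specialize (H4 (k - v)%Z ltac:(lia)). rewrite !H in H4.
    replace (k - v + v)%Z with k in H4 by ring. replace (k - v + 1 + v)%Z with (k + 1)%Z in H4 by ring. exact H4.
  - intros k Hk. rewrite !H. specialize (H4 (k + v)%Z ltac:(lia)). now replace (k + 1 + v)%Z with (k + v + 1)%Z by ring.
Qed.

Lemma in_opt_zrun_shift opt f g v i : (forall k, g k = f (k + v)%Z) -> in_opt_zrun opt g i <-> in_opt_zrun opt f (i + v).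
Proof.
  intros H. split.
  - intros (t & b & H1 & H2 & H3). exists (t + v)%Z, (b + v)%Z. split; [now apply (zrun_shift f g)|]. split; [lia|].
    now replace (b + v - (t + v))%Z with (b - t)%Z by ring.
  - intros (t & b & H1 & H2 & H3). exists (t - v)%Z, (b - v)%Z. split; [|split; [lia|]].
    + apply (zrun_shift f g v); auto. now replace (t - v + v)%Z with t by ring; replace (b - v + v)%Z with b by ring.
    + now replace (b - v - (t - v))%Z with (b - t)%Z by ring.
Qed.

Lemma zmismatch_shift opt f g v i : (forall k, g k = f (k + v)%Z) -> zmismatch opt g i -> zmismatch opt f (i + v).
Proof.
  intros H (r & b & H1 & H2 & H3 & H4 & H5). exists (r + v)%Z, (b + v)%Z.
  split; [now apply (zrun_shift f g)|]. split; [now apply (zrun_shift f g)|].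
  replace (i + v - (r + v))%Z with (i - r)%Z by ring. replace (b + v - (i + v))%Z with (b - i)%Z by ring. auto.
Qed.

Lemma defect_shift opt s v1 v2 x1 x2 : (forall y1 y2, s ((y1 + v1)%Z, (y2 + v2)%Z) = s (y1, y2)) ->
  defect opt s x1 x2 -> defect opt s (x1 + v1) (x2 + v2).
Proof.
  intros H.
  assert (Hh : forall k, hline s x2 k = hline s (x2 + v2) (k + v1)%Z) by (intros; unfold hline; now rewrite H).
  assert (Hv : forall k, vline s x1 k = vline s (x1 + v1) (k + v2)%Z) by (intros; unfold vline; now rewrite H).
  intros [Hc|[[Hn1 Hn2]|[Hm|Hm]]].
  - left. unfold corner_site in *.
    replace (x1 + v1 + 1)%Z with (x1 + 1 + v1)%Z by ring. replace (x1 + v1 - 1)%Z with (x1 - 1 + v1)%Z by ring.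
    replace (x2 + v2 + 1)%Z with (x2 + 1 + v2)%Z by ring. replace (x2 + v2 - 1)%Z with (x2 - 1 + v2)%Z by ring.
    now rewrite !H.
  - right; left. split.
    + intros X. apply Hn1. now apply (in_opt_zrun_shift opt _ _ _ _ Hh).
    + intros X. apply Hn2. now apply (in_opt_zrun_shift opt _ _ _ _ Hv).
  - right; right; left. now apply (zmismatch_shift opt _ _ _ _ Hh).
  - right; right; right. now apply (zmismatch_shift opt _ _ _ _ Hv).
Qed.

Lemma translation_iter s n k : translation_invariant s n -> forall y1 y2,
  s ((y1 + Z.of_nat k * fst n)%Z, (y2 + Z.of_nat k * snd n)%Z) = s (y1, y2).
Proof.
  intros Hn. induction k as [|k IH]; intros y1 y2.
  - f_equal. f_equal; lia.
  - rewrite <- (IH y1 y2), <- (Hn ((y1 + Z.of_nat k * fst n)%Z, (y2 + Z.of_nat k * snd n)%Z)).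
    cbn [fst snd]. f_equal. f_equal; lia.
Qed.

Lemma NoDup_map_on {T U} (f : T -> U) (l : list T) : NoDup l ->
  (forall x y, In x l -> In y l -> f x = f y -> x = y) -> NoDup (map f l).
Proof. intros H1 H2. now apply NoDup_map_NoDup_ForallPairs. Qed.

(* A linear bound on the number of defects in squares leaves room for finitely many n-orbits only. *)
Lemma defects_in_strip opt W s n C hs : (forall d, opt d -> (1 <= d <= W)%nat) -> (1 <= hs)%nat ->
  translation_invariant s n -> n <> (0%Z, 0%Z) -> 0 < C ->
  (forall M, Sg (2 * (M * hs)) (fun i => Sg (2 * (M * hs)) (fun j => defect_weight opt (cfg s (M * hs)) (2 * (M * hs)) i j))
    <= C * INR (2 * (M * hs))) ->
  exists K, (1 <= K)%Z /\ forall x, defect opt s (fst x) (snd x) -> (Z.abs (dot_perp x n) <= K)%Z.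
Proof.
  intros HW Hhs Hinv Hn0 HC Hbound. apply NNPP. intros Hno.
  assert (Hfar : forall K, (1 <= K)%Z -> exists x, defect opt s (fst x) (snd x) /\ (K < Z.abs (dot_perp x n))%Z).
  { intros K HK. apply NNPP. intros H. apply Hno. exists K. split; auto. intros x Hx.
    apply Z.nlt_ge. intros Hlt. apply H. eauto. }
  (* [dot_perp] is constant along n, so distinct values put the defects of the list on distinct
     n-orbits. *)
  assert (Hlist : forall k, exists l : list site, length l = k /\ NoDup (map (fun x => dot_perp x n) l) /\
     forall x, In x l -> defect opt s (fst x) (snd x)).
  { induction k as [|k (l & H1 & H2 & H3)]; [exists []; repeat split; [constructor|intros x []]|].
    destruct (Hfar (1 + fold_right Z.max 0 (map (fun x => Z.abs (dot_perp x n)) l))%Z) as [x [Hx1 Hx2]].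
    { clear. induction l as [|a l IH]; cbn [map fold_right]; lia. }
    exists (x :: l). split; [simpl; lia|]. split.
    - simpl. constructor; auto. intros Hin. apply in_map_iff in Hin. destruct Hin as [y [Ey Hy]].
      assert (Z.abs (dot_perp y n) <= fold_right Z.max 0 (map (fun x => Z.abs (dot_perp x n)) l))%Z.
      { clear -Hy. induction l as [|a l IH]; [destruct Hy|]. cbn [map fold_right]. destruct Hy as [->|Hy]; [lia|]. specialize (IH Hy). lia. }
      rewrite Ey in H. lia.
    - intros y [->|Hy]; auto. }
  set (N1 := Z.to_nat (Z.abs (fst n) + Z.abs (snd n))).
  (* k and T are chosen so that k T exceeds 2 C (B0 + T N1) hs: k beats the part proportional to T,
     then T beats the part coming from B0. *)
  destruct (nat_above (2 * C * INR (N1 * hs) + 1)) as [k Hk].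
  destruct (Hlist k) as (l & Hl1 & Hl2 & Hl3).
  set (B0 := (Z.to_nat (fold_right Z.max 0%Z (map (fun x => Z.abs (fst x) + Z.abs (snd x))%Z l)) + W + 2)%nat).
  destruct (nat_above (2 * C * INR (B0 * hs))) as [T HT].
  (* The half side A leaves room for T translates of each of the k defects and for the margin W +
     2. *)
  set (M := (B0 + T * N1)%nat). set (A := (M * hs)%nat).
  set (orb := fun xj : site * nat => ((fst (fst xj) + Z.of_nat (snd xj) * fst n)%Z, (snd (fst xj) + Z.of_nat (snd xj) * snd n)%Z) : site).
  set (l' := map orb (list_prod l (seq 0 T))).
  assert (Hlen : length l' = (k * T)%nat) by (unfold l'; rewrite length_map, length_prod, length_seq, Hl1; reflexivity).
  assert (Hdot : forall xj, dot_perp (orb xj) n = dot_perp (fst xj) n) by (intros [[a b] j]; unfold orb, dot_perp; simpl; ring).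
  assert (Hl0 : NoDup l) by (apply NoDup_map_inv in Hl2; exact Hl2).
  assert (Hnd : NoDup l').
  { apply NoDup_map_on.
    - apply NoDup_list_prod; auto using seq_NoDup.
    - intros [x j] [y j'] Hx Hy E. apply in_prod_iff in Hx, Hy.
      assert (Exy : x = y).
      { assert (D := Hdot (x, j)). rewrite E, Hdot in D. simpl in D.
        clear -D Hl2 Hx Hy. destruct Hx as [Hx _]. destruct Hy as [Hy _].
        induction l as [|a l IH]; [destruct Hx|]. simpl in Hl2. inversion Hl2 as [|? ? N1 N2]; subst.
        destruct Hx as [->|Hx]; destruct Hy as [->|Hy]; auto.
        - exfalso; apply N1. rewrite <- D. apply in_map_iff. eauto.
        - exfalso; apply N1. rewrite D. apply in_map_iff. eauto. }
      subst y. f_equal. unfold orb in E. simpl in E. injection E as E1 E2.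
      destruct n as [n1 n2]. simpl in *.
      assert (n1 <> 0 \/ n2 <> 0)%Z as [Hn|Hn].
      { destruct (Z.eq_dec n1 0); [right|now left]. intros ->. apply Hn0. congruence. }
      + assert (Z.of_nat j * n1 = Z.of_nat j' * n1)%Z by lia. apply Z.mul_cancel_r in H; auto. lia.
      + assert (Z.of_nat j * n2 = Z.of_nat j' * n2)%Z by lia. apply Z.mul_cancel_r in H; auto. lia. }
  assert (Hin : forall x, In x l' -> defect opt s (fst x) (snd x) /\
     (Z.abs (fst x) + Z.of_nat W + 2 <= Z.of_nat A)%Z /\ (Z.abs (snd x) + Z.of_nat W + 2 <= Z.of_nat A)%Z).
  { intros x Hx. unfold l' in Hx. apply in_map_iff in Hx. destruct Hx as [[y j] [<- Hyj]].
    apply in_prod_iff in Hyj. destruct Hyj as [Hy Hj]. apply in_seq in Hj. unfold orb. simpl fst; simpl snd.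
    split.
    - apply defect_shift; auto. now apply translation_iter.
    - assert (HB : (Z.abs (fst y) + Z.abs (snd y) <= fold_right Z.max 0 (map (fun x => Z.abs (fst x) + Z.abs (snd x)) l))%Z).
      { clear -Hy. induction l as [|a l IH]; [destruct Hy|]. cbn [map fold_right]. destruct Hy as [->|Hy]; [lia|]. specialize (IH Hy). lia. }
      assert (HA : (Z.of_nat B0 + Z.of_nat T * (Z.abs (fst n) + Z.abs (snd n)) <= Z.of_nat A)%Z).
      { unfold A, M, N1. nia. }
      assert (HB0 : (Z.of_nat B0 = fold_right Z.max 0 (map (fun x => Z.abs (fst x) + Z.abs (snd x)) l) + Z.of_nat W + 2)%Z).
      { unfold B0. lia. }
      assert (Z.abs (Z.of_nat j * fst n) <= Z.of_nat T * (Z.abs (fst n) + Z.abs (snd n)))%Z by (rewrite Z.abs_mul; nia).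
      assert (Z.abs (Z.of_nat j * snd n) <= Z.of_nat T * (Z.abs (fst n) + Z.abs (snd n)))%Z by (rewrite Z.abs_mul; nia).
      lia. }
  assert (F := defects_le_weight opt W s A l' HW Hnd Hin).
  assert (G := Hbound M). fold A in G. rewrite Hlen in F.
  assert (X : INR (k * T) <= C * INR (2 * A)) by lra.
  unfold A, M in X. rewrite !mult_INR, plus_INR, mult_INR in X. rewrite mult_INR in Hk, HT. simpl (INR 2) in X.
  assert (0 <= INR T) by apply pos_INR.
  assert (INR T * (2 * C * (INR N1 * INR hs) + 1) <= INR T * INR k) by (apply Rmult_le_compat_l; lra).
  nra.
Qed.

(** * Half-planes without defects *)

Lemma zrun_const f t b : zrun f t b -> forall k, (t < k <= b)%Z -> f k = f b.
Proof.
  intros (H1 & H2 & H3 & H4) k Hk.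
  assert (X : forall m : nat, (t < b - Z.of_nat m)%Z -> f (b - Z.of_nat m)%Z = f b).
  { induction m as [|m IH]; intros Hm; [f_equal; lia|].
    rewrite H4 by lia. rewrite <- IH by lia. f_equal. lia. }
  specialize (X (Z.to_nat (b - k)) ltac:(lia)). now replace (b - Z.of_nat (Z.to_nat (b - k)))%Z with k in X by lia.
Qed.

Lemma zrun_ext f g t b : zrun f t b -> (forall k, (t <= k <= b + 1)%Z -> f k = g k) -> zrun g t b.
Proof.
  intros (H1 & H2 & H3 & H4) E. unfold zrun. rewrite <- !E by lia. repeat split; auto.
  intros k Hk. rewrite <- !E by lia. auto.
Qed.

Lemma zrun_next f t b t' b' : zrun f t b -> zrun f t' b' -> (t' < b + 1 <= b')%Z -> t' = b.
Proof.
  intros (H1 & H2 & H3 & H4) (G1 & G2 & G3 & G4) H.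
  destruct (Z.eq_dec t' b); auto. exfalso. apply H3. apply G4. lia.
Qed.

Lemma zrun_prev f t b t' b' : zrun f t b -> zrun f t' b' -> (t' < t <= b')%Z -> b' = t.
Proof.
  intros (H1 & H2 & H3 & H4) (G1 & G2 & G3 & G4) H.
  destruct (Z.eq_dec b' t); auto. exfalso. apply H2. apply G4. lia.
Qed.

Lemma stZ_block d q r : (0 <= r < Z.of_nat d)%Z -> stZ d (q * Z.of_nat d + r) = Z.even q.
Proof.
  intros Hr. destruct (Z.Even_or_Odd q) as [[m ->]|[m ->]].
  - replace (2 * m * Z.of_nat d + r)%Z with (r + m * (2 * Z.of_nat d))%Z by ring.
    rewrite stZ_period. unfold stZ. rewrite Z.mod_small by lia. rewrite Z.even_mul. simpl.
    apply Z.ltb_lt. lia.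
  - replace ((2 * m + 1) * Z.of_nat d + r)%Z with (Z.of_nat d + r + m * (2 * Z.of_nat d))%Z by ring.
    rewrite stZ_period. unfold stZ. rewrite Z.mod_small by lia.
    replace (Z.even (2 * m + 1)) with false.
    + apply Z.ltb_ge. lia.
    + rewrite Z.even_add, Z.even_mul. reflexivity.
Qed.

(** In Q every site lies in an optimal run and adjacent optimal runs have equal widths, so the width
    of the run of i0 propagates both ways. Runs may stick out of Q; a block is obtained as soon as
    its site nearest to the initial run is in Q. *)
Lemma equal_runs_stripe opt f (Q : Z -> Prop) i0 : Q i0 ->
  (forall i j k, Q i -> Q k -> (i <= j <= k)%Z -> Q j) ->
  (forall i, Q i -> in_opt_zrun opt f i) -> (forall i, Q i -> ~ zmismatch opt f i) ->
  exists d c, opt d /\ forall i, Q i -> f i = stZ d (i + c).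
Proof.
  intros HQ0 Hconv Hopt Hmis.
  destruct (Hopt i0 HQ0) as (t & b & Hrun & Hi0 & Hd0).
  set (d := (b - t)%Z). set (dn := Z.to_nat d) in *.
  assert (Hd : (1 <= d)%Z) by (unfold d; lia).
  set (block := fun m : Z => zrun f (t + m * d) (t + (m + 1) * d) /\ f (t + (m + 1) * d)%Z = xorb (f b) (Z.odd m)).
  assert (B0 : block 0%Z).
  { split.
    - replace (t + 0 * d)%Z with t by ring. replace (t + (0 + 1) * d)%Z with b by (unfold d; ring). exact Hrun.
    - replace (t + (0 + 1) * d)%Z with b by (unfold d; ring). simpl. now rewrite xorb_false_r. }
  assert (Hflip : forall x y : bool, x <> y -> y = negb x) by (intros [] [] H; auto; congruence).
  assert (Hup : forall m : nat, (m = 0%nat \/ Q (t + Z.of_nat m * d + 1)%Z) -> block (Z.of_nat m)).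
  { induction m as [|m IH]; intros Hm; [exact B0|].
    destruct Hm as [Hm|Hm]; [discriminate|].
    assert (HB : block (Z.of_nat m)).
    { apply IH. destruct m as [|m]; [now left|right].
      apply (Hconv i0 _ (t + Z.of_nat (S (S m)) * d + 1)%Z); auto. unfold d in *; nia. }
    destruct HB as [HB1 HB2].
    set (e := (t + (Z.of_nat m + 1) * d)%Z) in *.
    replace (t + Z.of_nat (S m) * d + 1)%Z with (e + 1)%Z in Hm by (unfold e; lia).
    destruct (Hopt _ Hm) as (t' & b' & Hr' & Hi' & Ho').
    assert (t' = e) by (apply (zrun_next _ _ _ _ _ HB1 Hr'); lia). subst t'.
    (* A mismatch is recorded at the wall position e, which lies between i0 and e + 1. *)
    assert (He : Q e) by (apply (Hconv i0 _ (e + 1)%Z); auto; unfold e, d in *; nia).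
    assert (Eb : b' = (e + d)%Z).
    { destruct (Z.eq_dec (b' - e) d) as [E|E]; [lia|]. exfalso. apply (Hmis e He).
      exists (t + Z.of_nat m * d)%Z, b'. split; [auto|]. split; [auto|].
      replace (e - (t + Z.of_nat m * d))%Z with d by (unfold e; ring). auto. }
    unfold block. replace (t + Z.of_nat (S m) * d)%Z with e by (unfold e; lia).
    replace (t + (Z.of_nat (S m) + 1) * d)%Z with b' by (rewrite Eb; unfold e; lia).
    split; auto.
    rewrite <- (zrun_const _ _ _ Hr' (e + 1)%Z) by lia.
    rewrite (Hflip (f e) (f (e + 1)%Z)) by apply HB1. rewrite HB2.
    replace (Z.of_nat (S m)) with (Z.succ (Z.of_nat m)) by lia. rewrite Z.odd_succ, <- Z.negb_odd.
    destruct (f b), (Z.odd (Z.of_nat m)); reflexivity. }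
  assert (Hdown : forall m : nat, (m = 0%nat \/ Q (t - (Z.of_nat m - 1) * d)%Z) -> block (- Z.of_nat m)%Z).
  { induction m as [|m IH]; intros Hm; [exact B0|].
    destruct Hm as [Hm|Hm]; [discriminate|].
    assert (HB : block (- Z.of_nat m)%Z).
    { apply IH. destruct m as [|m]; [now left|right].
      apply (Hconv (t - (Z.of_nat (S (S m)) - 1) * d)%Z _ i0); auto. unfold d in *; nia. }
    destruct HB as [HB1 HB2].
    set (e := (t + - Z.of_nat m * d)%Z) in *.
    replace (t - (Z.of_nat (S m) - 1) * d)%Z with e in Hm by (unfold e; lia).
    destruct (Hopt _ Hm) as (t' & b' & Hr' & Hi' & Ho').
    assert (b' = e) by (apply (zrun_prev _ _ _ _ _ HB1 Hr'); lia). subst b'.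
    assert (Et : t' = (e - d)%Z).
    { destruct (Z.eq_dec (e - t') d) as [E|E]; [lia|]. exfalso. apply (Hmis e Hm).
      exists t', (t + (- Z.of_nat m + 1) * d)%Z. split; [auto|]. split; [auto|].
      replace (t + (- Z.of_nat m + 1) * d - e)%Z with d by (unfold e; ring). auto. }
    unfold block. replace (t + - Z.of_nat (S m) * d)%Z with t' by (rewrite Et; unfold e; lia).
    replace (t + (- Z.of_nat (S m) + 1) * d)%Z with e by (unfold e; lia).
    split; auto.
    rewrite (Hflip (f (e + 1)%Z) (f e)) by (intros X; apply (proj1 (proj2 HB1)); now rewrite X).
    rewrite (zrun_const _ _ _ HB1 (e + 1)%Z) by (unfold e; nia). rewrite HB2.
    replace (- Z.of_nat (S m))%Z with (Z.pred (- Z.of_nat m)) by lia. rewrite Z.odd_pred, <- Z.negb_odd.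
    destruct (f b), (Z.odd (- Z.of_nat m)); reflexivity. }
  (* [stZ] is true on [0, d): the phase sends the first site t + 1 of the initial run to 0 if its
     spin is true, to d otherwise. *)
  exists dn, (- (t + 1) + (if f b then 0 else d))%Z. split; [exact Hd0|].
  intros i Hi.
  set (m := ((i - (t + 1)) / d)%Z). set (r := ((i - (t + 1)) mod d)%Z).
  assert (Em := Z_div_mod_eq_full (i - (t + 1)) d). assert (Er := Z.mod_pos_bound (i - (t + 1)) d ltac:(lia)).
  fold m r in Em, Er.
  assert (HB : block m).
  { destruct (Z.le_gt_cases 0 m) as [Hm|Hm].
    - replace m with (Z.of_nat (Z.to_nat m)) by lia. apply Hup.
      destruct (Z.eq_dec m 0); [left; lia|right]. rewrite Z2Nat.id by lia.
      apply (Hconv i0 _ i); auto. unfold d in *; nia.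
    - replace m with (- Z.of_nat (Z.to_nat (- m)))%Z by lia. apply Hdown. right. rewrite Z2Nat.id by lia.
      apply (Hconv i _ i0); auto. unfold d in *; nia. }
  destruct HB as [HB1 HB2].
  rewrite (zrun_const _ _ _ HB1 i) by nia. rewrite HB2.
  assert (Edn : Z.of_nat dn = d) by (unfold dn; lia).
  destruct (f b).
  - replace (i + (- (t + 1) + 0))%Z with (m * Z.of_nat dn + r)%Z by (rewrite Edn; lia).
    rewrite stZ_block by lia. now rewrite <- Z.negb_odd.
  - replace (i + (- (t + 1) + d))%Z with ((m + 1) * Z.of_nat dn + r)%Z by (rewrite Edn; lia).
    rewrite stZ_block by lia. rewrite Z.add_1_r, Z.even_succ. simpl. reflexivity.
Qed.

Section HalfPlane.
Context (opt : nat -> Prop) (W : nat) (HW : forall d, opt d -> (1 <= d <= W)%nat).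

(** A site beside a wall that is not a corner agrees with both its neighbours along the wall. *)
Lemma wall_continues s i j : ~ corner_site s i j -> ~ corner_site s (i + 1) j -> s (i, j) <> s ((i + 1)%Z, j) ->
  s (i, (j + 1)%Z) <> s ((i + 1)%Z, (j + 1)%Z) /\ s (i, (j - 1)%Z) <> s ((i + 1)%Z, (j - 1)%Z).
Proof.
  intros H1 H2 Hne.
  assert (E1 : s (i, (j + 1)%Z) = s (i, j) /\ s (i, (j - 1)%Z) = s (i, j)).
  { split; apply NNPP; intros X; apply H1; (split; [left; intros Q; apply Hne; now rewrite Q|auto]). }
  assert (E2 : s ((i + 1)%Z, (j + 1)%Z) = s ((i + 1)%Z, j) /\ s ((i + 1)%Z, (j - 1)%Z) = s ((i + 1)%Z, j)).
  { split; apply NNPP; intros X; apply H2; (split; [right; replace (i + 1 - 1)%Z with i by ring; exact Hne|auto]). }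
  destruct E1 as [-> ->]. destruct E2 as [-> ->]. auto.
Qed.

Lemma wall_extends s (P : Z -> Prop) i j j' : (forall x y z, P x -> P z -> (x <= y <= z)%Z -> P y) ->
  (forall y, P y -> ~ corner_site s i y /\ ~ corner_site s (i + 1) y) -> P j -> P j' ->
  s (i, j) <> s ((i + 1)%Z, j) -> s (i, j') <> s ((i + 1)%Z, j').
Proof.
  intros Hc HP Hj Hj' Hne.
  assert (Up : forall m : nat, P (j + Z.of_nat m)%Z -> s (i, (j + Z.of_nat m)%Z) <> s ((i + 1)%Z, (j + Z.of_nat m)%Z)).
  { induction m as [|m IH]; intros Hm; [now rewrite Z.add_0_r|].
    assert (Pm : P (j + Z.of_nat m)%Z) by (apply (Hc j _ (j + Z.of_nat (S m))%Z); auto; lia).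
    destruct (HP _ Pm) as [C1 C2]. destruct (wall_continues s i _ C1 C2 (IH Pm)) as [X _].
    now replace (j + Z.of_nat (S m))%Z with (j + Z.of_nat m + 1)%Z by lia. }
  assert (Dn : forall m : nat, P (j - Z.of_nat m)%Z -> s (i, (j - Z.of_nat m)%Z) <> s ((i + 1)%Z, (j - Z.of_nat m)%Z)).
  { induction m as [|m IH]; intros Hm; [now rewrite Z.sub_0_r|].
    assert (Pm : P (j - Z.of_nat m)%Z) by (apply (Hc (j - Z.of_nat (S m))%Z _ j); auto; lia).
    destruct (HP _ Pm) as [C1 C2]. destruct (wall_continues s i _ C1 C2 (IH Pm)) as [_ X].
    now replace (j - Z.of_nat (S m))%Z with (j - Z.of_nat m - 1)%Z by lia. }
  destruct (Z.le_gt_cases j j') as [H|H].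
  - specialize (Up (Z.to_nat (j' - j))). replace (j + Z.of_nat (Z.to_nat (j' - j)))%Z with j' in Up by lia. auto.
  - specialize (Dn (Z.to_nat (j - j'))). replace (j - Z.of_nat (Z.to_nat (j - j')))%Z with j' in Dn by lia. auto.
Qed.

Definition swap_config (s : config) : config := fun x => s (snd x, fst x).

Lemma corner_swap s x1 x2 : corner_site (swap_config s) x1 x2 <-> corner_site s x2 x1.
Proof. unfold corner_site, swap_config. simpl. tauto. Qed.

Lemma defect_swap s x1 x2 : defect opt (swap_config s) x1 x2 -> defect opt s x2 x1.
Proof.
  unfold defect. intros [H|[[H1 H2]|[H|H]]].
  - left. now apply corner_swap.
  - right; left. split; auto.
  - right; right; right. exact H.
  - right; right; left. exact H.
Qed.

Lemma iter_shift_Z (s : config) v1 v2 : (forall x1 x2, s ((x1 + v1)%Z, (x2 + v2)%Z) = s (x1, x2)) ->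
  forall m x1 x2, s ((x1 + m * v1)%Z, (x2 + m * v2)%Z) = s (x1, x2).
Proof.
  intros H.
  assert (Hn : forall (m : nat) x1 x2, s ((x1 + Z.of_nat m * v1)%Z, (x2 + Z.of_nat m * v2)%Z) = s (x1, x2)).
  { induction m as [|m IH]; intros x1 x2; [f_equal; f_equal; lia|].
    rewrite <- (IH x1 x2), <- (H (x1 + Z.of_nat m * v1)%Z (x2 + Z.of_nat m * v2)%Z). f_equal. f_equal; lia. }
  intros m x1 x2. destruct (Z.le_gt_cases 0 m) as [Hm|Hm].
  - rewrite <- (Hn (Z.to_nat m) x1 x2). now rewrite Z2Nat.id by lia.
  - rewrite <- (Hn (Z.to_nat (- m)) (x1 + m * v1)%Z (x2 + m * v2)%Z). f_equal. rewrite Z2Nat.id by lia. f_equal; ring.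
Qed.

(* Translating the second wall along n makes the two walls cross inside the half-plane when both are oblique to n. *)
Lemma walls_parallel s a b kap :
  (forall x1 x2, (a * x1 + b * x2 < kap)%Z -> ~ corner_site s x1 x2) ->
  (forall x1 x2, s ((x1 + b)%Z, (x2 - a)%Z) = s (x1, x2)) ->
  forall i j i' j',
  (a * i + b * j < kap)%Z -> (a * (i + 1) + b * j < kap)%Z ->
  (a * i' + b * j' < kap)%Z -> (a * i' + b * (j' + 1) < kap)%Z ->
  s (i, j) <> s ((i + 1)%Z, j) -> s (i', j') <> s (i', (j' + 1)%Z) -> False.
Proof.
  intros Hnc Hinv i j i' j' H1 H2 H3 H4 Hh Hv.
  assert (Hinv' := iter_shift_Z s b (- a) Hinv).
  assert (Hm : exists m, (a * i + b * (j' - m * a) < kap /\ a * (i + 1) + b * (j' - m * a) < kap /\ a * i + b * (j' + 1 - m * a) < kap)%Z).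
  { destruct (Z.eq_dec (a * b) 0) as [E|E].
    - exists 0%Z. apply Z.eq_mul_0 in E. destruct E as [->| ->]; lia.
    - set (big := (Z.abs (a * i) + Z.abs (b * j') + Z.abs a + Z.abs b + Z.abs kap + 1)%Z).
      exists (Z.sgn (a * b) * big)%Z.
      assert (Hs : (b * (Z.sgn (a * b) * big * a) = Z.abs (a * b) * big)%Z).
      { rewrite <- Z.sgn_abs. ring. }
      assert (Hab : (1 <= Z.abs (a * b))%Z) by lia.
      assert (Hbig : (0 <= big)%Z) by (unfold big; lia).
      assert (big <= Z.abs (a * b) * big)%Z by nia.
      replace (b * (j' - Z.sgn (a * b) * big * a))%Z with (b * j' - Z.abs (a * b) * big)%Z by (rewrite <- Hs; ring).
      replace (b * (j' + 1 - Z.sgn (a * b) * big * a))%Z with (b * j' + b - Z.abs (a * b) * big)%Z by (rewrite <- Hs; ring).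
      replace (a * (i + 1))%Z with (a * i + a)%Z by ring.
      unfold big in *. lia. }
  destruct Hm as (m & M1 & M2 & M3).
  set (J := (j' - m * a)%Z) in *.
  (* A linear function on an interval is largest at an end, so walls can be followed between two
     points without leaving the half-plane. *)
  assert (Hcv : forall u v c k, (forall x y z, (u * x + c < k)%Z /\ (u * x + v < k)%Z -> (u * z + c < k)%Z /\ (u * z + v < k)%Z -> (x <= y <= z)%Z -> (u * y + c < k)%Z /\ (u * y + v < k)%Z)).
  { intros u v c k x y z [X1 X2] [Z1 Z2] Hy.
    assert (u * y <= u * z \/ u * y <= u * x)%Z by (destruct (Z.le_gt_cases 0 u); [left|right]; nia). lia. }
  assert (W1 : s (i, J) <> s ((i + 1)%Z, J)).
  { apply (wall_extends s (fun y => (b * y + a * i < kap)%Z /\ (b * y + a * (i + 1) < kap)%Z) i j J); auto; try lia.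
    - intros x y z. apply (Hcv b (a * (i + 1))%Z (a * i)%Z kap).
    - intros y [Y1 Y2]. split; apply Hnc; lia. }
  assert (W2 : s (i, J) <> s (i, (J + 1)%Z)).
  { apply (wall_extends (swap_config s) (fun x => (a * x + b * J < kap)%Z /\ (a * x + b * (J + 1) < kap)%Z) J (i' + m * b) i).
    - intros x y z. apply (Hcv a (b * (J + 1))%Z (b * J)%Z kap).
    - intros x [X1 X2]. split; intros X; apply (proj1 (corner_swap s _ _)) in X; revert X; apply Hnc; assumption.
    - unfold J. split; lia.
    - split; [lia|]. replace (J + 1)%Z with (j' + 1 - m * a)%Z by (unfold J; ring). lia.
    - unfold swap_config; simpl. unfold J.
      replace (j' - m * a)%Z with (j' + m * - a)%Z by ring.
      replace (j' + m * - a + 1)%Z with (j' + 1 + m * - a)%Z by ring.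
      rewrite !Hinv'. exact Hv. }
  (* Where the walls cross, (i, J) differs from its right and its upper neighbour. *)
  apply (Hnc i J); [lia|]. split; left; auto.
Qed.

(** With constant columns the configuration is a sequence indexed by columns. If b = 0 the
    half-plane restricts it to a half-line common to all rows; otherwise every column meets the
    half-plane, and the full sequence is compared locally with a row lying deep enough. *)
Lemma column_stripes s a b kap : (a <> 0 \/ b <> 0)%Z ->
  (forall x1 x2, (a * x1 + b * x2 < kap)%Z -> ~ defect opt s x1 x2) ->
  (forall x1 x2, (a * x1 + b * x2 < kap)%Z -> (a * x1 + b * (x2 + 1) < kap)%Z -> s (x1, x2) = s (x1, (x2 + 1)%Z)) ->
  exists d c, opt d /\ forall x1 x2, (a * x1 + b * x2 < kap)%Z -> s (x1, x2) = stZ d (x1 + c).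
Proof.
  intros Hab Hnd Hcol.
  assert (Hcol' : forall x1 x2 y2, (a * x1 + b * x2 < kap)%Z -> (a * x1 + b * y2 < kap)%Z -> s (x1, x2) = s (x1, y2)).
  { assert (Up : forall (m : nat) x1 x2, (a * x1 + b * x2 < kap)%Z -> (a * x1 + b * (x2 + Z.of_nat m) < kap)%Z -> s (x1, x2) = s (x1, (x2 + Z.of_nat m)%Z)).
    { induction m as [|m IH]; intros x1 x2 H1 H2; [f_equal; f_equal; lia|].
      assert (H3 : (a * x1 + b * (x2 + Z.of_nat m) < kap)%Z) by (destruct (Z.le_gt_cases 0 b); nia).
      rewrite IH by auto. rewrite Hcol; auto.
      - f_equal. f_equal. lia.
      - replace (x2 + Z.of_nat m + 1)%Z with (x2 + Z.of_nat (S m))%Z by lia. exact H2. }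
    intros x1 x2 y2 H1 H2. destruct (Z.le_gt_cases x2 y2) as [H|H].
    - specialize (Up (Z.to_nat (y2 - x2)) x1 x2). replace (x2 + Z.of_nat (Z.to_nat (y2 - x2)))%Z with y2 in Up by lia. auto.
    - specialize (Up (Z.to_nat (x2 - y2)) x1 y2). replace (y2 + Z.of_nat (Z.to_nat (x2 - y2)))%Z with x2 in Up by lia. symmetry; auto. }
  assert (Hrow : forall x1 x2, (a * x1 + b * x2 < kap)%Z -> in_opt_zrun opt (hline s x2) x1 /\ ~ zmismatch opt (hline s x2) x1).
  { intros x1 x2 H. assert (Hd := Hnd x1 x2 H). split.
    - apply NNPP. intros Hn. apply Hd. right; left. split; auto.
      intros (t & e & (R1 & R2 & R3 & R4) & Ht & _). unfold vline in *.
      (* A column run has two ends, and the one reached by moving into the half-plane would be a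
         sign change inside it. *)
      destruct (Z.le_gt_cases 0 b) as [Hb|Hb].
      + apply R2. apply Hcol'; nia.
      + apply R3. apply Hcol'; nia.
    - intros Hm. apply Hd. right; right; left. exact Hm. }
  destruct (Z.eq_dec b 0) as [Eb|Nb].
  - subst b.
    assert (Ha : (a <> 0)%Z) by (destruct Hab; auto; lia).
    destruct (equal_runs_stripe opt (hline s 0) (fun i => (a * i < kap)%Z) (- Z.sgn a * (Z.abs kap + 1))%Z) as (d & c & H1 & H2).
    + replace (a * (- Z.sgn a * (Z.abs kap + 1)))%Z with (- (Z.sgn a * a) * (Z.abs kap + 1))%Z by ring.
      rewrite Z.mul_comm with (n := Z.sgn a). rewrite Z.sgn_abs. nia.
    + intros i j k Hi Hk Hj. destruct (Z.le_gt_cases 0 a); nia.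
    + intros i Hi. apply Hrow. lia.
    + intros i Hi. apply Hrow. lia.
    + exists d, c. split; auto. intros x1 x2 Hx. rewrite <- H2 by lia. apply Hcol'; lia.
  - set (depth := fun i R : Z => (- Z.sgn b * (Z.abs a * (Z.abs i + R) + Z.abs kap + 1))%Z).
    assert (Hdepth : forall i R k, (Z.abs (k - i) <= R)%Z -> (a * k + b * depth i R < kap)%Z).
    { intros i R k Hk. unfold depth.
      replace (b * (- Z.sgn b * (Z.abs a * (Z.abs i + R) + Z.abs kap + 1)))%Z with (- (Z.sgn b * b) * (Z.abs a * (Z.abs i + R) + Z.abs kap + 1))%Z by ring.
      rewrite Z.mul_comm with (n := Z.sgn b). rewrite Z.sgn_abs.
      assert (Hk2 : (Z.abs k <= Z.abs i + R)%Z) by lia.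
      assert (H1 : (a * k <= Z.abs a * (Z.abs i + R))%Z).
      { apply Z.le_trans with (Z.abs a * Z.abs k)%Z; [rewrite <- Z.abs_mul; lia|]. apply Z.mul_le_mono_nonneg_l; lia. }
      assert (0 <= Z.abs a * (Z.abs i + R))%Z by (apply Z.mul_nonneg_nonneg; lia).
      assert (1 <= Z.abs b)%Z by lia. nia. }
    set (f := fun i => s (i, depth i 0%Z)).
    assert (Hf : forall i x2, (a * i + b * x2 < kap)%Z -> f i = s (i, x2)).
    { intros i x2 H. unfold f. apply Hcol'; auto. apply Hdepth. lia. }
    (* A radius ample for two optimal runs meeting at i together with their end sites. *)
    set (R := (2 * Z.of_nat W + 4)%Z).
    assert (Hfl : forall i k, (Z.abs (k - i) <= R)%Z -> f k = hline s (depth i R) k).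
    { intros i k Hk. unfold hline. apply Hf. now apply Hdepth. }
    destruct (equal_runs_stripe opt f (fun _ => True) 0%Z) as (d & c & H1 & H2); auto.
    + intros i _. destruct (Hrow i (depth i R)) as [(t & e & Hr & Ht & Ho) _]; [apply Hdepth; unfold R; lia|].
      exists t, e. split; [|auto]. assert (Hw := HW _ Ho). apply (zrun_ext _ _ _ _ Hr).
      intros k Hk. symmetry. apply Hfl. unfold R. lia.
    + intros i _ (r & e & Hr1 & Hr2 & Ho1 & Ho2 & Hne).
      destruct (Hrow i (depth i R)) as [_ Hm]; [apply Hdepth; unfold R; lia|]. apply Hm.
      assert (Hw1 := HW _ Ho1). assert (Hw2 := HW _ Ho2). assert (G1 := proj1 Hr1). assert (G2 := proj1 Hr2).
      exists r, e. split; [|split; [|auto]].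
      * apply (zrun_ext _ _ _ _ Hr1). intros k Hk. apply Hfl. unfold R. lia.
      * apply (zrun_ext _ _ _ _ Hr2). intros k Hk. apply Hfl. unfold R. lia.
    + exists d, c. split; auto. intros x1 x2 Hx. rewrite <- H2 by auto. symmetry. now apply Hf.
Qed.

(** Once a horizontal wall is present, [walls_parallel] excludes vertical ones, and exchanging the
    coordinates reduces to constant columns. *)
Lemma half_plane_stripes s a b kap : (a <> 0 \/ b <> 0)%Z ->
  (forall x1 x2, s ((x1 + b)%Z, (x2 - a)%Z) = s (x1, x2)) ->
  (forall x1 x2, (a * x1 + b * x2 < kap)%Z -> ~ defect opt s x1 x2) ->
  exists d c, opt d /\
    ((forall x1 x2, (a * x1 + b * x2 < kap)%Z -> s (x1, x2) = stZ d (x1 + c)) \/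
     (forall x1 x2, (a * x1 + b * x2 < kap)%Z -> s (x1, x2) = stZ d (x2 + c))).
Proof.
  intros Hab Hinv Hnd.
  assert (Hnc : forall x1 x2, (a * x1 + b * x2 < kap)%Z -> ~ corner_site s x1 x2).
  { intros x1 x2 H Hc. apply (Hnd x1 x2 H). now left. }
  destruct (classic (forall x1 x2, (a * x1 + b * x2 < kap)%Z -> (a * x1 + b * (x2 + 1) < kap)%Z -> s (x1, x2) = s (x1, (x2 + 1)%Z))) as [Hv|Hv].
  - destruct (column_stripes s a b kap Hab Hnd Hv) as (d & c & H1 & H2). exists d, c. auto.
  - assert (Hh : forall x1 x2, (a * x1 + b * x2 < kap)%Z -> (a * (x1 + 1) + b * x2 < kap)%Z -> s (x1, x2) = s ((x1 + 1)%Z, x2)).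
    { intros x1 x2 H1 H2. apply NNPP. intros Hne. apply Hv. intros y1 y2 G1 G2. apply NNPP. intros Hne'.
      exact (walls_parallel s a b kap Hnc Hinv x1 x2 y1 y2 H1 H2 G1 G2 Hne Hne'). }
    destruct (column_stripes (swap_config s) b a kap) as (d & c & H1 & H2); [tauto| | |].
    + intros x1 x2 H Hd. apply defect_swap in Hd. revert Hd. apply Hnd. lia.
    + intros x1 x2 G1 G2. unfold swap_config. simpl. apply Hh; lia.
    + exists d, c. split; auto. right. intros x1 x2 H. specialize (H2 x2 x1 ltac:(lia)). exact H2.
Qed.

End HalfPlane.

(** * From half-planes without defects to optimal striped configurations *)

Lemma half_plane_optimal p (hp : 4 < p) J opt W s a b kap : (forall d, opt d -> optimal_width p J d) ->
  (forall d, opt d -> (1 <= d <= W)%nat) -> (a <> 0 \/ b <> 0)%Z ->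
  (forall x1 x2, s ((x1 + b)%Z, (x2 - a)%Z) = s (x1, x2)) ->
  (forall x1 x2, (a * x1 + b * x2 < kap)%Z -> ~ defect opt s x1 x2) ->
  exists t, optimal_striped J p t /\ forall x1 x2, (a * x1 + b * x2 < kap)%Z -> s (x1, x2) = t (x1, x2).
Proof.
  intros Hopt HW Hab Hinv Hnd.
  destruct (half_plane_stripes opt W HW s a b kap Hab Hinv Hnd) as (d & c & Hd & [H|H]); apply Hopt in Hd.
  - exists (fun x => stripe d ((fst x + c)%Z, (snd x + 0)%Z)). split.
    + exists d. split; [now apply optimal_width_minimizer|]. exists 0%nat, (c, 0%Z). reflexivity.
    + intros x1 x2 Hx. rewrite stripe_stZ by apply Hd. simpl fst. auto.
  - exists (fun x => stripe d ((snd x + c)%Z, (- fst x + 0)%Z)). split.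
    (* Three quarter turns send (x1, x2) to (x2, -x1), which makes the second coordinate the
       first. *)
    + exists d. split; [now apply optimal_width_minimizer|]. exists 3%nat, (c, 0%Z). intros x. unfold rot. simpl.
      now rewrite Z.opp_involutive.
    + intros x1 x2 Hx. rewrite stripe_stZ by apply Hd. simpl fst. auto.
Qed.

Theorem theorem2 (p : R) (hp : 4 < p) :
  exists eps : R, 0 < eps /\
  forall J : R, 0 < J -> Jc p - eps < J -> J < Jc p ->
  forall (s : config) (n : site),
    ground_state J p s ->
    n <> (0%Z, 0%Z) ->
    translation_invariant s n ->
    exists k1 k2 : Z, (k1 < k2)%Z /\
      (exists t1 : config, optimal_striped J p t1 /\
         forall x : site, (dot_perp x n < k1)%Z -> s x = t1 x) /\
      (exists t2 : config, optimal_striped J p t2 /\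
         forall x : site, (k2 < dot_perp x n)%Z -> s x = t2 x).
Proof.
  rewrite Jc_eq_jc by auto.
  destruct (small_tau p hp) as (eps & Heps & Hsmall). exists eps. split; auto.
  intros J HJ HJ1 HJ2 s n Hgs Hn Hinv.
  destruct (Hsmall J HJ1 HJ2) as (Ht & d0 & Hd0 & Hdens).
  destruct (stripe_constants p hp J d0 HJ2 Ht Hd0 Hdens)
    as (hs & estar & eta & kappa & D & W & [Hhs Hhs2] & He & Hneg & Heta & Hkap & Hmin & Hgap & H3 & HD1 & HD2 & HW & Hpen).
  set (opt := fun d => (1 <= d)%nat /\ density p J d = estar).
  assert (Hiff : forall d, opt d -> optimal_width p J d).
  { intros d [H1 H2]. split; auto. intros d' Hd'. rewrite H2. auto. }
  assert (HWo : forall d, opt d -> (1 <= d <= W)%nat).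
  { intros d Hd. split; [apply Hd|apply HW; auto]. }
  subst estar.
  destruct (defect_weight_bound p hp J hs eta kappa D HJ (Rlt_le _ _ HJ2) Hhs Hneg Hmin Heta Hkap Hgap H3 HD1 HD2) as (C & HC & Hbound).
  { intros d d' Hd Hd' Hne. apply Hpen; auto. }
  fold opt in Hbound.
  destruct (defects_in_strip opt W s n C hs HWo Hhs Hinv Hn HC (fun M => Hbound s M Hgs)) as (K & HK & Hstrip).
  destruct n as [n1 n2].
  assert (Hn' : (n1 <> 0 \/ n2 <> 0)%Z).
  { destruct (Z.eq_dec n1 0); [right|now left]. intros ->. apply Hn. congruence. }
  assert (Hinv1 : forall x1 x2, s ((x1 + n1)%Z, (x2 + n2)%Z) = s (x1, x2)) by (intros; apply (Hinv (x1, x2))).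
  exists (- K)%Z, K. split; [lia|]. split.
  (* With a = -n2 and b = n1, a x1 + b x2 is [dot_perp] and (b, -a) is n. The opposite half-plane
     takes the negatives and the translation by -n. *)
  - destruct (half_plane_optimal p hp J opt W s (- n2) n1 (- K)) as (t & Ht1 & Ht2); auto; [lia| | |].
    + intros x1 x2. rewrite <- (Hinv1 x1 x2). f_equal. f_equal. ring.
    + intros x1 x2 Hx Hd. specialize (Hstrip (x1, x2) Hd). unfold dot_perp in Hstrip. simpl in Hstrip. lia.
    + exists t. split; auto. intros [x1 x2] Hx. apply Ht2. unfold dot_perp in Hx. simpl in Hx. lia.
  - destruct (half_plane_optimal p hp J opt W s n2 (- n1) (- K)) as (t & Ht1 & Ht2); auto; [lia| | |].
    + intros x1 x2. rewrite <- (Hinv1 (x1 + - n1)%Z (x2 - n2)%Z). f_equal. f_equal; ring.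
    + intros x1 x2 Hx Hd. specialize (Hstrip (x1, x2) Hd). unfold dot_perp in Hstrip. simpl in Hstrip. lia.
    + exists t. split; auto. intros [x1 x2] Hx. apply Ht2. unfold dot_perp in Hx. simpl in Hx. lia.
Qed.
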